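(* Let $F$ be a $C^2$ partially hyperbolic endomorphism of a compact smooth Riemannian manifold $M$. Assume that (a) $F$ has a physical measure $\mu$; (b) $F$ has a $C^1$ invariant foliation $\mathscr W$ with leaves of uniformly bounded volume; (c) for each leaf $W\in\mathscr W$ the restriction $F_W:W\to F(W)$ is a 1-1 map; (d) the leafwise volume Lyapunov exponent $\chi_{\mathscr W}$ with respect to $\mu$ is strictly positive. Then the foliation $\mathscr W$ is not absolutely continuous.
   Context: Partially hyperbolic endomorphism: a local diffeomorphism $F:M\to M$ (possibly non-invertible) whose lift $\tilde F$ to the universal cover $\tilde M$ admits constants $0<\lambda_1\le\lambda_2<\mu_1\le\mu_2$, $\mu_1>1$, $C\ge1$ and $D\tilde F$-invariant distributions with $T_{\tilde z}\tilde M=\tilde E^c(\tilde z)\oplus\tilde E^u(\tilde z)$ and, for all $n>0$, $C^{-1}\lambda_1^n\|v\|\le\|D\tilde F^nv\|\le C\lambda_2^n\|v\|$ on $\tilde E^c$, $C^{-1}\mu_1^n\|v\|\le\|D\tilde F^nv\|\le C\mu_2^n\|v\|$ on $\tilde E^u$. A $k$-dimensional $C^r$ foliation ($r\ge1$) of an $m$-manifold $M$ is a partition into $k$-dimensional complete connected $C^1$ submanifolds (leaves) $W(z)\ni z$ depending continuously on $z$, such that each $z$ has a neighbourhood $U$ and a homeomorphism $\phi:D^k\times D^{m-k}\to U$ ($D^n$ the open unit ball of $\mathbb R^n$; $(U,\phi)$ is a foliation box) with $\phi(\cdot,p)$ a $C^r$ diffeomorphism onto a piece (local leaf) of $W(\phi(0,p))$,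 depending continuously on $p$ in the $C^1$ topology. $\mathscr W$ is invariant under $F$ if the image of every sufficiently small local leaf is a local leaf. For an invariant foliation and an $F$-invariant measure $\mu$, the leafwise volume Lyapunov exponent is $\chi_{\mathscr W}(z)=\lim_{n\to\infty}\frac1n\log|\det DF^n|_{T_z\mathscr W}(z)|$, defined $\mu$-a.e. A foliation is absolutely continuous if for Lebesgue-a.e. $z\in M$ the conditional measure on the leaf $W(z)$, coming from the disintegration of Lebesgue measure (Riemannian volume) in foliation boxes, is absolutely continuous with respect to the induced Riemannian volume $\mathrm{Leb}_{W(z)}$ on the leaf. A probability measure $\mu$ is physical if, for $z$ in a set of positive Lebesgue measure, $\lim_n\frac1n\sum_{k=0}^{n-1}g(F^kz)=\mu(g)$ for all continuous $g$. *)

(* Defs.v *)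
From HB Require Import structures.
From mathcomp Require Import all_boot all_order all_algebra.
From mathcomp Require Import all_classical all_reals all_analysis.

Set Implicit Arguments.
Unset Strict Implicit.
Unset Printing Implicit Defensive.

Import Order.TTheory GRing.Theory Num.Theory.
Import numFieldNormedType.Exports.

Local Open Scope classical_set_scope.
Local Open Scope ring_scope.

(* Class C^r on an open set U of a finite-dimensional space. *)
Fixpoint Ck {R : realType} {V W : normedModType R} (r : nat) (U : set V)
    (f : V -> W) : Prop :=
  match r with
  | 0 => forall x, U x -> {for x, continuous f}
  | s.+1 => (forall x, U x -> differentiable f x) /\
            forall v, Ck s U (fun x => 'D_v f x)
  end.

(* The open Euclidean unit ball (the library norm on 'rV is the sup norm). *)
Definition disc (R : realType) (n : nat) : set 'rV[R]_n :=
  [set x | \sum_i x ord0 i ^+ 2 < 1].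
Arguments disc R n : clear implicits.

Definition borel (T : ptopologicalType) := g_sigma_algebraType (@open T).

(* Lebesgue measure of Borel subsets of R^n, by Cavalieri's principle (the
   formula by which the library defines product measures). *)
Fixpoint leb_rV (R : realType) (n : nat) : set 'rV[R]_n -> \bar R :=
  match n with
  | 0 => fun A => (\1_A (0 : 'rV[R]_0))%:E
  | p.+1 => fun A => (\int[lebesgue_measure]_t
      leb_rV [set v : 'rV[R]_p | A (row_mx (t%:M : 'rV[R]_1) v)])%E
  end.

Definition lebesgue_rV (R : realType) (n : nat) : set (borel 'rV[R]_n) -> \bar R :=
  @leb_rV R n.
Arguments lebesgue_rV R n : clear implicits.

(* A C^infinity Riemannian manifold without boundary of dimension m.
   An atlas is indexed by the points: [chart z], defined on the neighbourhood
   [cdom z] of z, has inverse [param z].  A tangent vector at z is represented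
   by the row of its coordinates in [chart z]; [metric z] is the Gram matrix of
   the inner product at z in these coordinates. *)
Record rmanifold (R : realType) (m : nat) := RManifold {
  mcar :> ptopologicalType ;
  cdom : mcar -> set mcar ;
  chart : mcar -> mcar -> 'rV[R]_m ;
  param : mcar -> 'rV[R]_m -> mcar ;
  metric : mcar -> 'M[R]_m ;
  mfd_hausdorff : hausdorff_space mcar ;
  mfd_second_countable : @second_countable mcar ;
  cdom_open : forall z, open (cdom z) ;
  cdom_refl : forall z, cdom z z ;
  chart_open : forall z, open (chart z @` cdom z) ;
  chartK : forall z y, cdom z y -> param z (chart z y) = y ;
  chart_continuous : forall z y, cdom z y -> {for y, continuous (chart z)} ;
  param_continuous : forall z x, (chart z @` cdom z) x ->
    {for x, continuous (param z)} ;
  transition_smooth : forall z w r,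
    Ck r (chart z @` (cdom z `&` cdom w)) (chart w \o param z) ;
  metric_sym : forall z, (metric z)^T = metric z ;
  metric_pos : forall z (v : 'rV[R]_m), v != 0 ->
    0 < (v *m metric z *m v^T) ord0 ord0 ;
  (* the Gram matrix of the coordinate frame of [chart z] *)
  metric_smooth : forall z r, Ck r (chart z @` cdom z) (fun x =>
    let y := param z x in
    let J := 'J (chart y \o param z) x in
    J *m metric y *m J^T)
}.

Section calculus.
Context {R : realType}.

Definition rnorm m (M : rmanifold R m) (z : M) (v : 'rV[R]_m) : R :=
  Num.sqrt ((v *m metric z *m v^T) ord0 ord0).

(* Class C^r for a map from an open subset U of a vector space to M. *)
Definition Ck_param m (M : rmanifold R m) (V : normedModType R) (r : nat)
    (U : set V) (s : V -> M) : Prop :=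
  (forall x, U x -> {for x, continuous s}) /\
  forall z, Ck r (U `&` s @^-1` cdom z) (chart z \o s).

(* Rows: the coordinates of the images of the basis vectors. *)
Definition dparam m (M : rmanifold R m) k (s : 'rV[R]_k -> M)
    (x : 'rV[R]_k) : 'M[R]_(k, m) := 'J (chart (s x) \o s) x.

Definition velocity m (M : rmanifold R m) (c : R -> M) (t : R) : 'rV[R]_m :=
  'D_1 (chart (c t) \o c) t.

(* Class C^r for a map from an open subset A of M to N. *)
Definition Ck_map m n (M : rmanifold R m) (N : rmanifold R n) (r : nat)
    (A : set M) (F : M -> N) : Prop :=
  (forall z, A z -> {for z, continuous F}) /\
  forall z w, Ck r (chart z @` (cdom z `&` A `&` F @^-1` cdom w))
                   (chart w \o F \o param z).

(* The matrix of T_z F, acting on row vectors on the right. *)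
Definition dmap m n (M : rmanifold R m) (N : rmanifold R n) (F : M -> N)
    (z : M) : 'M[R]_(m, n) := 'J (chart (F z) \o F \o param z) (chart z z).

Definition local_diffeo m (M N : rmanifold R m) (r : nat) (F : M -> N) : Prop :=
  Ck_map r [set: M] F /\
  forall z, exists (V : set M) (G : N -> M),
    [/\ open_nbhs z V, open (F @` V), (forall y, V y -> G (F y) = y)
      & Ck_map r (F @` V) G].

End calculus.

Section partial_hyperbolicity.
Context {R : realType}.

Definition simply_connected (T : topologicalType) : Prop :=
  (forall x y : T, exists c : R -> T,
     [/\ continuous c, c 0 = x & c 1 = y]) /\
  (forall c : R -> T, {within `[0, 1], continuous c} -> c 0 = c 1 ->
     exists H : R * R -> T,
       [/\ {within `[0, 1] `*` `[0, 1], continuous H},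
           (forall t, 0 <= t <= 1 -> H (0, t) = c t),
           (forall t, 0 <= t <= 1 -> H (1, t) = c 0)
         & (forall s, 0 <= s <= 1 -> H (s, 0) = c 0 /\ H (s, 1) = c 0)]).

Definition covering (T X : topologicalType) (pi : T -> X) : Prop :=
  [/\ continuous pi, range pi = [set: X] &
   forall z, exists (U : set X) (S : set (set T)),
     [/\ open_nbhs z U, pi @^-1` U = \bigcup_(V in S) V, trivIset S id &
      forall V, S V ->
        [/\ open V, pi @` V = U, set_inj V pi
          & forall O, open O -> O `<=` V -> open (pi @` O)]]].

(* Mt carries the smooth structure and the metric lifted from M. *)
Definition universal_cover m (Mt M : rmanifold R m) (pi : Mt -> M) : Prop :=
  [/\ covering pi, simply_connected Mt, (forall r, local_diffeo r pi) &
   forall z, metric z = dmap pi z *m metric (pi z) *m (dmap pi z)^T].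

(* Subspaces of T_z M are represented by the row spaces of m x m matrices.
   Continuity in z is not demanded: for the two distributions of a partially
   hyperbolic endomorphism it follows from the growth bounds. *)
Definition distribution m (M : rmanifold R m) (E : M -> 'M[R]_m) : Prop :=
  exists d, forall z, \rank (E z) = d.

Definition invariant_distribution m (M : rmanifold R m) (F : M -> M)
    (E : M -> 'M[R]_m) : Prop :=
  forall z, (E z *m dmap F z :=: E (F z))%MS.

Definition growth_between m (M : rmanifold R m) (F : M -> M)
    (E : M -> 'M[R]_m) (C a b : R) : Prop :=
  forall (n : nat) (z : M) (v : 'rV[R]_m), (0 < n)%N -> (v <= E z)%MS ->
    C^-1 * a ^+ n * rnorm z v <= rnorm (iter n F z) (v *m dmap (iter n F) z)
    <= C * b ^+ n * rnorm z v.

Definition partially_hyperbolic m (M : rmanifold R m) (F : M -> M) : Prop :=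
  local_diffeo 1 F /\
  exists (Mt : rmanifold R m) (pi : Mt -> M) (Ft : Mt -> Mt),
    [/\ universal_cover pi, continuous Ft, pi \o Ft = F \o pi &
    exists (l1 l2 u1 u2 C : R) (Ec Eu : Mt -> 'M[R]_m),
      [/\ [/\ 0 < l1, l1 <= l2, l2 < u1 & u1 <= u2], 1 < u1, 1 <= C &
       [/\ distribution Ec /\ invariant_distribution Ft Ec,
           distribution Eu /\ invariant_distribution Ft Eu,
           (forall z, (Ec z + Eu z :=: (1%:M : 'M[R]_m))%MS /\
                      mxdirect (Ec z + Eu z)),
           growth_between Ft Ec C l1 l2
         & growth_between Ft Eu C u1 u2]]].

End partial_hyperbolicity.

Section volume.
Context {R : realType} {m : nat} (M : rmanifold R m).

(* Riemannian volume density of a k-dimensional parametrized patch. *)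
Definition vol_density k (s : 'rV[R]_k -> M) (x : 'rV[R]_k) : R :=
  Num.sqrt (\det (dparam s x *m metric (s x) *m (dparam s x)^T)).

(* The k-dimensional Riemannian volume of a set A covered by the patches
   s(D), (D, s) in P, where P is the family of parametrizations of a
   k-dimensional submanifold: the outer measure generated by the formula
   vol (s(B)) = \int_B (density of s).  It is the Riemannian measure on Borel
   subsets of the submanifold. *)
Definition patch_vol k (P : set (set 'rV[R]_k * ('rV[R]_k -> M)))
    (A : set M) : \bar R :=
  ereal_inf [set v | exists (B : nat -> set (borel 'rV[R]_k))
                            (s : nat -> 'rV[R]_k -> M),
    [/\ (forall i, measurable (B i) /\ exists2 D, P (D, s i) & B i `<=` D),
        A `<=` \bigcup_i (s i @` B i) &
        v = (\sum_(i <oo)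
          \int[lebesgue_rV R k]_(x in B i) (vol_density (s i) x)%:E)%E]].

Definition vol : set M -> \bar R :=
  patch_vol [set p | exists z : M, p = (chart z @` cdom z, param z)].

End volume.

Section foliation.
Context {R : realType} {m : nat} (M : rmanifold R m) (k : nat).

(* An injectively immersed submanifold L of M is given with a family P of
   parametrizations of its pieces by the unit ball.  Its intrinsic topology is
   in general finer than the topology induced by M. *)
Definition leaf_open (P : set ('rV[R]_k -> M)) (V : set M) : Prop :=
  forall s, P s -> open (disc R k `&` s @^-1` V).

(* s is a C^r diffeomorphism of the unit ball onto an open piece of L. *)
Definition leaf_chart (r : nat) (L : set M) (P : set ('rV[R]_k -> M))
    (s : 'rV[R]_k -> M) : Prop :=
  [/\ s @` disc R k `<=` L, set_inj (disc R k) s, Ck_param r (disc R k) s,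
      (forall x, disc R k x -> \rank (dparam s x) = k) &
      (forall O, open O -> O `<=` disc R k -> leaf_open P (s @` O)) /\
      (forall V, leaf_open P V -> open (disc R k `&` s @^-1` V))].

Definition submanifold (r : nat) (L : set M) (P : set ('rV[R]_k -> M)) : Prop :=
  P `<=` leaf_chart r L P /\
  exists Q, [/\ Q `<=` P, countable Q & L `<=` \bigcup_(s in Q) (s @` disc R k)].

Definition leaf_connected (L : set M) (P : set ('rV[R]_k -> M)) : Prop :=
  forall V, V `<=` L -> leaf_open P V -> leaf_open P (L `\` V) ->
    V = set0 \/ V = L.

(* The distance in L between x and y (the infimum of the lengths of the C^1
   curves of L from x to y) is less than e. *)
Definition leaf_dist_lt (L : set M) (P : set ('rV[R]_k -> M)) (e : R)
    (x y : M) : Prop :=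
  exists c : R -> M,
    [/\ (forall t, L (c t)), (forall V, leaf_open P V -> open (c @^-1` V)),
        @Ck_param R m M R^o 1 [set: R] c, c 0 = x /\ c 1 = y &
        (\int[lebesgue_measure]_(t in `[0%R, 1%R])
            (rnorm (c t) (velocity c t))%:E < e%:E)%E].

Definition leaf_complete (L : set M) (P : set ('rV[R]_k -> M)) : Prop :=
  forall u : nat -> M, (forall n, L (u n)) ->
    (forall e : R, 0 < e -> exists N, forall i j, (N <= i)%N -> (N <= j)%N ->
       leaf_dist_lt L P e (u i) (u j)) ->
    exists2 x, L x & forall e : R, 0 < e ->
      exists N, forall i, (N <= i)%N -> leaf_dist_lt L P e (u i) x.

(* phi is a homeomorphism from the product of balls onto the open set
   U = phi (D^k x D^(m-k)); the last item (joint continuity of the derivative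
   along the first factor) is the continuous dependence of phi(., p) on p in
   the C^1 topology. *)
Definition foliation_box (r : nat) (leaf : M -> set M)
    (lpar : M -> set ('rV[R]_k -> M))
    (phi : 'rV[R]_k * 'rV[R]_(m - k) -> M) : Prop :=
  let D := disc R k `*` disc R (m - k) in
  [/\ set_inj D phi, (forall q, D q -> {for q, continuous phi}),
      (forall O, open O -> O `<=` D -> open (phi @` O)),
      (forall p, disc R (m - k) p ->
         leaf_chart r (leaf (phi (0, p))) (lpar (phi (0, p)))
           (fun x => phi (x, p))) &
      forall z v q, D q -> cdom z (phi q) -> {for q, continuous
        (fun q' : 'rV[R]_k * 'rV[R]_(m - k) =>
           'D_v (fun x => chart z (phi (x, q'.2))) q'.1)}].

(* A k-dimensional C^r foliation; [leaf z] is the leaf through z, and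
   [leaf_par z] its structure of C^1 submanifold.  Continuous dependence of the
   leaves on the point is expressed by the foliation boxes. *)
Record foliation (r : nat) := Foliation {
  leaf : M -> set M ;
  leaf_par : M -> set ('rV[R]_k -> M) ;
  leaf_dim : (k <= m)%N ;
  leaf_refl : forall z, leaf z z ;
  leaf_eq : forall z y, leaf z y -> leaf y = leaf z ;
  leaf_par_eq : forall z y, leaf z y -> leaf_par y = leaf_par z ;
  leaf_submanifold : forall z, submanifold 1 (leaf z) (leaf_par z) ;
  leaf_is_connected : forall z, leaf_connected (leaf z) (leaf_par z) ;
  leaf_is_complete : forall z, leaf_complete (leaf z) (leaf_par z) ;
  leaf_box : forall z, exists2 phi, foliation_box r leaf leaf_par phi &
    (phi @` (disc R k `*` disc R (m - k))) z
}.

Definition plaque (phi : 'rV[R]_k * 'rV[R]_(m - k) -> M)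
    (p : 'rV[R]_(m - k)) : set M := (fun x => phi (x, p)) @` disc R k.

Definition local_leaf r (W : foliation r) (L : set M) : Prop :=
  exists phi p, [/\ foliation_box r (leaf W) (leaf_par W) phi,
    disc R (m - k) p & L = plaque phi p].

Definition invariant_foliation r (W : foliation r) (F : M -> M) : Prop :=
  forall z, exists2 V, open_nbhs z V &
    forall L, local_leaf W L -> L `<=` V -> local_leaf W (F @` L).

(* Riemannian volume on the leaf through z. *)
Definition leaf_vol r (W : foliation r) (z : M) (A : set (borel M)) : \bar R :=
  patch_vol [set p | p.1 = disc R k /\ leaf_par W z p.2] (A `&` leaf W z).

(* kappa is the family of conditional measures of the Riemannian volume of the
   box phi along its plaques, nu being the measure induced on the
   transversal. *)
Definition disintegration (phi : 'rV[R]_k * 'rV[R]_(m - k) -> M)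
    (nu : {measure set (borel 'rV[R]_(m - k)) -> \bar R})
    (kappa : R.-pker (borel 'rV[R]_(m - k)) ~> (borel M)) : Prop :=
  let D := disc R (m - k) in
  [/\ (forall B, measurable B -> nu B = vol (phi @` (disc R k `*` (D `&` B)))),
      (\forall p \ae nu, kappa p (plaque phi p) = 1%E) &
      forall A : set (borel M), measurable A ->
        vol (A `&` (phi @` (disc R k `*` D))) = (\int[nu]_p kappa p A)%E].

Definition absolutely_continuous r (W : foliation r) : Prop :=
  forall phi, foliation_box r (leaf W) (leaf_par W) phi ->
    exists nu kappa, disintegration phi nu kappa /\
      vol [set z | exists x p, [/\ disc R k x, disc R (m - k) p,
             z = phi (x, p) & ~ (kappa p `<< leaf_vol W z)]] = 0%E.

End foliation.

Section lyapunov.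
Context {R : realType} {m : nat} {M : rmanifold R m} {k : nat}.

(* A basis of T_z W, in rows. *)
Definition tangent_frame r (W : foliation M k r) (z : M) : 'M[R]_(k, m) :=
  xget 0 [set E | exists s x,
    [/\ leaf_par W z s, disc R k x, s x = z & E = dparam s x]].

(* |det DG| on T_z W, with respect to the Riemannian inner products of T_z W
   and of its image. *)
Definition leaf_det r (W : foliation M k r) (G : M -> M) (z : M) : R :=
  let E := tangent_frame W z in
  let EG := E *m dmap G z in
  Num.sqrt (\det (EG *m metric (G z) *m EG^T)) /
  Num.sqrt (\det (E *m metric z *m E^T)).

Definition is_leaf_exponent r (W : foliation M k r) (F : M -> M) (z : M)
    (chi : R) : Prop :=
  (fun n => ln (leaf_det W (iter n F) z) / n%:R) @ \oo --> chi.

Definition basin (F : M -> M) (mu : probability (borel M) R) : set M :=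
  [set z | forall g : M -> R, continuous g ->
     (fun n => n%:R^-1 * \sum_(0 <= i < n) g (iter i F z)) @ \oo -->
       \int[mu]_x g x].

Definition physical (F : M -> M) (mu : probability (borel M) R) : Prop :=
  (0 < vol (basin F mu))%E.

End lyapunov.

(* Main.v *)
Require Import Defs.
From HB Require Import structures.
From mathcomp Require Import all_boot all_order all_fingroup all_algebra.
From mathcomp Require Import all_classical all_reals all_analysis.
From mathcomp Require Import measurable_realfun zify ring lra.
Set Implicit Arguments.
Unset Strict Implicit.
Unset Printing Implicit Defensive.
Import Order.TTheory GRing.Theory Num.Theory.
Import numFieldNormedType.Exports.
Local Open Scope classical_set_scope.
Local Open Scope ring_scope.

(** The theorem holds because the map expands volume along the leaves at an
exponential rate on a set of positive volume, while a leaf has bounded volume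
and is mapped injectively.

Let [g] be the logarithm of the leafwise volume expansion of [F].  It is
continuous ([leaf_det_continuous]), because a foliation box provides tangent
frames of the leaves that vary continuously and the expansion does not depend
on the frame.  By the chain rule, the logarithm of the leafwise expansion of
[F^n] is the Birkhoff sum [S_n g] ([ln_leaf_det_iter]).  Since the basin of [mu]
is not empty, [mu] gives the same integral to a continuous function [u] and to
[u \o F]; so [S_n g / n] and [g] have the same integral.  The averages [S_n g / n]
converge almost everywhere to the leafwise exponent, which is positive, and
dominated convergence shows that the integral of [g] is positive
([basin_Rintegral_gt0]).

Let [a] be half of this integral.  Every point [z] of the basin satisfies
[S_n g z >= n a] for all large [n], so the basin is covered by the closed sets
[late_growth F g a N] of the points for which this inequality holds from time [N]
on, and one of them, say [B], has positive volume.  If the foliation were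
absolutely continuous, [B] would meet some leaf in a set of positive leaf volume
([leaf_vol_gt0]).  But [F^n] is injective on this leaf, maps it into a leaf of
volume at most [C] and multiplies leaf volume by at least [exp (n a)] on [B].
Hence the part of the leaf in [B] has volume at most [K (C + 1) exp (- n a)], where
[K] depends on the dimension of the leaves only ([leaf_vol_growth]), and it
vanishes in the limit.

The analytic part is thus a change of variables inequality, in which a constant
factor is harmless.  Leaf volume is defined by coverings with patches.  A patch
[s] of the image leaf is pulled back to a patch [t] of the leaf by the map
[h = s^-1 \o F^n \o t] between open sets of [R^k].  Near a point with differential
[A], the map [h] followed by the inverse of [A] contracts distances by at most a
factor 2 ([sdiff_co_lipschitz]), so preimages of small cubes under it have
comparable diameter, and preimages of Borel sets have comparable measure
([lebesgue_co_lipschitz]).  A linear map divides the measure of preimages by the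
modulus of its determinant, up to a constant ([lebesgue_rV_linear]), which is
obtained from a factorization into triangular and permutation matrices. *)

(** * Norms and limits of matrices *)

Section norm_matrix.
Context {R : realType} {m n : nat}.
Implicit Types x : 'M[R]_(m, n).

Lemma coord_le_norm x i j : `|x i j| <= `|x|.
Proof.
rewrite {2}/Num.norm/= mx_normrE; exact: (le_bigmax _ (fun ij => `|x ij.1 ij.2|) (i, j)).
Qed.

Lemma norm_le_coord x (e : R) : 0 <= e -> (forall i j, `|x i j| <= e) -> `|x| <= e.
Proof.
move=> e0 h; rewrite {1}/Num.norm/= mx_normrE; apply/bigmax_leP; split => // -[i j] _.
Qed.

End norm_matrix.

Section mulmx_analysis.
Context {R : realType}.

Lemma norm_mulmx_le m n (A : 'M[R]_(m, n)) :
  exists2 K : R, 0 < K & forall x : 'rV[R]_m, `|x *m A| <= K * `|x|.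
Proof.
pose K := 1 + \sum_i \sum_j `|A i j|.
have S0 : 0 <= \sum_i \sum_j `|A i j|.
  by apply: sumr_ge0 => i _; exact: sumr_ge0.
have K0 : 0 < K by rewrite ltr_wpDr.
exists K => // x; apply: norm_le_coord => [|i j]; first by rewrite mulr_ge0// ltW.
rewrite (ord1 i) mxE; apply: le_trans (ler_norm_sum _ _ _) _.
apply: (@le_trans _ _ (\sum_k `|A k j| * `|x|)).
  apply: ler_sum => k _; rewrite normrM mulrC ler_wpM2l//; exact: coord_le_norm.
rewrite -mulr_suml ler_wpM2r// ler_wpDl//; apply: ler_sum => k _.
by rewrite (bigD1 j)//= lerDl sumr_ge0.
Qed.

Context {T : Type} {F : set_system T} {FF : Filter F}.

Lemma cvg_matrix m n (f : T -> 'M[R]_(m, n)) (a : 'M[R]_(m, n)) :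
  (forall i j, (fun x => f x i j) @ F --> a i j) -> f @ F --> a.
Proof.
move=> fa A [P Pa PA].
have := @filter_forall T ('I_m * 'I_n)%type (fun ij x => P ij.1 ij.2 (f x ij.1 ij.2)) F _
  (fun ij => fa ij.1 ij.2 _ (Pa _ _)).
rewrite nearE => h; change (F (f @^-1` A)); refine (@filterS _ F FF _ _ _ (h FF)) => {}x {}h.
by apply: PA => i j; exact: (h (i, j)).
Qed.

Lemma cvg_entry m n (f : T -> 'M[R]_(m, n)) (a : 'M[R]_(m, n)) i j :
  f @ F --> a -> (fun x => f x i j) @ F --> a i j.
Proof.
move=> fa; apply: (@cvg_comp _ _ _ f (fun M : 'M[R]_(m, n) => M i j) _ (nbhs a)) => //.
exact: coord_continuous.
Qed.

Lemma cvg_mulmx m n p (f : T -> 'M[R]_(m, n)) (g : T -> 'M[R]_(n, p))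
    (a : 'M[R]_(m, n)) (b : 'M[R]_(n, p)) :
  f @ F --> a -> g @ F --> b -> (fun x => f x *m g x) @ F --> a *m b.
Proof.
move=> fa gb; apply: cvg_matrix => i j; rewrite mxE.
rewrite (_ : (fun x => _) = (fun x => \sum_k f x i k * g x k j)); last first.
  by apply/funext => x; rewrite mxE.
apply: cvg_big => [|k _]; first exact: add_continuous.
by apply: cvgM; exact: cvg_entry.
Qed.

Lemma cvg_trmx m n (f : T -> 'M[R]_(m, n)) (a : 'M[R]_(m, n)) :
  f @ F --> a -> (fun x => (f x)^T) @ F --> a^T.
Proof.
move=> fa; apply: cvg_matrix => i j; rewrite mxE.
rewrite (_ : (fun x => _) = (fun x => f x j i)); first exact: cvg_entry.
by apply/funext => x; rewrite mxE.
Qed.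

Lemma cvg_det n (f : T -> 'M[R]_n) (a : 'M[R]_n) :
  f @ F --> a -> (fun x => \det (f x)) @ F --> \det a.
Proof.
move=> fa; apply: cvg_big => [|s _]; first exact: add_continuous.
apply: cvgM; first exact: cvg_cst.
apply: cvg_big => [|k _]; first exact: mul_continuous.
exact: cvg_entry.
Qed.

End mulmx_analysis.

Lemma continuous_mulmxr (R : realType) m n (A : 'M[R]_(m, n)) :
  continuous (fun x : 'rV[R]_m => x *m A).
Proof.
move=> x; apply: (@cvg_mulmx R _ (nbhs x) _ 1 m n id (fun=> A)); first exact: cvg_id.
exact: cvg_cst.
Qed.

Lemma nbhsI (T : topologicalType) (x : T) (A B : set T) :
  nbhs x A -> nbhs x B -> nbhs x (A `&` B).
Proof. exact: filterI. Qed.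

(** * Positive definite matrices *)

Section positive_definite.
Context {R : realType}.

Definition posdef n (B : 'M[R]_n) :=
  forall v : 'rV[R]_n, v != 0 -> 0 < (v *m B *m v^T) ord0 ord0.

(** The determinant does not vanish on the segment from the identity to [B],
since all matrices of the segment are positive definite; so it keeps the sign
it has at the identity. *)
Lemma posdef_det_gt0 n (B : 'M[R]_n) : posdef B -> 0 < \det B.
Proof.
move=> posB; rewrite ltNge; apply/negP => detB.
(* A negative or zero value at the end point gives a zero in [0, 1], that is, a
   matrix of the segment with a nontrivial kernel. *)
pose f (t : R) := \det ((1 - t) *: 1%:M + t *: B).
have cf : continuous f.
  move=> t; apply: (@cvg_det R _ (nbhs t) _ n (fun t => (1 - t) *: 1%:M + t *: B)).
  apply: cvg_matrix => i j; rewrite !mxE.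
  rewrite (_ : (fun x => _) = (fun x => (1 - x) * (i == j)%:R + x * B i j)); last first.
    by apply/funext => x; rewrite !mxE.
  apply: cvgD; apply: cvgM; try exact: cvg_cst; try exact: cvg_id.
  by apply: cvgB; [exact: cvg_cst|exact: cvg_id].
have f0 : f 0 = 1 by rewrite /f subr0 scale1r scale0r addr0 det1.
have f1 : f 1 = \det B by rewrite /f subrr scale1r scale0r add0r.
have [|c] := @IVT R f 0 1 0 ler01 (continuous_subspaceT cf).
  by rewrite f0 f1 ge_min le_max detB ler01 orbT.
rewrite in_itv/= => /andP[c0 c1] /eqP /det0P[v v0 vM].
have := congr1 (fun u => (u *m v^T) ord0 ord0) vM.
rewrite mul0mx mulmxDr mulmxDl -!scalemxAr -!scalemxAl mulmx1 ![in LHS]mxE [RHS]mxE.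
have vv : 0 < \sum_j v ord0 j * v^T j ord0.
  have : 0 <= \sum_j v ord0 j * v^T j ord0.
    by apply: sumr_ge0 => j _; rewrite mxE -expr2 sqr_ge0.
  rewrite le_eqVlt => /predU1P[|//] /esym/eqP.
  rewrite psumr_eq0 => [/allP h|j _]; last by rewrite mxE -expr2 sqr_ge0.
  case/eqP: v0; apply/rowP => j; rewrite mxE.
  have := h j (mem_index_enum _); rewrite mxE mulf_eq0 orbb => /eqP.
  by [].
have vB := posB v v0; rewrite mxE in vB.
move=> /eqP; apply/negP; rewrite gt_eqF//.
have [c00|c00] := eqVneq c 0; first by rewrite c00 subr0 mul1r mul0r addr0.
by apply: ltr_wpDl; [rewrite mulr_ge0 ?subr_ge0// ltW|rewrite mulr_gt0// lt0r c00].
Qed.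

Lemma posdef_congr k m (E : 'M[R]_(k, m)) (g : 'M[R]_m) :
  row_free E -> posdef g -> posdef (E *m g *m E^T).
Proof.
move=> Efree pg v v0.
have vE0 : v *m E != 0.
  by apply: contra v0 => /eqP vE; apply/eqP/(row_free_inj Efree); rewrite vE mul0mx.
by have := pg _ vE0; rewrite trmx_mul !mulmxA.
Qed.

End positive_definite.

(** * Strict differentiability *)

Section strict_differentiability.
Context {R : realType}.

(** Strict differentiability, in Leach's sense.  Unlike plain differentiability it
controls the increments between any two points near [x], so that local inversion
statements follow from it at a single point, and it is stable under composition
and under passage to a lift. *)
Definition sdiff m n (f : 'rV[R]_m -> 'rV[R]_n) (x : 'rV[R]_m) (A : 'M[R]_(m, n)) :=
  forall e : R, 0 < e -> exists2 U, nbhs x U & forall y z : 'rV[R]_m,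
    U y -> U z -> `|f y - f z - (y - z) *m A| <= e * `|y - z|.

Lemma sdiff_eq_near m n (f g : 'rV[R]_m -> 'rV[R]_n) x A :
  (\forall y \near x, f y = g y) -> sdiff f x A -> sdiff g x A.
Proof.
move=> fg fA e e0.
have [U xU hU] := fA e e0.
exists (U `&` [set y | f y = g y]); first exact: filterI.
by move=> y z [Uy <-] [Uz <-]; exact: hU.
Qed.

Lemma sdiff_lipschitz m n (f : 'rV[R]_m -> 'rV[R]_n) x A : sdiff f x A ->
  exists2 K, 0 < K & exists2 U, nbhs x U & forall y z : 'rV[R]_m, U y -> U z ->
    `|f y - f z| <= K * `|y - z|.
Proof.
move=> /(_ 1 ltr01)[U xU hU].
have [K K0 hK] := norm_mulmx_le A.
exists (1 + K); first by rewrite addr_gt0.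
exists U => // y z Uy Uz.
rewrite -[f y - f z](subrK ((y - z) *m A)) mulrDl.
by apply: le_trans (ler_normD _ _) _; apply: lerD; [exact: hU|exact: hK].
Qed.

Lemma sdiff_continuous m n (f : 'rV[R]_m -> 'rV[R]_n) x A : sdiff f x A ->
  {for x, continuous f}.
Proof.
move=> /sdiff_lipschitz[K K0 [U xU hU]].
apply: (proj2 (@cvgrPdist_le R 'rV[R]_n _ (nbhs x) _ f (f x))) => e e0.
have ballx : nbhs x (ball x (e / K)) by apply: nbhsx_ballx; rewrite divr_gt0.
have : nbhs x (U `&` ball x (e / K)) by exact: filterI.
apply: filterS => y [Uy xy]; apply: le_trans (hU _ _ (nbhs_singleton xU) Uy) _.
by rewrite mulrC -ler_pdivlMr//; apply: ltW; move: xy; rewrite mx_norm_ball.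
Qed.

Lemma sdiff_comp m n p (f : 'rV[R]_m -> 'rV[R]_n) (g : 'rV[R]_n -> 'rV[R]_p) x A B :
  sdiff f x A -> sdiff g (f x) B -> sdiff (g \o f) x (A *m B).
Proof.
move=> fA gB e e0.
have [K K0 [U xU hU]] := sdiff_lipschitz fA.
have [L L0 hL] := norm_mulmx_le B.
have e1 : 0 < e / (2 * K) by rewrite divr_gt0// mulr_gt0.
have e2 : 0 < e / (2 * L) by rewrite divr_gt0// mulr_gt0.
have [V fV hV] := gB _ e1.
have [W xW hW] := fA _ e2.
exists (U `&` W `&` f @^-1` V).
  by apply: filterI; [exact: filterI|exact: (sdiff_continuous fA)].
move=> y z [[Uy Wy] Vy] [[Uz Wz] Vz] /=.
have -> : g (f y) - g (f z) - (y - z) *m (A *m B) =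
    (g (f y) - g (f z) - (f y - f z) *m B) + (f y - f z - (y - z) *m A) *m B.
  by rewrite [X in _ = _ + X]mulmxBl addrA subrK mulmxA.
apply: le_trans (ler_normD _ _) _.
rewrite [e](splitr e) mulrDl; apply: lerD.
  apply: le_trans (hV _ _ Vy Vz) _.
  apply: (@le_trans _ _ (e / (2 * K) * (K * `|y - z|))).
    by apply: ler_wpM2l; [exact: ltW|exact: hU].
  rewrite (_ : _ * (K * _) = e / 2 * `|y - z|)//.
  by field; rewrite gt_eqF.
apply: le_trans (hL _) _.
apply: (@le_trans _ _ (L * (e / (2 * L) * `|y - z|))).
  by rewrite ler_pM2l//; exact: hW.
rewrite (_ : L * (_ * _) = e / 2 * `|y - z|)//.
by field; rewrite gt_eqF.
Qed.

Lemma diff_of_bound (V W : normedModType R) (f : V -> W) (df : {linear V -> W}) x :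
  continuous df ->
  (forall e, 0 < e -> \forall h \near (0 : V), `|f (h + x) - f x - df h| <= e * `|h|) ->
  differentiable f x /\ 'd f x = df :> (V -> W).
Proof.
move=> cdf fx.
have fdf : f \o shift x = cst (f x) + df +o_ 0 id.
  apply/eqaddoP => _/posnumP[e]; rewrite near_simpl.
  have := fx e%:num (ltac:(by [])).
  by apply: filterS => h; rewrite !fctE/= opprD addrA.
have dE := diff_unique cdf fdf.
by split => //; apply/diff_locallyP; rewrite dE.
Qed.

Lemma sdiff_jacobian m n (f : 'rV[R]_m -> 'rV[R]_n) x A : sdiff f x A ->
  differentiable f x /\ 'J f x = A.
Proof.
move=> fA; pose df : {linear 'rV[R]_m -> 'rV[R]_n} := mulmxr A.
have cdf : continuous df by exact: continuous_mulmxr.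
have [|dfx dE] := @diff_of_bound _ _ f df x cdf.
  move=> e e0; have [U xU hU] := fA e e0.
  have : \forall h \near (0 : 'rV[R]_m), U (h + x).
    by rewrite (near_shift x); near do rewrite /= sub0r subrK.
  apply: filterS => h Uh.
  by have := hU _ _ Uh (nbhs_singleton xU); rewrite addrK.
split => //.
by rewrite /jacobian dE; apply/row_matrixP => i; rewrite rowE mul_rV_lin1/= rowE.
Unshelve. all: by end_near. Qed.

Lemma sdiff_J m n (f : 'rV[R]_m -> 'rV[R]_n) x A : sdiff f x A -> sdiff f x ('J f x).
Proof. by move=> fA; have [_ ->] := sdiff_jacobian fA. Qed.

Lemma derive_line n (W : normedModType R) (f : 'rV[R]_n -> W) (z w : 'rV[R]_n) (c : R) :
  derivable f (z + c *: w) w ->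
  is_derive c 1 (fun t : R => f (z + t *: w)) ('D_w f (z + c *: w)).
Proof.
have E : (fun h : R => h^-1 *: (((fun t : R => f (z + t *: w)) \o shift c) (h *: 1)
     - f (z + c *: w))) = 
     (fun h => h^-1 *: ((f \o shift (z + c *: w)) (h *: w) - f (z + c *: w))).
  apply/funext => h /=; congr (_ *: (f _ - _)).
  by rewrite (_ : h *: (1 : R) = h) ?scalerDl 1?addrCA//; exact: mulr1.
by move=> fw; apply: DeriveDef; rewrite /derivable /derive E.
Qed.

(** The mean value theorem is applied to each coordinate of [f] along the segment
between two points of a ball; it bounds the increment by the oscillation of the
partial derivatives on the ball, which is small by continuity. *)
Lemma Ck1_sdiff m n (U : set 'rV[R]_m) (f : 'rV[R]_m -> 'rV[R]_n) x :
  open U -> Ck 1 U f -> U x -> sdiff f x ('J f x).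
Proof.
move=> oU [df cf] Ux e e0.
pose e' := e / m.+1%:R.
have e'0 : 0 < e' by rewrite divr_gt0.
pose D i y := 'D_(delta_mx ord0 i : 'rV[R]_m) f y.
have near_i (i : 'I_m) : \forall y \near x, `|D i x - D i y| <= e'.
  have : {for x, continuous (D i)} by exact: cf.
  by move=> /(@cvgrPdist_le _ _ _ (nbhs x) _); apply.
have := filter_forall (nbhs_filter x) near_i.
move=> near_all.
have : nbhs x (U `&` [set y | forall i, `|D i x - D i y| <= e']).
  by apply: filterI => //; exact: open_nbhs_nbhs.
move=> /nbhs_ballP[d /= d0 dU].
exists (ball x d); first exact: nbhsx_ballx.
move=> y z xy xz.
pose w : 'rV[R]_m := y - z; pose l (t : R) : 'rV[R]_m := z + t *: w.
have xl (t : R) : 0 <= t <= 1 -> ball x d (l t).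
  move: xy xz; rewrite mx_norm_ball /ball_/= => xy xz /andP[t0 t1].
  have -> : x - l t = (1 - t) *: (x - z) + t *: (x - y).
    apply/matrixP => i j; rewrite /l /w !mxE; ring.
  have [->|tn0] := eqVneq t 0; first by rewrite subr0 scale1r scale0r addr0.
  apply: le_lt_trans (ler_normD _ _) _; rewrite !normrZ (ger0_norm t0) ger0_norm ?subr_ge0//.
  apply: (@lt_le_trans _ _ ((1 - t) * d + t * d)).
    apply: ler_ltD; first by rewrite ler_wpM2l ?subr_ge0// ltW.
    by rewrite ltr_pM2l// lt0r tn0.
  by rewrite -mulrDl subrK mul1r.
apply: norm_le_coord => [|i j]; first by rewrite mulr_ge0// ltW.
rewrite (ord1 i) {i}.
have dl (t : R) : 0 <= t <= 1 -> is_derive t 1 (fun s : R => f (l s)) ('D_w f (l t)).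
  move=> /xl /dU[Ul _]; apply: derive_line; apply: diff_derivable; exact: df.
have dlj (t : R) : 0 <= t <= 1 ->
    is_derive t 1 (fun s : R => f (l s) ord0 j) ('D_w f (l t) ord0 j).
  move=> /dl [dt Et]; have /derivable_mxP/(_ ord0 j) dtj := dt.
  by apply: DeriveDef => //; rewrite -Et derive_mx// mxE.
have [c c01] : exists2 c, c \in `[0, 1]%R &
    f (l 1) ord0 j - f (l 0) ord0 j = 'D_w f (l c) ord0 j * (1 - 0).
  apply: (@MVT_segment R (fun s => f (l s) ord0 j)) => //.
    move=> t /[!in_itv]/= /andP[t0 t1]; apply: dlj; rewrite !ltW//.
  apply: derivable_within_continuous => t; rewrite in_itv/= => t01.
  by have := dlj t t01 => dt; exact: ex_derive.
have -> : l 1 = y by rewrite /l /w scale1r addrC subrK.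
have -> : l 0 = z by rewrite /l scale0r addr0.
rewrite subr0 mulr1 => E.
have := xl c; rewrite in_itv/= in c01; move=> /(_ c01) /dU[Ulc hD].
rewrite !mxE -/(w) E deriveEjacobian; last exact: df.
rewrite mxE -sumrB.
apply: le_trans (ler_norm_sum _ _ _) _.
apply: (@le_trans _ _ (\sum_(i < m) (`|w| * e'))).
  apply: ler_sum => i _; rewrite -/w -mulrBr normrM.
  apply: ler_pM => //; first exact: coord_le_norm.
  have DE y' : U y' -> D i y' ord0 j = 'J f y' i j.
    by move=> Uy'; rewrite /D deriveEjacobian; [rewrite -rowE mxE|exact: df].
  have := hD i; rewrite distrC => /(le_trans (coord_le_norm _ ord0 j)).
  rewrite (_ : (D i (l c) - D i x) ord0 j = D i (l c) ord0 j - D i x ord0 j); last by rewrite !mxE.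
  by rewrite !DE.
rewrite sumr_const card_ord -mulr_natr -mulrA mulrC ler_wpM2r//.
by rewrite /e' mulrAC -mulrA ler_piMr ?ltW// ltr_pdivrMr// mul1r ltr_nat.
Qed.

(** A continuous lift [h] of [g] through an immersion [s] is as smooth as [g].  The
pseudo-inverse of [S] recovers increments of [h] from increments of [g], with an
error proportional to the increment of [h] itself; for a small factor this error
is absorbed, which first yields a Lipschitz bound on [h] and then its
derivative. *)
Lemma sdiff_lift l k m (s : 'rV[R]_k -> 'rV[R]_m) (g : 'rV[R]_l -> 'rV[R]_m)
    (h : 'rV[R]_l -> 'rV[R]_k) w (S : 'M[R]_(k, m)) (G : 'M[R]_(l, m)) :
  sdiff s (h w) S -> row_free S -> sdiff g w G -> {for w, continuous h} ->
  (\forall y \near w, s (h y) = g y) ->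
  sdiff h w (G *m pinvmx S) /\ G = G *m pinvmx S *m S.
Proof.
move=> sS Sfree gG ch shg; set P := pinvmx S.
have SP : S *m P = 1%:M by exact: mulmxVp.
have hA : sdiff h w (G *m P).
  move=> e e0.
  have [L L0 hL] := norm_mulmx_le P.
  have [K K0 hK] := norm_mulmx_le (G *m P).
  (* The first bound absorbs the increment of [h] into the left-hand side; the
     second one gives the precision [e]. *)
  pose e1 := Num.min (1 / (2 * L)) (e / (L * (2 * K + 2))).
  have KK : 0 < 2 * K + 2 by rewrite addr_gt0// mulr_gt0.
  have e10 : 0 < e1 by rewrite lt_min !divr_gt0// mulr_gt0.
  have Le1 : L * e1 <= 1 / 2.
    rewrite mulrC -ler_pdivlMr//; apply: (@le_trans _ _ (1 / (2 * L))).
      by rewrite ge_min lexx.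
    by rewrite invfM mulrA.
  have Le2 : L * e1 * (2 * K + 2) <= e.
    rewrite mulrAC mulrC -ler_pdivlMr ?mulr_gt0//.
    by rewrite ge_min lexx orbT.
  have [U hU Us] := sS _ e10; have [V wV Vg] := gG _ e10.
  exists (V `&` h @^-1` U `&` [set y | s (h y) = g y]).
    by apply: filterI => //; apply: filterI => //; exact: ch.
  move=> y z [[Vy Uy] /= Ey] [[Vz Uz] /= Ez].
  have r1 := Us _ _ Uy Uz; have r2 := Vg _ _ Vy Vz; rewrite Ey Ez in r1.
  have E : h y - h z - (y - z) *m (G *m P) =
     ((g y - g z - (y - z) *m G) - (g y - g z - (h y - h z) *m S)) *m P.
    have E0 (a b c : 'rV[R]_m) : a - b - (a - c) = c - b by rewrite opprB addrC addrA subrK.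
    by rewrite E0 [RHS]mulmxBl -[in RHS](mulmxA _ S) SP mulmx1 mulmxA.
  have B1 : `|h y - h z - (y - z) *m (G *m P)| <= L * e1 * (`|y - z| + `|h y - h z|).
    rewrite E; apply: le_trans (hL _) _; rewrite -mulrA ler_pM2l// mulrDr.
    apply: le_trans (ler_normB _ _) _.
    by apply: lerD.
  have B2 : `|h y - h z| <= (2 * K + 1) * `|y - z|.
    have := ler_normD (h y - h z - (y - z) *m (G *m P)) ((y - z) *m (G *m P)).
    rewrite subrK => h1.
    have h2 := hK (y - z).
    have h3 : L * e1 * (`|y - z| + `|h y - h z|) <= 1 / 2 * (`|y - z| + `|h y - h z|).
      by rewrite ler_wpM2r// addr_ge0.
    lra.
  apply: le_trans B1 _.
  apply: (@le_trans _ _ (L * e1 * ((2 * K + 2) * `|y - z|))).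
    apply: ler_wpM2l; first by rewrite mulr_ge0// ltW.
    lra.
  by rewrite mulrA ler_wpM2r.
split => //.
have := sdiff_comp hA sS => /(sdiff_eq_near shg) /sdiff_jacobian[_ <-].
by have [_ ->] := sdiff_jacobian gG.
Qed.

(** The map [h] followed by the inverse of its differential is a small Lipschitz
perturbation of the identity. *)
Lemma sdiff_co_lipschitz n (h : 'rV[R]_n -> 'rV[R]_n) w (A : 'M[R]_n) :
  sdiff h w A -> A \in unitmx ->
  exists2 U, nbhs w U & forall y z : 'rV[R]_n, U y -> U z ->
    `|y - z| <= 2 * `|h y *m invmx A - h z *m invmx A|.
Proof.
move=> hA uA; have [L L0 hL] := norm_mulmx_le (invmx A).
have e0 : 0 < 1 / (2 * L) by rewrite divr_gt0// mulr_gt0.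
have [U wU hU] := hA _ e0; exists U => // y z Uy Uz.
have := hL (h y - h z - (y - z) *m A).
rewrite mulmxBl mulmxK// -mulmxBl => h1.
have h2 := hU _ _ Uy Uz.
have h3 : L * `|h y - h z - (y - z) *m A| <= 1 / 2 * `|y - z|.
  apply: (@le_trans _ _ (L * (1 / (2 * L) * `|y - z|))); first by rewrite ler_pM2l.
  by rewrite (_ : L * (_ * _) = 1 / 2 * `|y - z|)//; field; rewrite gt_eqF.
have := ler_normB ((h y - h z) *m invmx A) ((h y - h z) *m invmx A - (y - z)).
rewrite opprB addrC subrK => h4.
lra.
Qed.

End strict_differentiability.

(** * Differential calculus on manifolds *)

Section Ck_facts.
Context {R : realType}.

Lemma Ck_S_continuous (V W : normedModType R) r (U : set V) (f : V -> W) x :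
  Ck r U f -> U x -> {for x, continuous f}.
Proof.
by case: r => [|r] /= => [h /h//|[h _] /h]; exact: differentiable_continuous.
Qed.

Lemma Ck_le (V W : normedModType R) r q (U : set V) (f : V -> W) :
  (q <= r)%N -> Ck r U f -> Ck q U f.
Proof.
elim: r q f => [|r IH] [|q] f //.
  by move=> _ h x; exact: Ck_S_continuous h.
by move=> qr [h1 h2]; split => // v; exact: IH (h2 v).
Qed.

Lemma Ck_sub (V W : normedModType R) r (U U' : set V) (f : V -> W) :
  U' `<=` U -> Ck r U f -> Ck r U' f.
Proof.
move=> UU; elim: r f => [|r IH] f /=; first by move=> h x /UU /h.
by move=> [h1 h2]; split => [x /UU /h1|v]; [exact|exact: IH (h2 v)].
Qed.

(** The rows of the Jacobian are the directional derivatives along the basis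
vectors. *)
Lemma Ck1_jacobian_continuous m n (U : set 'rV[R]_m) (f : 'rV[R]_m -> 'rV[R]_n) x :
  open U -> Ck 1 U f -> U x -> {for x, continuous (fun y => 'J f y)}.
Proof.
move=> oU [df cf] Ux; apply: (@cvg_matrix R _ (nbhs x) _ m n) => i j.
pose D y := ('D_(delta_mx ord0 i : 'rV[R]_m) f y) ord0 j.
have DE y : U y -> 'J f y i j = D y.
  by move=> Uy; rewrite /D deriveEjacobian; [rewrite -rowE [RHS]mxE|exact: df].
have cD : D @ nbhs x --> D x.
  have c0 := cf (delta_mx ord0 i : 'rV[R]_m) x Ux.
  pose D0 : 'rV[R]_m -> 'M[R]_(1, n) := 'D_(delta_mx ord0 i : 'rV[R]_m) f.
  exact: (@cvg_entry R _ (nbhs x) 1 n D0 (D0 x) ord0 j c0).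
rewrite -(DE x Ux) in cD; apply: cvg_trans cD; apply: near_eq_cvg.
have : nbhs x U by exact: open_nbhs_nbhs.
by apply: filterS => y /DE.
Qed.

End Ck_facts.

Section charts.
Context {R : realType} {m : nat} (M : rmanifold R m).
Implicit Types z y c : M.

Lemma chartK_image z x : (chart z @` cdom z) x ->
  cdom z (param z x) /\ chart z (param z x) = x.
Proof. by move=> [y zy <-]; rewrite chartK. Qed.

Lemma nbhs_cdom z y : cdom z y -> nbhs y (cdom z).
Proof. by move=> zy; apply: open_nbhs_nbhs; split => //; exact: cdom_open. Qed.

Lemma nbhs_chart z y : cdom z y -> nbhs (chart z y) (chart z @` cdom z).
Proof.
by move=> zy; apply: open_nbhs_nbhs; split; [exact: chart_open|exists y].
Qed.

Lemma cvg_param z y : cdom z y -> param z @ nbhs (chart z y) --> y.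
Proof.
move=> zy; rewrite -[X in _ --> X](chartK zy); apply: param_continuous.
by exists y.
Qed.

Lemma chart_image_open z (A : set M) : open A -> open (chart z @` (cdom z `&` A)).
Proof.
move=> oA; rewrite openE => _ [y [zy Ay] <-].
have h1 : nbhs (chart z y) (param z @^-1` A).
  by apply: (cvg_param zy); exact: open_nbhs_nbhs.
have h := nbhsI (nbhs_chart zy) h1; apply: filterS h => x [/chartK_image[zx xE] Ax].
by exists (param z x).
Qed.

Lemma transition_sdiff z w y : cdom z y -> cdom w y ->
  sdiff (chart w \o param z) (chart z y) ('J (chart w \o param z) (chart z y)).
Proof.
move=> zy wy; apply: (@Ck1_sdiff _ _ _ (chart z @` (cdom z `&` cdom w))).
- by apply: chart_image_open; exact: cdom_open.
- exact: transition_smooth.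
- by exists y.
Qed.

End charts.

Section smooth_maps.
Context {R : realType}.

(** Strict differentiability of a parametrization, read in the chart centred at the
image point, where [dparam] is its derivative. *)
Definition sdiff_param m (M : rmanifold R m) k (f : 'rV[R]_k -> M) (x : 'rV[R]_k) :=
  {for x, continuous f} /\ sdiff (chart (f x) \o f) x (dparam f x).

Definition sdiff_map m n (M : rmanifold R m) (N : rmanifold R n) (G : M -> N) (z : M) :=
  {for z, continuous G} /\
  sdiff (chart (G z) \o G \o param z) (chart z z) (dmap G z).

Lemma near_cdom m (M : rmanifold R m) k (f : 'rV[R]_k -> M) x c :
  {for x, continuous f} -> cdom c (f x) -> \forall y \near x, cdom c (f y).
Proof. by move=> cf cx; apply: cf; exact: nbhs_cdom. Qed.

(** Passage from the chart centred at [f x], which moves with [x], to a fixed chart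
[c]. *)
Lemma sdiff_param_chart m (M : rmanifold R m) k (f : 'rV[R]_k -> M) x c :
  sdiff_param f x -> cdom c (f x) ->
  [/\ differentiable (chart c \o f) x, sdiff (chart c \o f) x ('J (chart c \o f) x) &
  dparam f x = 'J (chart c \o f) x *m 'J (chart (f x) \o param c) (chart c (f x))].
Proof.
move=> [cf df] cx; have xx := cdom_refl (f x).
have h1 := sdiff_comp df (transition_sdiff xx cx).
have h2 : sdiff (chart c \o f) x (dparam f x *m
    'J (chart c \o param (f x)) (chart (f x) (f x))).
  apply: sdiff_eq_near h1; have := near_cdom cf xx.
  by apply: filterS => y xy /=; rewrite chartK.
have [d1 _] := sdiff_jacobian h2; move: h2 => /sdiff_J h2; split => //.
have h3 := sdiff_comp h2 (transition_sdiff cx xx).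
have h4 : sdiff (chart (f x) \o f) x ('J (chart c \o f) x *m
    'J (chart (f x) \o param c) (chart c (f x))).
  apply: sdiff_eq_near h3; have := near_cdom cf cx.
  by apply: filterS => y xy /=; rewrite chartK.
by have [_ <-] := sdiff_jacobian h4.
Qed.

Lemma sdiff_param_comp m n (M : rmanifold R m) (N : rmanifold R n) k
    (f : 'rV[R]_k -> M) (G : M -> N) x :
  sdiff_param f x -> sdiff_map G (f x) ->
  sdiff_param (G \o f) x /\ dparam (G \o f) x = dparam f x *m dmap G (f x).
Proof.
move=> [cf df] [cG dG].
have h : sdiff (chart (G (f x)) \o (G \o f)) x (dparam f x *m dmap G (f x)).
  apply: sdiff_eq_near (sdiff_comp df dG); have := near_cdom cf (cdom_refl (f x)).
  by apply: filterS => y xy /=; rewrite chartK.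
have [_ E] := sdiff_jacobian h.
have E' : dparam (G \o f) x = dparam f x *m dmap G (f x) by exact: E.
split => //; split; last by rewrite E'.
exact: continuous_comp.
Qed.

(** The tangent map of [G] is the derivative of a parametrization; this reduces the
chain rule for maps to the one for parametrizations. *)
Lemma dmapE m n (M : rmanifold R m) (N : rmanifold R n) (G : M -> N) z :
  dparam (G \o param z) (chart z z) = dmap G z.
Proof. by rewrite /dparam/= chartK//; exact: cdom_refl. Qed.

Lemma sdiff_map_sdiff_param m n (M : rmanifold R m) (N : rmanifold R n) (G : M -> N) z :
  {for z, continuous G} -> sdiff_map G z <-> sdiff_param (G \o param z) (chart z z).
Proof.
move=> cG; have zz := cdom_refl z.
have e : (G \o param z) (chart z z) = G z by rewrite /= chartK.
split => [[_ dG]|[_ dG]].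
  split; last by rewrite dmapE e; exact: dG.
  rewrite /prop_for /continuous_at e.
  by apply: (@cvg_comp _ _ _ (param z) G _ (nbhs z)); [exact: cvg_param|exact: cG].
split; first exact: cG.
by rewrite (dmapE G z) e in dG; exact: dG.
Qed.

Lemma sdiff_map_comp m n p (M : rmanifold R m) (N : rmanifold R n) (P : rmanifold R p)
    (F : M -> N) (G : N -> P) z :
  sdiff_map F z -> sdiff_map G (F z) ->
  sdiff_map (G \o F) z /\ dmap (G \o F) z = dmap F z *m dmap G (F z).
Proof.
move=> sF sG; have [cF _] := sF; have [cG _] := sG.
have sFp := (sdiff_map_sdiff_param cF).1 sF.
have e : (F \o param z) (chart z z) = F z by rewrite /= chartK//; exact: cdom_refl.
have cGF : {for z, continuous (G \o F)} by exact: continuous_comp.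
have sG' : sdiff_map G ((F \o param z) (chart z z)) by rewrite e.
have [sGF E] := sdiff_param_comp sFp sG'.
split; first exact/(sdiff_map_sdiff_param cGF).
transitivity (dparam (G \o (F \o param z)) (chart z z)).
  exact: (esym (dmapE (G \o F) z)).
refine (etrans E _); refine (etrans (congr1 (fun A => A *m _) (dmapE F z)) _).
exact: (congr1 (fun u => dmap F z *m dmap G u) e).
Qed.

Lemma sdiff_map_id_near m (M : rmanifold R m) (G : M -> M) z : G z = z ->
  (\forall y \near z, G y = y) -> dmap G z = 1%:M.
Proof.
move=> Gz Gy; have zz := cdom_refl z.
have h : sdiff (chart (G z) \o G \o param z) (chart z z) 1%:M.
  apply: (@sdiff_eq_near _ _ _ id).
    rewrite Gz; have := nbhsI (nbhs_chart zz) (cvg_param zz Gy).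
    by apply: filterS => x [/chartK_image[zx xE] /= Gx]; rewrite Gx xE.
  move=> e e0; exists setT; first exact: filterT.
  by move=> y y' _ _; rewrite mulmx1 subrr normr0 mulr_ge0// ltW.
by have [_ <-] := sdiff_jacobian h.
Qed.

Lemma Ck_map_sdiff_map m n (M : rmanifold R m) (N : rmanifold R n) r (A : set M)
    (F : M -> N) z : (0 < r)%N -> open A -> Ck_map r A F -> A z -> sdiff_map F z.
Proof.
move=> r0 oA [cF dF] Az; split; first exact: cF.
apply: (@Ck1_sdiff _ _ _ (chart z @` (cdom z `&` A `&` F @^-1` cdom (F z)))).
- rewrite -setIA; apply: chart_image_open.
  rewrite openE => y [Ay Fy]; apply: filterI; first exact: open_nbhs_nbhs.
  by apply: cF => //; exact: nbhs_cdom.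
- exact: Ck_le (dF _ _).
- by exists z => //; split; [split => //; exact: cdom_refl|exact: cdom_refl].
Qed.

Lemma Ck_param_open m (M : rmanifold R m) k r (U : set 'rV[R]_k) (s : 'rV[R]_k -> M)
    (O : set M) : open U -> Ck_param r U s -> open O -> open (U `&` s @^-1` O).
Proof.
move=> oU [cs _] oO; rewrite openE => x [Ux Ox].
by apply: filterI; [exact: open_nbhs_nbhs|apply: cs => //; exact: open_nbhs_nbhs].
Qed.

Lemma Ck_param_sdiff_param m (M : rmanifold R m) k r (U : set 'rV[R]_k) (s : 'rV[R]_k -> M) x :
  (0 < r)%N -> open U -> Ck_param r U s -> U x -> sdiff_param s x.
Proof.
move=> r0 oU cs Ux; split; first exact: cs.1.
apply: (@Ck1_sdiff _ _ _ (U `&` s @^-1` cdom (s x))).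
- by apply: Ck_param_open cs _ => //; exact: cdom_open.
- exact: Ck_le (cs.2 _).
- by split => //; exact: cdom_refl.
Qed.

Lemma local_diffeo_sdiff_map m (M N : rmanifold R m) r (F : M -> N) z : (0 < r)%N ->
  local_diffeo r F -> sdiff_map F z.
Proof. by move=> r0 [cF _]; exact: Ck_map_sdiff_map r0 openT cF _. Qed.

(** A local inverse provides, by the chain rule, an inverse of the tangent map. *)
Lemma local_diffeo_dmap_unit m (M : rmanifold R m) (N : rmanifold R m) r (F : M -> N) z :
  (0 < r)%N -> local_diffeo r F -> dmap F z \in unitmx.
Proof.
move=> r0 lF; have [V [G [[oV Vz] oFV GF cG]]] := lF.2 z.
have sF := local_diffeo_sdiff_map z r0 lF.
have sG : sdiff_map G (F z) by apply: (Ck_map_sdiff_map r0 oFV cG); exists z.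
have [_ E] := sdiff_map_comp sF sG.
have := mulmx1_unit (esym (etrans (esym (@sdiff_map_id_near _ _ (G \o F) z _ _)) E)).
by case => //=; [exact: GF|apply: filterS (open_nbhs_nbhs (conj oV Vz)) => y /GF].
Qed.

End smooth_maps.

Section gram.
Context {R : realType} {m : nat} (M : rmanifold R m).

(** The matrix whose determinant is the square of the volume density. *)
Definition gram k (f : 'rV[R]_k -> M) x : 'M[R]_k :=
  dparam f x *m metric (f x) *m (dparam f x)^T.

(** The Gram matrix of the coordinate frame of the chart [c], in the form in which
it is assumed to be smooth. *)
Definition chart_metric (c : M) (x : 'rV[R]_m) : 'M[R]_m :=
  let y := param c x in let J := 'J (chart y \o param c) x in
  J *m metric y *m J^T.

Lemma gram_chart k (f : 'rV[R]_k -> M) x c : sdiff_param f x -> cdom c (f x) ->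
  gram f x = 'J (chart c \o f) x *m chart_metric c (chart c (f x)) *m ('J (chart c \o f) x)^T.
Proof.
move=> sf cx; have [_ _ E] := sdiff_param_chart sf cx.
by rewrite /gram E /chart_metric/= chartK// trmx_mul !mulmxA.
Qed.

Lemma vol_densityE k (f : 'rV[R]_k -> M) x : vol_density f x = Num.sqrt (\det (gram f x)).
Proof. by []. Qed.

Lemma gram_det_gt0 k (f : 'rV[R]_k -> M) x : \rank (dparam f x) = k -> 0 < \det (gram f x).
Proof.
move=> rk; apply: posdef_det_gt0; apply: posdef_congr; last exact: metric_pos.
by rewrite /row_free rk.
Qed.

(** The Gram matrix of a family of parametrizations involves charts centred at the
moving point [f t (x t)].  Read in a single chart [c] around the limit point, it
is a continuous function of the derivative and of the position. *)
Lemma cvg_gram (T : Type) (F : set_system T) (FF : ProperFilter F) k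
    (f : T -> 'rV[R]_k -> M) (x : T -> 'rV[R]_k) (t0 : T) c :
  (\forall t \near F, sdiff_param (f t) (x t)) -> sdiff_param (f t0) (x t0) -> cdom c (f t0 (x t0)) ->
  (fun t => f t (x t)) @ F --> f t0 (x t0) ->
  (fun t => 'J (chart c \o f t) (x t)) @ F --> 'J (chart c \o f t0) (x t0) ->
  (fun t => gram (f t) (x t)) @ F --> gram (f t0) (x t0).
Proof.
move=> sf sf0 c0 cf cJ.
have E t : sdiff_param (f t) (x t) -> cdom c (f t (x t)) -> gram (f t) (x t) = 'J (chart c \o f t) (x t) *m
   chart_metric c (chart c (f t (x t))) *m ('J (chart c \o f t) (x t))^T.
  by move=> st ct; exact: gram_chart.
have Fc : F [set t | cdom c (f t (x t))] by apply: cf; exact: nbhs_cdom.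
pose h t := 'J (chart c \o f t) (x t) *m chart_metric c (chart c (f t (x t))) *m
  ('J (chart c \o f t) (x t))^T.
have hE : h @ F --> h t0.
  apply: (@cvg_mulmx R T F FF); last exact: (@cvg_trmx R T F FF).
  apply: (@cvg_mulmx R T F FF) => //.
  have cc : chart c (f t (x t)) @[t --> F] --> chart c (f t0 (x t0)).
    apply: (@cvg_comp _ _ _ (fun t => f t (x t)) (chart c) _ (nbhs (f t0 (x t0)))) => //.
    exact: chart_continuous.
  apply: (@cvg_comp _ _ _ (fun t => chart c (f t (x t))) (chart_metric c) _
    (nbhs (chart c (f t0 (x t0))))) => //.
  have := @metric_smooth _ _ _ c 0 => /=; apply.
  by exists (f t0 (x t0)).
rewrite (E t0 sf0 c0); apply: cvg_trans hE; apply: near_eq_cvg.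
apply: filterS2 sf Fc => t st ct; exact: esym (E t st ct).
Qed.

Lemma vol_density_continuous k (U : set 'rV[R]_k) (s : 'rV[R]_k -> M) x :
  open U -> Ck_param 1 U s -> U x -> {for x, continuous (vol_density s)}.
Proof.
move=> oU cs Ux; pose c := s x.
have ss y : U y -> sdiff_param s y by exact: Ck_param_sdiff_param cs.
have cg : gram s @ nbhs x --> gram s x.
  apply: (@cvg_gram _ (nbhs x) _ k (fun=> s) id x c).
  - by apply: filterS (open_nbhs_nbhs (conj oU Ux)) => y; exact: ss.
  - exact: ss.
  - exact: cdom_refl.
  - exact: cs.1.
  - apply: (@Ck1_jacobian_continuous _ _ _ (U `&` s @^-1` cdom c)).
    + by apply: Ck_param_open cs _ => //; exact: cdom_open.
    + exact: cs.2.
    + by split => //; exact: cdom_refl.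
apply: (@cvg_comp _ _ _ (fun y => \det (gram s y)) Num.sqrt _ (nbhs (\det (gram s x)))).
  exact: (@cvg_det R _ (nbhs x)).
exact: sqrt_continuous.
Qed.

Lemma vol_density_gt0 k (s : 'rV[R]_k -> M) x :
  \rank (dparam s x) = k -> 0 < vol_density s x.
Proof. by move=> /gram_det_gt0 h; rewrite vol_densityE sqrtr_gt0. Qed.

End gram.

(** * Small foliation boxes *)

Lemma continuous_prod_map (S T U V : topologicalType) (f : S -> U) (g : T -> V) :
  continuous f -> continuous g -> continuous (fun q : S * T => (f q.1, g q.2)).
Proof.
move=> cf cg q A [[P Q] [/= fP gQ] PQA].
exists (f @^-1` P, g @^-1` Q); first by split; [exact: cf|exact: cg].
by move=> [s t] [/= Ps Qt]; exact: PQA.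
Qed.

Section affine_reparametrization.
Context {R : realType}.

(** Reparametrizing a foliation box by a homothety of each factor centred at a point
gives a box that is centred at this point and as small as desired. *)
Definition rescale (V : normedModType R) (x0 : V) (e : R) (x : V) : V := x0 + e *: x.

Lemma rescale_continuous (V : normedModType R) (x0 : V) e : continuous (rescale x0 e).
Proof.
by move=> x; apply: cvgD; [exact: cvg_cst|apply: cvgZ; [exact: cvg_cst|exact: cvg_id]].
Qed.

Lemma rescale_open (V : normedModType R) (x0 : V) e (O : set V) : 0 < e -> open O ->
  open (rescale x0 e @` O).
Proof.
move=> e0 oO.
rewrite (_ : _ @` _ = (fun y => e^-1 *: (y - x0)) @^-1` O); last first.
  apply/seteqP; split => [_ [x Ox <-]|y Oy] /=.
    by rewrite /rescale addrAC subrr add0r scalerA mulVf ?gt_eqF// scale1r.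
  exists (e^-1 *: (y - x0)) => //.
  by rewrite /rescale scalerA divff ?gt_eqF// scale1r addrC subrK.
apply: open_comp => // y _; apply: cvgZ; first exact: cvg_cst.
by apply: cvgB; [exact: cvg_id|exact: cvg_cst].
Qed.

Lemma rescale_derive (V W : normedModType R) (x0 : V) e (f : V -> W) v x :
  'D_v (f \o rescale x0 e) x = 'D_(e *: v) f (rescale x0 e x).
Proof.
have E : (fun h : R => h^-1 *: (((f \o rescale x0 e) \o shift x) (h *: v) -
      (f \o rescale x0 e) x)) =
    (fun h : R => h^-1 *: ((f \o shift (rescale x0 e x)) (h *: (e *: v)) - f (rescale x0 e x))).
  apply/funext => h /=; congr (_ *: (f _ - _)).
  by rewrite /rescale scalerDr !scalerA [e * h]mulrC addrCA.
by rewrite /derive E.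
Qed.

Lemma rescale_differentiable (V W : normedModType R) (x0 : V) e (f : V -> W) x :
  differentiable f (rescale x0 e x) -> differentiable (f \o rescale x0 e) x.
Proof.
by move=> df; apply: (@differentiable_comp R V V W (rescale x0 e) f x).
Qed.

Lemma Ck_rescale (V W : normedModType R) r (U U' : set V) (x0 : V) e (f : V -> W) :
  Ck r U f -> (forall x, U' x -> U (rescale x0 e x)) -> Ck r U' (f \o rescale x0 e).
Proof.
elim: r f => [|r IH] f /=.
  move=> cf UU x /UU /cf cfx; apply: continuous_comp => //; exact: rescale_continuous.
move=> [df cf] UU; split => [x /UU /df|v]; first exact: rescale_differentiable.
rewrite (_ : (fun x => _) = 'D_(e *: v) f \o rescale x0 e); first exact: IH (cf _) UU.
by apply/funext => x; exact: rescale_derive.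
Qed.

Lemma rescale_sdiff n (x0 x : 'rV[R]_n) e : sdiff (rescale x0 e) x (e%:M).
Proof.
move=> d d0; exists setT => [|y z _ _]; first exact: filterT.
rewrite /rescale opprD addrACA subrr add0r -scalerBr mul_mx_scalar subrr normr0.
by rewrite mulr_ge0// ltW.
Qed.

Lemma disc_open n : open (disc R n).
Proof.
have cs : continuous (fun x : 'rV[R]_n => \sum_i x ord0 i ^+ 2).
  apply: continuous_big => [|i _]; first exact: add_continuous.
  have -> : (fun x : 'rV[R]_n => x ord0 i ^+ 2) = (fun x => x ord0 i * x ord0 i).
    by apply/funext => x; exact: expr2.
  move=> x; have c := @coord_continuous R 1 n ord0 i x.
  exact: (@cvgM _ _ (nbhs x) _ _ _ _ _ c c).
rewrite (_ : disc R n = (fun x : 'rV[R]_n => \sum_i x ord0 i ^+ 2) @^-1` [set t | t < 1]) //.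
by apply: open_comp => [x _|]; [exact: cs|exact: open_lt].
Qed.

Lemma disc0 n : disc R n 0.
Proof. by rewrite /disc/= big1// => i _; rewrite mxE expr0n. Qed.

Lemma disc_norm n (x : 'rV[R]_n) : disc R n x -> `|x| <= 1.
Proof.
move=> /= dx; apply: norm_le_coord => // i j; rewrite (ord1 i).
rewrite -(@expr_le1 _ 2)// -normrX ger0_norm ?sqr_ge0//.
apply: le_trans (ltW dx); rewrite (bigD1 j)//= lerDl.
by apply: sumr_ge0 => l _; exact: sqr_ge0.
Qed.

End affine_reparametrization.

Section leaf_topology.
Context {R : realType} {m : nat} (M : rmanifold R m) (k : nat).
Implicit Types (L V : set M) (P : set ('rV[R]_k -> M)).

Lemma leaf_open_nbhs P V :
  (forall y, V y -> exists O, [/\ leaf_open P O, O y & O `<=` V]) -> leaf_open P V.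
Proof.
move=> h s Ps; rewrite openE => x [Dx /= Vsx].
have [ O [oO Oy OV]] := h _ Vsx.
have : nbhs x (disc R k `&` s @^-1` O) by apply: open_nbhs_nbhs; split => //; exact: oO.
by apply: filterS => y [Dy Osy]; split => //; exact: OV.
Qed.

Lemma leaf_openI P V V' : leaf_open P V -> leaf_open P V' -> leaf_open P (V `&` V').
Proof.
move=> oV oV' s Ps; rewrite (_ : _ `&` _ = (disc R k `&` s @^-1` V) `&` (disc R k `&` s @^-1` V')).
  by apply: openI; [exact: oV|exact: oV'].
by apply/seteqP; split => x; [move=> [? []]|move=> [[? ?] []]].
Qed.

(** The openness conditions survive because a homothety is a homeomorphism onto an
open subset of the disc. *)
Lemma leaf_chart_rescale r L P s x0 e : leaf_chart r L P s -> (0 < r)%N -> 0 < e ->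
  (forall x, disc R k x -> disc R k (rescale x0 e x)) ->
  leaf_chart r L P (s \o rescale x0 e).
Proof.
move=> [sL si cs rs [so1 so2]] r0 e0 De.
have oD := @disc_open R k.
split.
- by move=> _ [x Dx <-]; apply: sL; exists (rescale x0 e x) => //; exact: De.
- move=> x y /set_mem Dx /set_mem Dy /si; rewrite !inE => /(_ (De _ Dx) (De _ Dy)).
  by move=> /addrI /(scalerI (lt0r_neq0 e0)).
- split => [x Dx|z].
    by apply: continuous_comp; [exact: rescale_continuous|exact: cs.1 (De _ Dx)].
  by apply: (Ck_rescale (cs.2 z)) => x [Dx zx]; split => //; exact: De.
- move=> x Dx.
  have [_ h] := Ck_param_sdiff_param r0 oD cs (De _ Dx).
  have [_ E] := sdiff_jacobian (sdiff_comp (rescale_sdiff x0 x e) h).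
  rewrite (_ : dparam _ x = e%:M *m dparam s (rescale x0 e x)); last exact: E.
  rewrite mul_scalar_mx mxrank_scale_nz ?gt_eqF//.
  exact: rs (De _ Dx).
- split => [ O oO OD|V oV].
    rewrite -(image_comp (rescale x0 e) s).
    apply: so1; first exact: rescale_open.
    by move=> _ [x Ox <-]; apply/De/OD.
  rewrite (_ : _ `&` _ = disc R k `&` rescale x0 e @^-1` (disc R k `&` s @^-1` V)).
    apply: openI => //; apply: open_comp; last exact: so2.
    by move=> x _; exact: rescale_continuous.
  apply/seteqP; split => x /= [Dx]; last by case.
  by move=> Vx; split => //; split => //; exact: De.
Qed.

End leaf_topology.

Section boxes.
Context {R : realType} {m : nat} (M : rmanifold R m) (k r : nat) (W : foliation M k r).
Hypothesis r_gt0 : (0 < r)%N.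
Local Notation box := (foliation_box r (leaf W) (leaf_par W)).
Local Notation D := (disc R k `*` disc R (m - k)).

(** The centre of the plaques moves from [phi (0, p)] to another point of the same
leaf, which has the same leaf structure. *)
Lemma foliation_box_rescale phi (x0 : 'rV[R]_k) (p0 : 'rV[R]_(m - k)) e : box phi -> 0 < e ->
  (forall x, disc R k x -> disc R k (rescale x0 e x)) ->
  (forall p, disc R (m - k) p -> disc R (m - k) (rescale p0 e p)) ->
  box (fun q => phi (rescale x0 e q.1, rescale p0 e q.2)).
Proof.
move=> [phii phic phio phil phid] e0 Dk Dmk.
pose b (q : 'rV[R]_k * 'rV[R]_(m - k)) := (rescale x0 e q.1, rescale p0 e q.2).
have bD q : D q -> D (b q) by move=> [/Dk ? /Dmk ?].
have cb : continuous b.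
  by apply: continuous_prod_map; exact: rescale_continuous.
have e0' := lt0r_neq0 e0.
split.
- move=> q q' /set_mem Dq /set_mem Dq' /phii; rewrite !inE => /(_ (bD _ Dq) (bD _ Dq')).
  case: q q' {Dq Dq'} => [x p] [x' p'] [/addrI /(scalerI e0') -> /addrI /(scalerI e0') ->].
  by [].
- move=> q Dq; apply: (@continuous_comp _ _ _ b phi); first exact: cb.
  exact: phic (bD _ Dq).
- move=> O oO OD.
  rewrite (_ : _ @` O = phi @` (b @` O)); last by rewrite image_comp.
  apply: phio; last by move=> _ [q Oq <-]; apply/bD/OD.
  pose b' (q : 'rV[R]_k * 'rV[R]_(m - k)) :=
    (e^-1 *: (q.1 - x0), e^-1 *: (q.2 - p0)).
  rewrite (_ : b @` O = b' @^-1` O).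
    apply: open_comp => // q _.
    have ci (V : normedModType R) (c : V) : continuous (fun x => e^-1 *: (x - c)).
      move=> x; apply: cvgZ; first exact: cvg_cst.
      by apply: cvgB; [exact: cvg_id|exact: cvg_cst].
    exact: (continuous_prod_map (ci _ x0) (ci _ p0)).
  have K1 q : b' (b q) = q.
    case: q => x p; rewrite /b' /b /rescale /=.
    by rewrite ![_ + e *: _ - _]addrAC !subrr !add0r !scalerA !mulVf// !scale1r.
  have K2 q : b (b' q) = q.
    case: q => x p; rewrite /b' /b /rescale /=.
    by rewrite !scalerA !divff// !scale1r ![_ + (_ - _)]addrC !subrK.
  by apply/seteqP; split => [_ [q Oq <-]|q Oq] /=; [rewrite K1|exists (b' q)].
- move=> p Dp /=.
  have := leaf_chart_rescale (phil _ (Dmk _ Dp)) r_gt0 e0 Dk.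
  set y := phi (0, rescale p0 e p); set z := phi (rescale x0 e 0, rescale p0 e p).
  have yz : leaf W y z.
    have [sL _ _ _ _] := phil _ (Dmk _ Dp); apply: sL.
    by exists (rescale x0 e 0) => //; apply: Dk; exact: disc0.
  by rewrite (leaf_eq yz) (leaf_par_eq yz).
- move=> z v q Dq zq.
  have h := phid z (e *: v) (b q) (bD _ Dq) zq.
  rewrite (_ : (fun q' => _) = (fun q' : 'rV[R]_k * 'rV[R]_(m - k) =>
      'D_(e *: v) (fun x => chart z (phi (x, q'.2))) q'.1) \o b).
    exact: (@continuous_comp _ _ _ b _ q (cb q) h).
  apply/funext => q' /=.
  exact: (@rescale_derive R _ _ x0 e (fun x => chart z (phi (x, rescale p0 e q'.2)))).
Qed.

(** Invariance of a foliation speaks of sufficiently small local leaves, and those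
of a small box qualify. *)
Lemma small_foliation_box y (V : set M) : open_nbhs y V ->
  exists2 phi, box phi & phi (0, 0) = y /\ phi @` D `<=` V.
Proof.
move=> yV; have [phi bphi [[x0 p0] [/= Dx Dp] E]] := leaf_box W y.
have [_ phic _ _ _] := bphi.
have h : nbhs ((x0, p0) : 'rV[R]_k * 'rV[R]_(m - k)) (phi @^-1` V).
  by apply: phic => //; rewrite E; exact: open_nbhs_nbhs.
have h1 : nbhs x0 (disc R k) by apply: open_nbhs_nbhs; split => //; exact: disc_open.
have h2 : nbhs p0 (disc R (m - k)) by apply: open_nbhs_nbhs; split => //; exact: disc_open.
have [[A B] /= [xA pB] AB] := h.
have /nbhs_ballP[d1 /= d10 hd1] := nbhsI xA h1.
have /nbhs_ballP[d2 /= d20 hd2] := nbhsI pB h2.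
pose e := Num.min d1 d2 / 2.
have e0 : 0 < e by rewrite divr_gt0// lt_min d10.
have ed n (x c : 'rV[R]_n) d : Num.min d1 d2 <= d -> disc R n x -> ball c d (rescale c e x).
  move=> dd /disc_norm x1; rewrite mx_norm_ball /ball_/= /rescale opprD addrA subrr sub0r normrN.
  rewrite normrZ gtr0_norm//; apply: (@le_lt_trans _ _ e); first by rewrite ler_piMr// ltW.
  by apply: lt_le_trans dd; rewrite /e ltr_pdivrMr// mulr_natr mulr2n ltrDl lt_min d10.
have ex x : disc R k x -> (A `&` disc R k) (rescale x0 e x).
  by move=> Dx'; apply: hd1; apply: ed => //; rewrite ge_min lexx.
have ep p : disc R (m - k) p -> (B `&` disc R (m - k)) (rescale p0 e p).
  by move=> Dp'; apply: hd2; apply: ed => //; rewrite ge_min lexx orbT.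
exists (fun q => phi (rescale x0 e q.1, rescale p0 e q.2)).
  by apply: foliation_box_rescale => // [x /ex[]|p /ep[]].
split; first by rewrite /= /rescale !scaler0 !addr0.
by move=> _ [[x p] [/= /ex[Ax _] /ep[Bp _]] <-]; exact: AB.
Qed.

End boxes.

(** * Images of leaves under an invariant map *)

Lemma open_within (S T : topologicalType) (D : set S) (f : S -> T) (O : set T) :
  open D -> (forall x, D x -> {for x, continuous f}) -> open O -> open (D `&` f @^-1` O).
Proof.
move=> oD cf oO; rewrite openE => x [Dx fx]; apply: filterI; first exact: open_nbhs_nbhs.
by apply: cf => //; exact: open_nbhs_nbhs.
Qed.

Lemma open_setX (S T : topologicalType) (A : set S) (B : set T) :
  open A -> open B -> open (A `*` B).
Proof.
move=> oA oB; rewrite openE => -[x y] [/= Ax By]; exists (A, B) => //.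
by split; exact: open_nbhs_nbhs.
Qed.

Section leaves.
Context {R : realType} {m : nat} (M : rmanifold R m) (k : nat) (W : foliation M k 1).
Local Notation L := (leaf W).
Local Notation P := (leaf_par W).
Local Notation disc := (disc R k).

Lemma leaf_par_chart z s : P z s -> leaf_chart 1 (L z) (P z) s.
Proof. by have [h _] := leaf_submanifold W z; exact: h. Qed.

Lemma leaf_par_cover z : exists Q, [/\ Q `<=` P z, countable Q &
  L z `<=` \bigcup_(s in Q) (s @` disc)].
Proof. by have [_] := leaf_submanifold W z. Qed.

Lemma leaf_par_ex z y : L z y -> exists s x, [/\ P z s, disc x & s x = y].
Proof.
move=> zy; have [Q [QP _ cov]] := leaf_par_cover z.
by have [s Qs [x Dx E]] := cov _ zy; exists s, x; split => //; exact: QP.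
Qed.

Lemma leaf_chart_image_open r z s : leaf_chart r (L z) (P z) s -> leaf_open (P z) (s @` disc).
Proof. by move=> [_ _ _ _ [h _]]; apply: h => //; exact: disc_open. Qed.

Lemma leaf_chart_rank r (A : set M) (Q : set ('rV[R]_k -> M)) s x : leaf_chart r A Q s -> disc x -> \rank (dparam s x) = k.
Proof. by move=> [_ _ _ h _]; exact: h. Qed.

Lemma leaf_sym z y : L z y -> L y z.
Proof. by move=> zy; rewrite (leaf_eq zy); exact: leaf_refl. Qed.

Variable F : M -> M.
Hypothesis F_diffeo : local_diffeo 1 F.
Hypothesis F_inv : invariant_foliation W F.

(** Locally, [F] sends a leaf homeomorphically onto a leaf for the intrinsic
topologies.  A plaque [s @` disc] around [y] is mapped onto a plaque [s' @` disc];
inside a foliation box the intrinsic topology of a single plaque is the one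
induced by [M], so that continuity of [F] and of its local inverse suffices. *)
Lemma local_plaque y : exists s s' : 'rV[R]_k -> M,
  [/\ leaf_chart 1 (L y) (P y) s, s 0 = y, leaf_chart 1 (L (F y)) (P (F y)) s',
      F @` (s @` disc) = s' @` disc &
      (forall V, leaf_open (P (F y)) V -> open (disc `&` (F \o s) @^-1` V)) /\
      (forall O, open O -> O `<=` disc -> leaf_open (P (F y)) (F @` (s @` O)))].
Proof.
have [V [oV Vy] FV] := F_inv y.
have [V1 [G [[oV1 V1y] oFV1 GF [cG _]]]] := F_diffeo.2 y.
have [phi bphi [phi0 phiV]] := small_foliation_box W (ltn0Sn 0)
  (conj (openI oV oV1) (conj Vy V1y)).
have D0 := @disc0 R (m - k).
pose s x := phi (x, 0).
have sV x : disc x -> V (s x) /\ V1 (s x) by move=> Dx; apply: phiV; exists (x, 0).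
have [phi' [p' [bphi' Dp' FL]]] : local_leaf W (F @` plaque phi 0).
  apply: FV; first by exists phi, 0.
  by move=> _ [x /sV[Vx _] <-].
pose s' x := phi' (x, p').
have [phii phic phio phil _] := bphi; have [phii' phic' phio' phil' _] := bphi'.
have chs : leaf_chart 1 (L y) (P y) s by have := phil _ D0; rewrite phi0.
have Fs x : disc x -> exists2 x', disc x' & s' x' = F (s x).
  move=> Dx; have : (F @` plaque phi 0) (F (s x)) by exists (s x) => //; exists x.
  by rewrite FL => -[x' Dx' E]; exists x'.
have Fs' x' : disc x' -> exists2 x, disc x & s' x' = F (s x).
  move=> Dx'; have : plaque phi' p' (s' x') by exists x'.
  by rewrite -FL => -[_ [x Dx <-] E]; exists x.
have chs' : leaf_chart 1 (L (F y)) (P (F y)) s'.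
  have ch := phil' _ Dp'; have [sL _ _ _ _] := ch.
  have [x' Dx' E] := Fs 0 (@disc0 R k).
  have : L (phi' (0, p')) (F y) by rewrite -phi0 -[phi (0, 0)]/(s 0) -E; apply: sL; exists x'.
  by move=> h; rewrite (leaf_eq h) (leaf_par_eq h).
have cs x : disc x -> {for x, continuous s}.
  by have [_ _ [h _] _ _] := chs; exact: h.
have cs' x : disc x -> {for x, continuous s'}.
  by have [_ _ [h _] _ _] := chs'; exact: h.
have cF x : {for x, continuous F} by exact: F_diffeo.1.1.
have oD := @disc_open R k.
exists s, s'; split => //; split => [V' oV'|A oA AD].
  have [_ _ _ _ [_ o2]] := chs'.
  pose A' := disc `&` s' @^-1` V'.
  have oA' : open A' by exact: o2.
  (* An open set of [M] that cuts out the given piece of the plaque [s']. *)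
  pose N := phi' @` (A' `*` Defs.disc R (m - k)).
  have oN : open N.
    apply: phio'; last by move=> [x p] [[Dx _] Dp].
    by apply: open_setX => //; exact: disc_open.
  rewrite (_ : _ `&` _ = disc `&` (F \o s) @^-1` N).
    by apply: open_within => // x Dx; apply: continuous_comp; [exact: cs|exact: cF].
  apply/seteqP; split => x /= [Dx Fx]; split => //.
    have [x' Dx' E] := Fs x Dx; rewrite -E; exists (x', p') => //; split => //.
    by split => //; rewrite /= E.
  have [x' Dx' E] := Fs x Dx; case: Fx => -[u p] [[/= Du Vu] Dp] Eu.
  have : (x', p') = (u, p).
    by apply: phii'; rewrite ?inE//; rewrite Eu -E.
  by move=> [xu _]; rewrite -E xu.
have [_ _ _ _ [ o1 _]] := chs'.
(* The same device in the source, where the local inverse [G] is available. *)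
pose N := phi @` (A `*` Defs.disc R (m - k)).
have oN : open N.
  apply: phio; last by move=> [x p] [/AD ? Dp].
  by apply: open_setX => //; exact: disc_open.
rewrite (_ : _ @` _ = s' @` (disc `&` (G \o s') @^-1` N)).
  apply: o1; last by move=> x [].
  apply: open_within => // x Dx; apply: continuous_comp; first exact: cs'.
  have [u Du ->] := Fs' _ Dx; apply: cG; exists (s u) => //; exact: (sV u Du).2.
apply/seteqP; split => [_ [_ [x Ax <-] <-]|_ [x' [Dx' /= Nx'] <-]].
  have Dx := AD _ Ax; have [x' Dx' E] := Fs x Dx; exists x' => //; split => //=.
  by rewrite E GF; [exists (x, 0)|exact: (sV x Dx).2].
have [x Dx E] := Fs' _ Dx'; rewrite E GF in Nx'; last exact: (sV x Dx).2.
case: Nx' => -[u p] [/= Au Dp] Eu.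
have : (u, p) = (x, 0).
  by apply: phii; rewrite ?inE//; split => //; exact: AD.
by move=> [ux _]; rewrite E; exists (s x) => //; exists x => //; rewrite -ux.
Qed.

(** The points of the leaf of [z] that are sent to the leaf of [F z] form a set that is
open and closed in the leaf, because [F] sends plaques into leaves; so it is the
whole connected leaf. *)
Lemma leaf_image_sub z y : L z y -> L (F z) (F y).
Proof.
move=> zy.
(* Each point of the leaf has a neighbourhood whose image lies in one leaf. *)
pose V := L z `&` F @^-1` L (F z).
have loc u : L z u -> exists O, [/\ leaf_open (P z) O, O u, O `<=` L z &
    forall v, O v -> L (F u) (F v)].
  move=> zu; have [s [s' [chs s0 chs' FE _]]] := local_plaque u.
  rewrite (leaf_eq zu) (leaf_par_eq zu) in chs.
  exists (s @` disc); split.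
  - exact: leaf_chart_image_open chs.
  - by exists 0 => //; exact: disc0.
  - by case: chs.
  - move=> v [x Dx <-]; have [sL _ _ _ _] := chs'; apply: sL; rewrite -FE.
    by exists (s x) => //; exists x.
have [|||V0|VL] := @leaf_is_connected _ _ _ _ _ W z V.
- by move=> u [].
- apply: leaf_open_nbhs => u [zu Fu]; have [ O [ oO Ou OL OF]] := loc u zu.
  exists O; split => // v Ov; split; first exact: OL.
  by rewrite /= -(leaf_eq Fu); exact: OF.
- apply: leaf_open_nbhs => u [zu nVu]; have [ O [ oO Ou OL OF]] := loc u zu.
  exists O; split => // v Ov; split; first exact: OL.
  move=> [_ /= Fv]; apply: nVu; split => //=.
  by rewrite -(leaf_eq Fv); apply: leaf_sym; exact: OF.
- have : V z by split; exact: leaf_refl.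
  by rewrite V0.
- by have [_ Fy] : V y by rewrite VL.
Qed.

Lemma leaf_open_preimage z V : leaf_open (P (F z)) V -> leaf_open (P z) (L z `&` F @^-1` V).
Proof.
move=> oV; apply: leaf_open_nbhs => u [zu Vu].
have [s [s' [chs s0 chs' FE [cont _]]]] := local_plaque u.
rewrite (leaf_eq zu) (leaf_par_eq zu) in chs.
have Fzu := leaf_image_sub zu; rewrite -(leaf_par_eq Fzu) in oV.
have [sL _ _ _ [ o1 _]] := chs.
exists (s @` (disc `&` (F \o s) @^-1` V)); split.
- by apply: o1; [exact: cont|move=> x []].
- by exists 0 => //; split; [exact: disc0|rewrite /= s0].
- by move=> _ [x [Dx Vx] <-]; split => //; apply: sL; exists x.
Qed.

Lemma leaf_open_image z V : V `<=` L z -> leaf_open (P z) V -> leaf_open (P (F z)) (F @` V).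
Proof.
move=> VL oV; apply: leaf_open_nbhs => _ [u Vu <-].
have zu := VL _ Vu; have Fzu := leaf_image_sub zu.
have [s [s' [chs s0 chs' FE [_ cont]]]] := local_plaque u.
rewrite (leaf_eq zu) (leaf_par_eq zu) in chs; rewrite (leaf_par_eq Fzu) in cont.
have [_ _ _ _ [_ o2]] := chs.
exists (F @` (s @` (disc `&` s @^-1` V))); split.
- by apply: cont; [exact: o2|move=> x []].
- by exists u => //; exists 0 => //; split; [exact: disc0|rewrite /= s0].
- by move=> _ [_ [x [Dx Vx] <-] <-]; exists (s x).
Qed.

Lemma iter_leaf n z y : L z y -> L (iter n F z) (iter n F y).
Proof. by move=> zy; elim: n => //= n; exact: leaf_image_sub. Qed.

Lemma iter_leaf_open_preimage n z V : leaf_open (P (iter n F z)) V ->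
  leaf_open (P z) (L z `&` iter n F @^-1` V).
Proof.
elim: n V => [|n IH] V oV.
  apply: leaf_open_nbhs => u [zu Vu]; have [s [x [Ps Dx E]]] := leaf_par_ex zu.
  exists ((s @` disc) `&` V); split.
  - by apply: leaf_openI => //; apply: leaf_chart_image_open (leaf_par_chart Ps).
  - by split => //; exists x.
  - by move=> v [sv Vv]; split => //; have [sL _ _ _ _] := leaf_par_chart Ps; exact: sL.
rewrite (_ : _ `&` _ = L z `&` iter n F @^-1` (L (iter n F z) `&` F @^-1` V)).
  exact: IH (leaf_open_preimage oV).
apply/seteqP; split => u [zu /=]; last by case.
by move=> Fu; split => //; split => //; exact: iter_leaf.
Qed.

Lemma iter_leaf_open_image n z V : V `<=` L z -> leaf_open (P z) V ->
  leaf_open (P (iter n F z)) (iter n F @` V).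
Proof.
move=> VL oV; elim: n => [|n IH]; first by rewrite image_id.
rewrite (_ : iter n.+1 F @` V = F @` (iter n F @` V)); last by rewrite image_comp.
by apply: leaf_open_image => // _ [u /VL zu <-]; exact: iter_leaf.
Qed.

Lemma iter_leaf_inj n z : (forall z, set_inj (L z) F) -> set_inj (L z) (iter n F).
Proof.
move=> Fi; elim: n => [|n IH] x y /set_mem zx /set_mem zy //= E.
apply: IH; rewrite ?inE//.
by apply: (Fi (iter n F z)) E; rewrite inE; exact: iter_leaf.
Qed.

End leaves.

(** * The leafwise Jacobian and its chain rule *)

(** A change of frame by [A] multiplies the volume of the frame by [`|\det A|]. *)
Lemma sqrt_det_congr (R : realType) k m (A : 'M[R]_k) (B : 'M[R]_(k, m)) (g : 'M[R]_m) :
  Num.sqrt (\det ((A *m B) *m g *m (A *m B)^T)) =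
  `|\det A| * Num.sqrt (\det (B *m g *m B^T)).
Proof.
have -> : (A *m B) *m g *m (A *m B)^T = A *m (B *m g *m B^T) *m A^T.
  by rewrite trmx_mul !mulmxA.
rewrite !det_mulmx det_tr mulrAC -expr2.
by rewrite sqrtrM ?sqr_ge0// sqrtr_sqr.
Qed.

Section leaf_lift.
Context {R : realType} {m : nat} (M : rmanifold R m) (k : nat) (W : foliation M k 1).
Local Notation L := (leaf W).
Local Notation P := (leaf_par W).
Local Notation disc := (disc R k).

(** Continuity for the intrinsic topology of the leaf, which is in general finer than
the one of [M]: a map into the leaf may be continuous in [M] and yet jump from one
plaque to another. *)
Definition leafwise_at (z : M) (f : 'rV[R]_k -> M) x := forall V, leaf_open (P z) V ->
  V (f x) -> \forall y \near x, V (f y).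

Lemma leaf_chart_leafwise z s x : leaf_chart 1 (L z) (P z) s -> disc x -> leafwise_at z s x.
Proof.
move=> [_ _ _ _ [_ o2]] Dx V oV Vx.
have : nbhs x (disc `&` s @^-1` V) by apply: open_nbhs_nbhs; split => //; exact: o2.
by apply: filterS => y [].
Qed.

Lemma leaf_chart_sdiff_param z s x : leaf_chart 1 (L z) (P z) s -> disc x -> sdiff_param s x.
Proof.
by move=> [_ _ cs _ _] Dx; apply: Ck_param_sdiff_param cs Dx => //; exact: disc_open.
Qed.

Variables (z : M) (s : 'rV[R]_k -> M).
Hypothesis s_chart : leaf_chart 1 (L z) (P z) s.

(** The map [s^-1 \o f]; it takes the value 0 where [f] leaves the patch [s]. *)
Definition leaf_coord (f : 'rV[R]_k -> M) y : 'rV[R]_k :=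
  xget 0 [set u | disc u /\ s u = f y].

Lemma leaf_coordE f y u : disc u -> s u = f y -> leaf_coord f y = u.
Proof.
move=> Du E; rewrite /leaf_coord; case: xgetP => [v -> [Dv Ev]|/(_ u)].
  by have [_ si _ _ _] := s_chart; apply: si; rewrite ?inE// Ev.
by move=> h; exfalso; apply: h.
Qed.

Lemma leaf_coord_continuous f x u : disc u -> s u = f x -> leafwise_at z f x ->
  {for x, continuous (leaf_coord f)}.
Proof.
move=> Du E lf; rewrite /prop_for /continuous_at (leaf_coordE Du E) => N uN.
have [_ _ _ _ [ o1 _]] := s_chart.
have oN : open (interior N `&` disc) by apply: openI; [exact: open_interior|exact: disc_open].
have lo : leaf_open (P z) (s @` (interior N `&` disc)) by apply: o1 => // y [].
have lx : (s @` (interior N `&` disc)) (f x) by exists u.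
have := lf _ lo lx; apply: filterS => y [v [Nv Dv] Ev] /=.
by rewrite (leaf_coordE Dv Ev); exact: interior_subset Nv.
Qed.

Lemma leaf_coord_near f x u : disc u -> s u = f x -> leafwise_at z f x ->
  \forall y \near x, disc (leaf_coord f y) /\ s (leaf_coord f y) = f y.
Proof.
move=> Du E lf.
have su : (s @` disc) (f x) by exists u.
have := lf _ (leaf_chart_image_open s_chart) su; apply: filterS => y [v Dv Ev].
by rewrite (leaf_coordE Dv Ev).
Qed.

(** The coordinate map [s^-1 \o f] is a continuous lift of [f] through the immersion
[s]. *)
Lemma leaf_coord_sdiff f x u : disc u -> s u = f x -> leafwise_at z f x -> sdiff_param f x ->
  exists A, sdiff (leaf_coord f) x A /\ dparam f x = A *m dparam s u.
Proof.
move=> Du E lf [cf df].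
have [_ ds] := leaf_chart_sdiff_param s_chart Du.
have hu := leaf_coordE Du E.
have sfree : row_free (dparam s u).
  by rewrite /row_free (leaf_chart_rank s_chart Du).
rewrite E -hu in ds; rewrite -hu in sfree.
have near_eq : \forall y \near x,
    (chart (f x) \o s) (leaf_coord f y) = (chart (f x) \o f) y.
  by have := leaf_coord_near Du E lf; apply: filterS => y /= [_ ->].
have [hA Ef] := sdiff_lift ds sfree df (leaf_coord_continuous Du E lf) near_eq.
by exists (dparam f x *m pinvmx (dparam s (leaf_coord f x))); rewrite -hu.
Qed.

End leaf_lift.

Section leaf_determinant.
Context {R : realType} {m : nat} (M : rmanifold R m) (k : nat) (W : foliation M k 1).
Local Notation L := (leaf W).
Local Notation P := (leaf_par W).
Local Notation disc := (disc R k).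

(** The leafwise determinant is defined with a chosen tangent frame of the leaf.  The
frame of any other parametrization [f] differs from it by an invertible matrix,
whose determinant cancels in the quotient. *)
Lemma leaf_detE (f : 'rV[R]_k -> M) x (G : M -> M) : leafwise_at W (f x) f x -> sdiff_param f x ->
  \rank (dparam f x) = k -> sdiff_map G (f x) ->
  leaf_det W G (f x) = vol_density (G \o f) x / vol_density f x.
Proof.
move=> lf sf rk sG.
have ex : [set E | exists s u, [/\ P (f x) s, disc u, s u = f x & E = dparam s u]] !=set0.
  have [s [u [Ps Du E]]] := leaf_par_ex (leaf_refl W (f x)).
  by exists (dparam s u), s, u.
have [s [u [Ps Du E EF]]] : [set E | exists s u, [/\ P (f x) s, disc u, s u = f x & E = dparam s u]]
   (tangent_frame W (f x)) by case: ex => E hE; exact: (xgetPex 0 (ex_intro _ E hE)).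
have [A [_ dE]] := leaf_coord_sdiff (leaf_par_chart Ps) Du E lf sf.
rewrite /leaf_det EF.
have [_ dG] := sdiff_param_comp sf sG.
have detA : `|\det A| != 0.
  rewrite normr_eq0 -unitfE -unitmxE -row_free_unit /row_free eqn_leq rank_leq_row/=.
  by rewrite -[leqLHS]rk dE mxrankM_maxl.
have h1 : vol_density f x = `|\det A| *
    Num.sqrt (\det (dparam s u *m metric (f x) *m (dparam s u)^T)).
  by rewrite /vol_density dE sqrt_det_congr.
have h2 : vol_density (G \o f) x = `|\det A| *
    Num.sqrt (\det (dparam s u *m dmap G (f x) *m metric (G (f x)) *m
      (dparam s u *m dmap G (f x))^T)).
  have dG' : dparam (G \o f) x = A *m (dparam s u *m dmap G (f x)).
    by rewrite dG dE mulmxA.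
  by rewrite /vol_density dG' sqrt_det_congr.
by rewrite h1 h2 -mulf_div divff// mul1r.
Qed.

Variable F : M -> M.
Hypothesis F_diffeo : local_diffeo 1 F.
Hypothesis F_inv : invariant_foliation W F.

Lemma sdiff_map_iter n z : sdiff_map (iter n F) z /\ dmap (iter n F) z \in unitmx.
Proof.
elim: n => [|n [sn un]].
  have E : dmap (fun y : M => y) z = 1%:M by apply: sdiff_map_id_near => //; exact: filterE.
  split; last by rewrite E unitmx1.
  split; first exact: cvg_id.
  have zz := cdom_refl z; rewrite E.
  apply: (@sdiff_eq_near _ _ _ id).
    by have := nbhs_chart zz; apply: filterS => x /chartK_image[_ /= ->].
  move=> e e0; exists setT; first exact: filterT.
  by move=> y y' _ _; rewrite mulmx1 subrr normr0 mulr_ge0// ltW.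
have sF := local_diffeo_sdiff_map (iter n F z) (ltn0Sn 0) F_diffeo.
have [sS E] := sdiff_map_comp sn sF; split; first exact: sS.
have -> : dmap (iter n.+1 F) z = dmap (iter n F) z *m dmap F (iter n F z) by exact: E.
rewrite unitmx_mul; apply/andP; split; first exact: un.
exact: (local_diffeo_dmap_unit _ (ltn0Sn 0) F_diffeo).
Qed.

Lemma leafwise_iter n z t w : leaf_chart 1 (L z) (P z) t -> disc w ->
  leafwise_at W (iter n F z) (iter n F \o t) w.
Proof.
move=> tc Dw V oV Vw; have [tL _ _ _ _] := tc.
have := leaf_chart_leafwise tc Dw (iter_leaf_open_preimage F_diffeo F_inv oV).
have h : (L z `&` iter n F @^-1` V) (t w) by split => //; apply: tL; exists w.
by move=> /(_ h); apply: filterS => y [].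
Qed.

Lemma rank_iter n z t w : leaf_chart 1 (L z) (P z) t -> disc w ->
  sdiff_param (iter n F \o t) w /\ \rank (dparam (iter n F \o t) w) = k.
Proof.
move=> tc Dw; have [sn un] := sdiff_map_iter n (t w).
have [st E] := sdiff_param_comp (leaf_chart_sdiff_param tc Dw) sn; split => //.
by rewrite E mxrankMfree ?row_free_unit// (leaf_chart_rank tc Dw).
Qed.

Lemma leaf_det_iterE n z t w : leaf_chart 1 (L z) (P z) t -> disc w ->
  leaf_det W (iter n F) (t w) = vol_density (iter n F \o t) w / vol_density t w.
Proof.
move=> tc Dw; apply: leaf_detE.
- have [tL _ _ _ _] := tc; have zt : L z (t w) by apply: tL; exists w.
  rewrite /leafwise_at (leaf_par_eq zt); exact: leaf_chart_leafwise tc Dw.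
- exact: leaf_chart_sdiff_param tc Dw.
- exact: leaf_chart_rank tc Dw.
- by have [] := sdiff_map_iter n (t w).
Qed.

Lemma leaf_det_iter_gt0 n z : 0 < leaf_det W (iter n F) z.
Proof.
have [s [u [Ps Du <-]]] := leaf_par_ex (leaf_refl W z).
have sc := leaf_par_chart Ps.
rewrite (leaf_det_iterE _ sc Du) divr_gt0//; apply: vol_density_gt0.
  by have [] := rank_iter n sc Du.
exact: leaf_chart_rank sc Du.
Qed.

(** Both factors are quotients of volume densities along the same patch, and the
density at the intermediate time cancels. *)
Lemma leaf_det_iterS n z :
  leaf_det W (iter n.+1 F) z = leaf_det W (iter n F) z * leaf_det W F (iter n F z).
Proof.
have [s [u [Ps Du <-]]] := leaf_par_ex (leaf_refl W z).
have sc := leaf_par_chart Ps.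
have [sn rn] := rank_iter n sc Du.
have zs : L z (s u) by have [sL _ _ _ _] := sc; apply: sL; exists u.
have h : leaf_det W F ((iter n F \o s) u) =
   vol_density (F \o (iter n F \o s)) u / vol_density (iter n F \o s) u.
  apply: leaf_detE => //; last exact: local_diffeo_sdiff_map _ (ltn0Sn 0) F_diffeo.
  rewrite /leafwise_at (leaf_par_eq (iter_leaf F_diffeo F_inv n zs)).
  exact: leafwise_iter sc Du.
rewrite !(leaf_det_iterE _ sc Du) [leaf_det W F _]h.
have a0 := vol_density_gt0 rn; have b0 := vol_density_gt0 (leaf_chart_rank sc Du).
rewrite -[vol_density (iter n.+1 F \o s) u]/(vol_density (F \o (iter n F \o s)) u).
move: (vol_density _ _) (vol_density _ _) (vol_density _ _) a0 b0 => c b a b0 a0.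
by field; rewrite !gt_eqF.
Qed.

Lemma ln_leaf_det_iter n z :
  ln (leaf_det W (iter n F) z) = \sum_(0 <= i < n) ln (leaf_det W F (iter i F z)).
Proof.
elim: n => [|n IH].
  rewrite big_nil; have [s [u [Ps Du <-]]] := leaf_par_ex (leaf_refl W z).
  have sc := leaf_par_chart Ps.
  rewrite (leaf_det_iterE 0 sc Du) divff ?ln1// gt_eqF// vol_density_gt0//.
  exact: leaf_chart_rank sc Du.
rewrite big_nat_recr//= -IH leaf_det_iterS lnM//; rewrite posrE.
  exact: leaf_det_iter_gt0.
exact: (leaf_det_iter_gt0 1).
Qed.

End leaf_determinant.

(** * Continuity of the leafwise Jacobian *)

(** In a foliation box, the leafwise determinant at [phi q] is a quotient of volume
densities along the plaque of [q].  The plaques depend continuously on [q] in the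
C^1 topology, hence so do their Gram matrices and those of their images under
[F]. *)
Section continuity.
Context {R : realType} {m : nat} (M : rmanifold R m) (k : nat) (W : foliation M k 1).
Local Notation L := (leaf W).
Local Notation P := (leaf_par W).
Local Notation D := (disc R k `*` disc R (m - k)).
Local Notation T := ('rV[R]_k * 'rV[R]_(m - k))%type.

Variable F : M -> M.
Hypothesis F_diffeo : local_diffeo 1 F.
Variable phi : T -> M.
Hypothesis phi_box : foliation_box 1 L P phi.

Let plaque_par (q : T) : 'rV[R]_k -> M := fun x => phi (x, q.2).

Let D_open : open (D : set T).
Proof. by apply: open_setX; exact: disc_open. Qed.

Let plaque_chart q : D q ->
  leaf_chart 1 (L (phi (0, q.2))) (P (phi (0, q.2))) (plaque_par q).
Proof. by move=> [_ Dp]; have [_ _ _ h _] := phi_box; exact: h. Qed.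

Let plaque_sdiff_param q : D q -> sdiff_param (plaque_par q) q.1.
Proof. by move=> Dq; apply: leaf_chart_sdiff_param (plaque_chart Dq) _; case: Dq. Qed.

Let phiE q : phi q = plaque_par q q.1.
Proof. by case: q. Qed.

Let phi_continuous q : D q -> {for q, continuous phi}.
Proof. by have [_ h _ _ _] := phi_box; exact: h. Qed.

Let box_jacobian c q0 : D q0 -> cdom c (phi q0) ->
  (fun q => 'J (chart c \o plaque_par q) q.1) @ nbhs q0 -->
  'J (chart c \o plaque_par q0) q0.1.
Proof.
move=> Dq0 cq0; apply: cvg_matrix => i j.
pose d (q : T) := ('D_(delta_mx ord0 i : 'rV[R]_k) (fun x => chart c (phi (x, q.2))) q.1
   : 'rV[R]_m).
have dE q : D q -> cdom c (phi q) -> d q ord0 j = 'J (chart c \o plaque_par q) q.1 i j.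
  move=> Dq cq; rewrite phiE in cq.
  have [df _ _] := sdiff_param_chart (plaque_sdiff_param Dq) cq.
  have := deriveEjacobian (delta_mx ord0 i : 'rV[R]_k) df.
  rewrite -rowE => h; refine (etrans (congr1 (fun v : 'rV[R]_m => v ord0 j) h) _).
  by rewrite [LHS]mxE.
have cd : {for q0, continuous d} by have [_ _ _ _ h] := phi_box; exact: h.
have cdj : (fun q => d q ord0 j) @ nbhs q0 --> d q0 ord0 j.
  exact: (@cvg_entry R _ (nbhs q0) 1 m d (d q0) ord0 j cd).
rewrite (dE _ Dq0 cq0) in cdj; apply: cvg_trans cdj; apply: near_eq_cvg.
have h1 : nbhs q0 D by exact: open_nbhs_nbhs.
have h2 : nbhs q0 (phi @^-1` cdom c) by apply: (phi_continuous Dq0); exact: nbhs_cdom.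
by apply: filterS2 h1 h2 => q Dq cq; exact: dE.
Qed.

Let box_jacobian_F c c' q0 : D q0 -> cdom c (phi q0) -> cdom c' (F (phi q0)) ->
  (fun q => 'J (chart c' \o (F \o plaque_par q)) q.1) @ nbhs q0 -->
  'J (chart c' \o (F \o plaque_par q0)) q0.1.
Proof.
move=> Dq0 cq0 cF0.
pose H := chart c' \o F \o param c.
pose U := cdom c `&` F @^-1` cdom c'.
have cF z : {for z, continuous F} by exact: F_diffeo.1.1.
have oU : open U by apply: open_within => //; [exact: cdom_open|exact: cdom_open].
have oCU : open (chart c @` U).
  have UE : cdom c `&` U = U by apply/seteqP; split => x; [case=> ? []|case].
  by rewrite -UE; exact: chart_image_open.
have cH : Ck 1 (chart c @` U) H.
  by have := F_diffeo.1.2 c c'; apply: Ck_sub => _ [y [cy Fy] <-]; exists y.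
have JE q : D q -> U (phi q) ->
    'J (chart c \o plaque_par q) q.1 *m 'J H (chart c (phi q)) =
    'J (chart c' \o (F \o plaque_par q)) q.1.
  move=> Dq [cq Fq]; have cq' : cdom c (plaque_par q q.1) by rewrite -phiE.
  have [_ s1 _] := sdiff_param_chart (plaque_sdiff_param Dq) cq'.
  have s2 : sdiff H ((chart c \o plaque_par q) q.1) ('J H (chart c (phi q))).
    by rewrite /= -phiE; apply: (Ck1_sdiff oCU cH); exists (phi q).
  have s3 : sdiff (chart c' \o (F \o plaque_par q)) q.1
      ('J (chart c \o plaque_par q) q.1 *m 'J H (chart c (phi q))).
    apply: sdiff_eq_near (sdiff_comp s1 s2).
    have := near_cdom (plaque_sdiff_param Dq).1 cq'; apply: filterS => x cx.
    by rewrite /H /= chartK.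
  by have [_ ->] := sdiff_jacobian s3.
rewrite -(JE _ Dq0 (conj cq0 cF0)).
have U0 : U (phi q0) by [].
have h1 : nbhs q0 D by exact: open_nbhs_nbhs.
have h2 : nbhs q0 (phi @^-1` U) by apply: (phi_continuous Dq0); exact: open_nbhs_nbhs.
have c1 : (fun q => 'J H (chart c (phi q))) @ nbhs q0 --> 'J H (chart c (phi q0)).
  apply: (@cvg_comp _ _ _ (fun q => chart c (phi q)) (fun x => 'J H x) _
     (nbhs (chart c (phi q0)))).
    apply: (@cvg_comp _ _ _ phi (chart c) _ (nbhs (phi q0))); first exact: phi_continuous.
    exact: chart_continuous.
  by apply: (Ck1_jacobian_continuous oCU cH); exists (phi q0).
have := @cvg_mulmx R T (nbhs q0) (nbhs_filter q0) _ _ _ _ _ _ _ (box_jacobian Dq0 cq0) c1.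
apply: cvg_trans; apply: near_eq_cvg.
by apply: filterS2 h1 h2 => q Dq Uq; exact: JE.
Qed.

Let leaf_det_box q : D q -> leaf_det W F (phi q) =
  Num.sqrt (\det (gram (F \o plaque_par q) q.1)) / Num.sqrt (\det (gram (plaque_par q) q.1)).
Proof.
move=> Dq; rewrite {1}phiE; have ch := plaque_chart Dq; have Dq1 : disc R k q.1 by case: Dq.
apply: leaf_detE.
- have [sL _ _ _ _] := ch.
  have h : L (phi (0, q.2)) (plaque_par q q.1) by apply: sL; exists q.1.
  by rewrite /leafwise_at (leaf_par_eq h); exact: leaf_chart_leafwise ch Dq1.
- exact: plaque_sdiff_param.
- exact: leaf_chart_rank ch Dq1.
- exact: local_diffeo_sdiff_map _ (ltn0Sn 0) F_diffeo.
Qed.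

Let cvg_sqrt_det (f : T -> 'M[R]_k) q0 : f @ nbhs q0 --> f q0 ->
  (fun q => Num.sqrt (\det (f q))) @ nbhs q0 --> Num.sqrt (\det (f q0)).
Proof.
move=> cf.
apply: (@cvg_comp _ _ _ (fun q => \det (f q)) Num.sqrt _ (nbhs (\det (f q0)))).
  exact: (@cvg_det R T (nbhs q0)).
exact: sqrt_continuous.
Qed.

Lemma leaf_det_box_continuous q0 : D q0 -> (fun q => leaf_det W F (phi q)) @ nbhs q0 -->
  leaf_det W F (phi q0).
Proof.
move=> Dq0; have ch := plaque_chart Dq0; have Dq1 : disc R k q0.1 by case: Dq0.
have h1 : nbhs q0 D by exact: open_nbhs_nbhs.
have sF z : sdiff_map F z by exact: local_diffeo_sdiff_map _ (ltn0Sn 0) F_diffeo.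
have cF z : {for z, continuous F} by exact: F_diffeo.1.1.
have cphi := phi_continuous Dq0.
have phi_eq : (fun q => plaque_par q q.1) = phi by apply/funext => q; rewrite phiE.
have g1 : (fun q => gram (plaque_par q) q.1) @ nbhs q0 --> gram (plaque_par q0) q0.1.
  apply: (@cvg_gram R m M T (nbhs q0) _ k plaque_par (fun q => q.1) q0 (phi q0)).
  - by apply: filterS h1 => q; exact: plaque_sdiff_param.
  - exact: plaque_sdiff_param.
  - by rewrite -phiE; exact: cdom_refl.
  - by rewrite phi_eq -phiE.
  - by apply: box_jacobian => //; exact: cdom_refl.
have g2 : (fun q => gram (F \o plaque_par q) q.1) @ nbhs q0 --> gram (F \o plaque_par q0) q0.1.
  apply: (@cvg_gram R m M T (nbhs q0) _ k (fun q => F \o plaque_par q) (fun q => q.1) q0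
    (F (phi q0))).
  - by apply: filterS h1 => q /plaque_sdiff_param sq; have [] := sdiff_param_comp sq (sF _).
  - by have [] := sdiff_param_comp (plaque_sdiff_param Dq0) (sF (plaque_par q0 q0.1)).
  - by rewrite /= -phiE; exact: cdom_refl.
  - rewrite /= (_ : (fun q => F (plaque_par q q.1)) = F \o phi); last first.
      by apply/funext => q /=; rewrite phiE.
    rewrite -phiE; exact: continuous_comp.
  - by apply: (@box_jacobian_F (phi q0)) => //; exact: cdom_refl.
have q2 := @cvg_sqrt_det (fun q => gram (F \o plaque_par q) q.1) q0 g2.
have q1 := @cvg_sqrt_det (fun q => gram (plaque_par q) q.1) q0 g1.
have nz : Num.sqrt (\det (gram (plaque_par q0) q0.1)) != 0.
  by apply: lt0r_neq0; rewrite sqrtr_gt0; apply/gram_det_gt0/(leaf_chart_rank ch Dq1).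
pose a q := Num.sqrt (\det (gram (F \o plaque_par q) q.1)).
pose b q := Num.sqrt (\det (gram (plaque_par q) q.1)).
have qq : (fun q => a q / b q) @ nbhs q0 --> a q0 / b q0.
  by apply: (@cvgM _ _ (nbhs q0) _ a (fun q => (b q)^-1)); [exact: q2|exact: cvgV].
rewrite (leaf_det_box Dq0); apply: cvg_trans qq; apply: near_eq_cvg.
by apply: filterS h1 => q Dq; exact: esym (leaf_det_box Dq).
Qed.

End continuity.

(** A foliation box is an open map, so continuity may be tested after composition
with it. *)
Lemma leaf_det_continuous (R : realType) m (M : rmanifold R m) k (W : foliation M k 1)
    (F : M -> M) : local_diffeo 1 F -> continuous (leaf_det W F).
Proof.
move=> F_diffeo z.
have [phi bphi [q0 Dq0 <-]] := leaf_box W z.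
move=> N /(leaf_det_box_continuous F_diffeo bphi Dq0) hN.
have [_ _ phio _ _] := bphi.
have oD : open (disc R k `*` disc R (m - k)) by apply: open_setX; exact: disc_open.
have hD := open_nbhs_nbhs (conj oD Dq0).
have : nbhs q0 (interior ((fun q => leaf_det W F (phi q)) @^-1` N) `&` (disc R k `*` disc R (m - k))).
  by apply: nbhsI => //; apply: nbhs_interior.
set A := _ `&` _ => /nbhs_singleton Aq0.
have oA : open A by apply: openI => //; exact: open_interior.
have : nbhs (phi q0) (phi @` A).
  by apply: open_nbhs_nbhs; split; [apply: phio => // q []|exists q0].
by apply: filterS => _ [q [Nq _] <-]; exact: (interior_subset Nq).
Qed.

(** * Lebesgue measure on row vectors *)

Section borel_rV.
Context {R : realType}.

Lemma measurable_borel_open (T : ptopologicalType) (A : set (borel T)) :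
  open (A : set T) -> measurable A.
Proof. exact: sub_sigma_algebra. Qed.

Lemma measurable_borel_closed (T : ptopologicalType) (A : set (borel T)) :
  closed (A : set T) -> measurable A.
Proof.
move=> cA; rewrite -(setCK A); apply: measurableC.
by apply: measurable_borel_open; exact: closed_openC.
Qed.

Lemma measurable_borel_fun d (S : measurableType d) (T : ptopologicalType)
    (D : set S) (f : S -> borel T) :
  (forall O : set T, open O -> measurable (D `&` f @^-1` O)) -> measurable_fun D f.
Proof.
move=> h; refine (@measurability _ _ S (borel T) D f (@open T : set (set T)) _ _) => //.
by move=> _ [ O oO <-]; exact: h.
Qed.

(** Rational balls form a countable base of the topology.  It is stated with
explicit indices, so that the balls of the base can be enumerated. *)
Lemma rV_rational_ball n (O : set 'rV[R]_n) (x : 'rV[R]_n) :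
  open O -> O x -> exists (q : 'rV[rat]_n) (i : nat),
    ball (map_mx ratr q : 'rV[R]_n) i.+1%:R^-1 x /\
    ball (map_mx ratr q : 'rV[R]_n) i.+1%:R^-1 `<=` O.
Proof.
move=> oO Ox; have /nbhs_ballP[e /= e0 be] : nbhs x O by exact: open_nbhs_nbhs.
have [i ie] : exists i, i.+1%:R^-1 < e / 2 :> R.
  have e20 : 0 < e / 2 by rewrite divr_gt0.
  exists (Num.trunc (e/2)^-1); rewrite invf_plt ?posrE//.
  exact: truncnS_gt.
have i0 : 0 < i.+1%:R^-1 :> R by rewrite invr_gt0.
have /choice[q qP] (j : 'I_n) : exists q : rat, ball (ratr q : R) i.+1%:R^-1 (x ord0 j).
  have [q] := @rat_in_itvoo R (x ord0 j - i.+1%:R^-1) (x ord0 j) (ltac:(by rewrite ltrBlDr ltrDl)).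
  rewrite in_itv/= => /andP[h1 h2]; exists q.
  rewrite /ball/=; move: i0 h1 h2; move: (i.+1%:R^-1) => d d0 h1 h2.
  by rewrite ltr_norml; apply/andP; split; lra.
exists (\row_j q j), i; split.
  by split => // a j; rewrite !mxE (ord1 a); exact: qP.
move=> y yb; apply: be; apply: (@ball_splitr _ _ (map_mx ratr (\row_j q j) : 'rV[R]_n)).
  by apply: (le_ball (ltW ie)); split => // a j; rewrite !mxE (ord1 a); exact: qP.
by apply: (le_ball (ltW ie)).
Qed.

(** Adding a coordinate is continuous, but the source carries the product of two
Borel structures and not the Borel structure of the product.  The two agree
because an open set is a countable union of products of rational balls. *)
Lemma measurable_row_mx p :
  measurable_fun setT (fun x : measurableTypeR R * borel 'rV[R]_p =>
     (row_mx (x.1%:M : 'rV[R]_1) x.2 : borel 'rV[R]_p.+1)).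
Proof.
apply: measurable_borel_fun => O oO; rewrite setTI.
pose good (k : 'rV[rat]_p.+1 * nat) : Prop :=
  ball (map_mx ratr k.1 : 'rV[R]_p.+1) k.2.+1%:R^-1 `<=` O.
pose A (k : 'rV[rat]_p.+1 * nat) : set (measurableTypeR R * borel 'rV[R]_p) :=
  if `[< good k >] then
    ball (ratr (k.1 ord0 ord0) : R) k.2.+1%:R^-1 `*`
    ball (map_mx ratr (rsubmx (k.1 : 'rV[rat]_(1 + p))) : 'rV[R]_p) k.2.+1%:R^-1
  else set0.
have bE (k : 'rV[rat]_p.+1 * nat) (x : measurableTypeR R * borel 'rV[R]_p) :
  ball (map_mx ratr k.1 : 'rV[R]_p.+1) k.2.+1%:R^-1
       (row_mx (x.1%:M : 'rV[R]_1) x.2) <->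
  (ball (ratr (k.1 ord0 ord0) : R) k.2.+1%:R^-1 `*`
    ball (map_mx ratr (rsubmx (k.1 : 'rV[rat]_(1 + p))) : 'rV[R]_p) k.2.+1%:R^-1) x.
  split.
    move=> [k0 h]; split => /=.
      have := h ord0 ord0; rewrite mxE.
      have -> : (ord0 : 'I_p.+1) = lshift p (ord0 : 'I_1) by exact: val_inj.
      by rewrite (row_mxEl (x.1%:M : 'rV_1)) mxE eqxx.
    split => // a j; rewrite (ord1 a) !mxE.
    have := h ord0 (rshift 1 j); rewrite mxE.
    by rewrite (row_mxEr (x.1%:M : 'rV_1)).
  move=> [/= h1 [k0 h2]]; split => // a j; rewrite (ord1 a) mxE.
  case: (@split_ordP 1 p j) => l ->.
    rewrite (ord1 l) (row_mxEl (x.1%:M : 'rV_1)) mxE eqxx.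
    by have -> : (lshift p (ord0 : 'I_1)) = ord0 by exact: val_inj.
  rewrite (row_mxEr (x.1%:M : 'rV_1)).
  by have := h2 ord0 l; rewrite !mxE.
rewrite (_ : _ @^-1` O = \bigcup_k (if @unpickle ('rV[rat]_p.+1 * nat)%type k is Some k' then A k' else set0)).
  apply: bigcupT_measurable => k; case: unpickle => [k'|]; last exact: measurable0.
  rewrite /A; case: ifP => _; last exact: measurable0.
  apply: measurableX; first by apply: open_measurable; exact: ball_open.
  by apply: measurable_borel_open; exact: ball_open.
apply/seteqP; split => [x /= Ox|x [k _]].
  have [q [i [h1 h2]]] := rV_rational_ball oO Ox.
  exists (pickle (q, i)) => //; rewrite pickleK /A.
  case: asboolP => [_|]; last by move=> /(_ h2).
  exact/(bE (q,i)).
case: unpickle => // -[q i]; rewrite /A; case: asboolP => // g /bE.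
exact: g.
Qed.

End borel_rV.

Section sigma_finite_pack.
Context d (T : measurableType d) (R : realType) (mu : {measure set T -> \bar R}).

(** A synonym of [mu] that depends on the proof of sigma-finiteness, so that the
structure of sigma-finite measure can be attached to it. *)
Definition sigma_finite_pack (_ : sigma_finite setT mu) : set T -> \bar R := mu.
Hypothesis mu_sf : sigma_finite setT mu.
HB.instance Definition _ := Measure.copy (sigma_finite_pack mu_sf) mu.
HB.instance Definition _ :=
  Measure_isSigmaFinite.Build _ _ _ (sigma_finite_pack mu_sf) mu_sf.

End sigma_finite_pack.

Section lebesgue_rV_measure.
Context {R : realType}.
Local Open Scope ereal_scope.

(** The recursion formula of Lebesgue measure is the one of the product measure of
the line and a measure [mu] in one dimension less, transported to row
vectors. *)
Lemma leb_rVE p (mu : {sigma_finite_measure set (borel 'rV[R]_p) -> \bar R}) :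
  mu = lebesgue_rV R p :> (set _ -> _) ->
  pushforward (lebesgue_measure \x mu)
   (fun x : measurableTypeR R * borel 'rV[R]_p =>
     (row_mx (x.1%:M : 'rV[R]_1) x.2 : borel 'rV[R]_p.+1)) = lebesgue_rV R p.+1.
Proof.
move=> muE; apply/funext => A; rewrite /pushforward /product_measure1 /lebesgue_rV /=.
apply: eq_integral => t _; rewrite muE /lebesgue_rV; congr (leb_rV _).
by apply/seteqP; split => v; rewrite /xsection /= inE.
Qed.

(** Sigma-finiteness is carried along the induction, since a product measure
requires it of its second factor; so is finiteness on balls, which yields
it. *)
Lemma lebesgue_rV_ex n :
  exists mu : {sigma_finite_measure set (borel 'rV[R]_n) -> \bar R},
    (mu = lebesgue_rV R n :> (set _ -> _)) /\
    forall N : nat, mu (ball (0%R : 'rV[R]_n) N.+1%:R) < +oo.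
Proof.
elim: n => [|p [mu [muE muB]]].
  exists (dirac (0%R : borel 'rV[R]_0) : {sigma_finite_measure set _ -> \bar R}).
  split.
    by apply/funext => A; rewrite /lebesgue_rV /=.
  by move=> N; rewrite /= /dirac ltry.
pose T := (fun x : measurableTypeR R * borel 'rV[R]_p =>
     (row_mx (x.1%:M : 'rV[R]_1) x.2 : borel 'rV[R]_p.+1)).
have mT : measurable_fun setT T := @measurable_row_mx R p.
pose nu0 : {measure set (borel 'rV[R]_p.+1) -> \bar R} :=
   measure_function_pushforward__canonical__measure_function_Measure
     (lebesgue_measure \x mu : {measure set _ -> \bar R}) mT.
have nuE : nu0 = lebesgue_rV R p.+1 :> (set _ -> _) by rewrite -(leb_rVE muE).
have nuB N : nu0 (ball (0%R : 'rV[R]_p.+1) N.+1%:R) < +oo.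
  rewrite /nu0 /= /pushforward.
  apply: (@le_lt_trans _ _ ((lebesgue_measure \x mu)
     (ball (0%R:R) N.+1%:R `*` ball (0%R : 'rV[R]_p) N.+1%:R))).
    apply: le_measure; rewrite ?inE.
    - rewrite -[X in measurable X]setTI; apply: (mT) => //; apply: measurable_borel_open.
      exact: ball_open.
    - apply: measurableX; first by apply: open_measurable; exact: ball_open.
      by apply: measurable_borel_open; exact: ball_open.
    - move=> x [N0 h]; split.
        have := h ord0 ord0; rewrite mxE.
        have -> : (ord0 : 'I_p.+1) = lshift p (ord0 : 'I_1) by exact: val_inj.
        by rewrite (row_mxEl (x.1%:M : 'rV_1)) mxE eqxx.
      split => // a j; rewrite (ord1 a) mxE.
      have := h ord0 (rshift 1 j); rewrite mxE.
      by rewrite (row_mxEr (x.1%:M : 'rV_1)).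
  rewrite product_measure1E.
  - have h := @lebesgue_measure_ball R 0%R N.+1%:R (ler0n _ _).
    by apply: lte_mul_pinfty => //; rewrite [X in X \is a _]h.
  - by apply: open_measurable; exact: ball_open.
  - by apply: measurable_borel_open; exact: ball_open.
have sf : sigma_finite setT nu0.
  exists (fun N => ball (0%R : 'rV[R]_p.+1) N.+1%:R).
    apply/esym/seteqP; split => // x _.
    exists (Num.trunc `|x|) => //; rewrite mx_norm_ball /ball_ /= sub0r normrN.
    exact: truncnS_gt.
  move=> N; split; last exact: nuB.
  by apply: measurable_borel_open; exact: ball_open.
by exists (sigma_finite_pack sf).
Qed.

Let lebesgue_rV0 n : lebesgue_rV R n set0 = 0.
Proof. by have [mu [<- _]] := lebesgue_rV_ex n. Qed.
Let lebesgue_rV_ge0 n A : 0 <= lebesgue_rV R n A.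
Proof. by have [mu [<- _]] := lebesgue_rV_ex n. Qed.
Let lebesgue_rV_sigma_additive n : semi_sigma_additive (lebesgue_rV R n).
Proof.
by have [mu [<- _]] := lebesgue_rV_ex n; exact: measure_semi_sigma_additive.
Qed.
HB.instance Definition _ n := isMeasure.Build _ _ _ (lebesgue_rV R n)
  (lebesgue_rV0 n) (@lebesgue_rV_ge0 n) (@lebesgue_rV_sigma_additive n).

Let lebesgue_rV_sigma_finite n : sigma_finite setT (lebesgue_rV R n).
Proof. by have [mu [<- _]] := lebesgue_rV_ex n; exact: sigma_finiteT. Qed.
HB.instance Definition _ n := Measure_isSigmaFinite.Build _ _ _ (lebesgue_rV R n)
  (@lebesgue_rV_sigma_finite n).

Lemma lebesgue_rV_ball_fin n (N : nat) :
  lebesgue_rV R n (ball (0%R : 'rV[R]_n) N.+1%:R) < +oo.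
Proof. by have [mu [<- h]] := lebesgue_rV_ex n. Qed.

Lemma lebesgue_rVS n (A : set (borel 'rV[R]_n.+1)) :
  lebesgue_rV R n.+1 A =
  \int[lebesgue_measure]_t lebesgue_rV R n
     [set v : 'rV[R]_n | A (row_mx (t%:M : 'rV[R]_1) v)].
Proof. by []. Qed.

End lebesgue_rV_measure.

(** * Outer regularity of finite Borel measures *)

(** The sets that are approximated in measure by closed sets from inside and by open
sets from outside form a sigma-algebra, which contains the open sets. *)
Section regularity.
Context {R : realType} {n : nat}.
Variable nu : {measure set (borel 'rV[R]_n) -> \bar R}.
Hypothesis nu_fin : (nu setT < +oo)%E.
Local Open Scope ereal_scope.

Let approximable (A : set (borel 'rV[R]_n)) := forall e : R, (0 < e)%R ->
  exists U K : set 'rV[R]_n,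
    [/\ open U, closed K, K `<=` A, A `<=` U & nu (U `\` K) <= e%:E].

Let mO (U : set 'rV[R]_n) : open U -> measurable (U : set (borel 'rV[R]_n)).
Proof. exact: measurable_borel_open. Qed.
Let mC (U : set 'rV[R]_n) : closed U -> measurable (U : set (borel 'rV[R]_n)).
Proof. exact: measurable_borel_closed. Qed.
Let nu_lty A : measurable A -> nu A < +oo.
Proof. by move=> mA; apply: le_lt_trans nu_fin; apply: le_measure; rewrite ?inE. Qed.

Let nonincreasing_small (D : nat -> set (borel 'rV[R]_n)) (e d : R) :
  (forall i, measurable (D i)) -> nonincreasing_seq D -> (d < e)%R ->
  nu (\bigcap_i D i) <= d%:E -> exists i, nu (D i) <= e%:E.
Proof.
move=> mD nD de h.
have mI : measurable (\bigcap_i D i) by exact: bigcapT_measurable.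
have cv := nonincreasing_cvg_mu (nu_lty (mD 0%N)) mD mI nD.
have [i _ hi] : \forall i \near \oo, nu (D i) < e%:E.
  by apply: (cv [set y | y < e%:E]); apply: open_ereal_lt'; apply: le_lt_trans h _; rewrite lte_fin.
by exists i; apply/ltW/hi => /=.
Qed.

Let approximable_open (U : set 'rV[R]_n) : open U -> approximable U.
Proof.
move=> oU e e0.
pose K i := ~` \bigcup_(y in ~` U) ball y (i.+1%:R^-1)%R.
have cK i : closed (K i).
  by apply: open_closedC; apply: bigcup_open => y _; exact: ball_open.
have KU i : K i `<=` U.
  move=> x Kx; apply: contrapT => Ux; apply: Kx; exists x => //.
  by apply: ballxx; rewrite invr_gt0.
have [i hi] : exists i, nu (U `\` K i) <= e%:E.
  apply: (@nonincreasing_small _ _ 0) => //.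
  - by move=> i; apply: measurableD; [exact: mO|exact: mC].
  - move=> i j ij; apply/subsetPset; apply: setDS => x Kx [y Uy yx]; apply: Kx.
    exists y => //; apply: le_ball yx.
    by rewrite lef_pV2 ?posrE// ler_nat ltnS.
  - rewrite (_ : \bigcap_i _ = set0) ?measure0//.
    apply/seteqP; split => // x h; have [Ux _] := h 0%N I.
    have /nbhs_ballP[d /= d0 dU] : nbhs x U by exact: open_nbhs_nbhs.
    have id : ((Num.trunc d^-1).+1%:R^-1 < d)%R.
      by rewrite invf_plt ?posrE//; exact: truncnS_gt.
    have [_ +] := h (Num.trunc d^-1) I; apply => -[y Uy yx]; apply: Uy; apply: dU.
    by apply: (le_ball (ltW id)); exact: ball_sym.
by exists U, (K i); split.
Qed.

Let approximable_sigma : sigma_algebra setT approximable.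
Proof.
split.
- by apply: approximable_open; exact: open0.
- move=> A aA e e0; have [U [K [oU cK KA AU h]]] := aA e e0.
  exists (~` K), (~` U); split.
  + exact: closed_openC.
  + exact: open_closedC.
  + by move=> x Ux; split => // /AU.
  + by move=> x [_ Ax] /KA.
  + by rewrite setDE setCK setIC -setDE.
- move=> A aA e e0.
  have e40 i : (0 < (e / 2) / (2 ^ i.+1)%:R)%R.
    by rewrite divr_gt0// ?divr_gt0// ltr0n expn_gt0.
  have /choice[UK h] i : exists UK : set 'rV[R]_n * set 'rV[R]_n,
    [/\ open UK.1, closed UK.2, UK.2 `<=` A i, A i `<=` UK.1 &
       nu (UK.1 `\` UK.2) <= ((e / 2) / (2 ^ i.+1)%:R)%:E].
    by have [U [K hh]] := aA i _ (e40 i); exists (U, K).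
  pose U := \bigcup_i (UK i).1.
  have oU : open U by apply: bigcup_open => i _; have [] := h i.
  pose K N := \big[setU/set0]_(i < N) (UK i).2.
  have cK N : closed (K N).
    apply: (@big_ind _ (fun S => closed S)); first exact: closed0.
      by move=> *; exact: closedU.
    by move=> i _; have [] := h i.
  have [N hN] : exists N, nu (U `\` K N) <= e%:E.
    apply: (@nonincreasing_small _ _ (e/2)%R).
    - by move=> N; apply: measurableD; [exact: mO|exact: mC].
    - move=> i j ij; apply/subsetPset; apply: setDS; exact: (@subset_bigsetU _ (fun i => (UK i).2) _ _ ij).
    - by rewrite ltr_pdivrMr// mulr_natr mulr2n ltrDl.
    - apply: (@le_trans _ _ (\sum_(i <oo) nu ((UK i).1 `\` (UK i).2))).
        apply: measure_sigma_subadditive.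
        + by move=> i; have [oi ci _ _ _] := h i; apply: measurableD; [exact: mO|exact: mC].
        + apply: bigcapT_measurable => N.
          by apply: measurableD; [exact: mO|exact: mC].
        + move=> x hx; have [[i _ Ux] _] := hx 0%N I.
          exists i => //; split => // Kx.
          by have [_ +] := hx i.+1 I; apply; rewrite /K big_ord_recr/=; right.
      have e20 : (0 <= e / 2)%R by rewrite divr_ge0// ltW.
      refine (le_trans _ (epsilon_trick0 xpredT e20)).
      by apply: lee_nneseries => [i _ _|i _]; [exact: measure_ge0|have [_ _ _ _] := h i; exact].
  exists U, (K N); split => //.
    move=> x Kx; have [i _ Kix] := @bigsetU_bigcup _ (fun i => (UK i).2) N x Kx.
    exists i => //.
    by have [_ _ + _ _] := h i; apply.
  by move=> x [i _ Ax]; exists i => //; have [_ _ _ + _] := h i; apply.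
Qed.

Lemma borel_rV_outer_regular (A : set (borel 'rV[R]_n)) (e : R) :
  measurable A -> (0 < e)%R ->
  exists U : set 'rV[R]_n, [/\ open U, A `<=` U & nu U <= nu A + e%:E].
Proof.
move=> mA e0.
have aA : approximable A.
  by apply: (smallest_sub approximable_sigma _ mA) => U; exact: approximable_open.
have [U [K [oU cK KA AU h]]] := aA e e0.
exists U; split => //.
rewrite (_ : (U : set (borel _)) = A `|` (U `\` A)); last by rewrite setDUK.
apply: le_trans (measureU2 _ _ _) _ => //; first by apply: measurableD => //; exact: mO.
rewrite leeD2l//; apply: le_trans h; apply: le_measure; rewrite ?inE.
- by apply: measurableD => //; exact: mO.
- by apply: measurableD; [exact: mO|exact: mC].
- exact: setDS.
Qed.

End regularity.

(** * Boxes *)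

Section boxes.
Context {R : realType}.

Lemma measurable_borel_real_fun (T : ptopologicalType) (D : set (borel T)) (f : T -> R) :
  (forall A : set R, open A -> measurable (D `&` f @^-1` A : set (borel T))) ->
  measurable_fun D (f : borel T -> measurableTypeR R).
Proof.
move=> h; refine (@measurability _ _ (borel T) (measurableTypeR R) D f _ (RGenOpens.measurableE R) _).
by move=> _ [A [a [b ->]] <-]; apply: h; exact: interval_open.
Qed.

Lemma measurable_coord n (i : 'I_n) (A : set R) : measurable A ->
  measurable ([set x | A (x ord0 i)] : set (borel 'rV[R]_n)).
Proof.
move=> mA.
have : measurable_fun setT ((fun x : 'rV[R]_n => x ord0 i) : borel 'rV[R]_n -> measurableTypeR R).
  apply: measurable_borel_real_fun => B oB; rewrite setTI.
  apply: measurable_borel_open; apply: open_comp => // x _.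
  exact: coord_continuous.
by move=> /(_ measurableT A mA); rewrite setTI.
Qed.

Definition box n (A : 'I_n -> set R) : set (borel 'rV[R]_n) :=
  [set x | forall i, A i (x ord0 i)].

Lemma measurable_box n (A : 'I_n -> set R) :
  (forall i, measurable (A i)) -> measurable (box A).
Proof.
move=> mA.
rewrite (_ : box A = \bigcap_(i in [set: 'I_n]) [set x | A i (x ord0 i)]).
  by apply: fin_bigcap_measurable => // i _; exact: measurable_coord.
by apply/seteqP; split => [x h i _|x h i]; exact: h.
Qed.

Lemma lebesgue_rV_box n (A : 'I_n -> set R) (d : R) :
  (forall i, measurable (A i)) -> (forall i, lebesgue_measure (A i) = d%:E) ->
  lebesgue_rV R n (box A) = (d ^+ n)%:E.
Proof.
elim: n A => [|n IH] A mA dA.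
  rewrite /lebesgue_rV/= expr0 indicE mem_set//.
  by case.
have boxE (t : R) : [set v : 'rV[R]_n | box A (row_mx (t%:M : 'rV[R]_1) v)] =
    if t \in A ord0 then box (fun i => A (rshift 1 i)) else set0.
  have eq0 : (ord0 : 'I_n.+1) = lshift n (ord0 : 'I_1) by exact: val_inj.
  case: ifPn => [/set_mem At|/negP At].
    apply/seteqP; split => v /= h i.
      by have := h (rshift 1 i); rewrite (row_mxEr (t%:M : 'rV_1)).
    case: (@split_ordP 1 n i) => l ->.
      by rewrite (ord1 l) (row_mxEl (t%:M : 'rV_1)) mxE eqxx -eq0.
    by rewrite (row_mxEr (t%:M : 'rV_1)).
  apply/seteqP; split => // v /= h; apply: At; apply/mem_set.
  by have := h ord0; rewrite eq0 (row_mxEl (t%:M : 'rV_1)) mxE eqxx.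
rewrite lebesgue_rVS.
under eq_integral do rewrite boxE.
have d0 : 0 <= d by rewrite -lee_fin -(dA ord0).
transitivity (\int[lebesgue_measure]_t ((d ^+ n)%:E * (\1_(A ord0) t)%:E))%E.
  apply: eq_integral => t _; rewrite indicE; case: ifPn => tA; last by rewrite mule0 measure0.
  by rewrite mule1 IH.
rewrite ge0_integralZl//.
- rewrite integral_indic; [|exact: measurableT|exact: mA].
  by rewrite (_ : A ord0 `&` _ = A ord0) ?setIT// [X in (_ * X)%E]dA exprSr EFinM.
- apply/(@measurable_EFinP _ (measurableTypeR R)); apply: measurable_indic; exact: mA.
- by rewrite lee_fin exprn_ge0.
Qed.

(** A set of diameter [d] lies in a cube of side [2 d] centred at any of its points.
The factor 2 is not optimal. *)
Lemma lebesgue_rV_small n (A : set (borel 'rV[R]_n)) (d : R) : measurable A ->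
  0 < d -> (forall x y : 'rV[R]_n, A x -> A y -> `|x - y| <= d) ->
  (lebesgue_rV R n A <= ((2 * d) ^+ n)%:E)%E.
Proof.
move=> mA d0 dA; have [->|/set0P[x Ax]] := eqVneq A set0.
  by rewrite measure0 lee_fin exprn_ge0// mulr_ge0// ltW.
rewrite -(@lebesgue_rV_box n (fun i => `[x ord0 i - d, x ord0 i + d]%classic)).
- apply: le_measure; rewrite ?inE//; first exact: measurable_box.
  move=> y Ay i /=; have : `|(x - y) ord0 i| <= d.
    by apply: le_trans (dA _ _ Ax Ay); exact: coord_le_norm.
  by rewrite !mxE in_itv/= ler_norml => /andP[h1 h2]; apply/andP; split; lra.
- by move=> i; exact: measurable_itv.
- move=> i; rewrite lebesgue_measure_itv/= lte_fin.
  by rewrite ifT; [rewrite -EFinB; congr EFin; ring|lra].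
Qed.

End boxes.

(** * Maps that do not contract distances *)

Section co_lipschitz.
Context {R : realType} {n : nat}.
Local Notation E := (borel 'rV[R]_n).
Local Notation m := (lebesgue_rV R n).

(** The half-open cube of side [2^-j] with lower corner [2^-j a].  The integer part
makes the cubes of one generation a partition, indexed by integer vectors. *)
Definition dyadic_cube (j : nat) (a : 'rV[int]_n) : set E :=
  box (fun i => [set t : R | Num.floor (2 ^+ j * t) = a ord0 i]).

Lemma dyadic_itvE j (a : int) :
  [set t : R | Num.floor (2 ^+ j * t) = a] =
  `[a%:~R / 2 ^+ j, (a + 1)%:~R / 2 ^+ j[%classic.
Proof.
have p0 : 0 < 2 ^+ j :> R by rewrite exprn_gt0.
apply/seteqP; split => t /=; rewrite in_itv/= ler_pdivrMr// ltr_pdivlMr//.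
  by move=> <-; rewrite ![t * _]mulrC floor_itv.
by rewrite ![t * _]mulrC => h; exact: floor_def.
Qed.

Lemma measurable_dyadic_cube j a : measurable (dyadic_cube j a).
Proof.
by apply: measurable_box => i; rewrite dyadic_itvE; exact: measurable_itv.
Qed.

Lemma lebesgue_dyadic_cube j a : m (dyadic_cube j a) = ((2 ^- j) ^+ n)%:E.
Proof.
apply: lebesgue_rV_box => i; rewrite dyadic_itvE; first exact: measurable_itv.
rewrite lebesgue_measure_itv/= lte_fin ltr_pM2r ?invr_gt0 ?exprn_gt0// ltr_int.
rewrite ltzD1 lexx -EFinB -mulrBl.
by rewrite -rmorphB/= addrC addKr mul1r.
Qed.

Lemma dyadic_cube_diam j a (x y : 'rV[R]_n) :
  dyadic_cube j a x -> dyadic_cube j a y -> `|x - y| <= 2 ^- j.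
Proof.
move=> hx hy; apply: norm_le_coord => [|i k].
  by rewrite invr_ge0 exprn_ge0.
rewrite (ord1 i) !mxE.
have p0 : 0 < 2 ^+ j :> R by rewrite exprn_gt0.
rewrite -(ler_pM2l p0) divff ?gt_eqF// -[X in X * _](gtr0_norm p0) -normrM mulrBr.
have /andP[h1 h2] := floor_itv (2 ^+ j * x ord0 k).
have /andP[h3 h4] := floor_itv (2 ^+ j * y ord0 k).
have := hx k => /= hxk; have := hy k => /= hyk.
rewrite hxk intrD in h1 h2; rewrite hyk intrD in h3 h4.
rewrite ler_norml; apply/andP; split; lra.
Qed.

Lemma dyadic_refine j (s t : R) :
  Num.floor (2 ^+ j.+1 * s) = Num.floor (2 ^+ j.+1 * t) ->
  Num.floor (2 ^+ j * s) = Num.floor (2 ^+ j * t).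
Proof.
rewrite exprS -!mulrA; move: (2 ^+ j * s) (2 ^+ j * t) => u v uv.
have F (w : R) : (2 * Num.floor w <= Num.floor (2 * w) <= 2 * Num.floor w + 1)%R.
  have /andP[h1 h2] := floor_itv w.
  rewrite floor_ge_int intrM; apply/andP; split; first lra.
  rewrite -ltzD1 -addrA floor_lt_int intrD intrM; rewrite intrD in h2; lra.
have /andP[h1 h2] := F u; have /andP[h3 h4] := F v; rewrite uv in h1 h2.
lia.
Qed.

(** Cubes of generation [j] have diameter at most [2^-j]. *)
Lemma dyadic_exhaust (U : set 'rV[R]_n) (x : 'rV[R]_n) : open U -> U x ->
  exists j, forall y : 'rV[R]_n, (forall i, Num.floor (2 ^+ j * y ord0 i) = Num.floor (2 ^+ j * x ord0 i)) -> U y.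
Proof.
move=> oU Ux.
have /nbhs_ballP[d /= d0 dU] : nbhs x U by exact: open_nbhs_nbhs.
pose j := (Num.trunc d^-1).+1; exists j => y yx; apply: dU.
rewrite mx_norm_ball /ball_/=.
apply: (@le_lt_trans _ _ (2 ^- j)).
  by apply: (@dyadic_cube_diam j (\row_i Num.floor (2 ^+ j * x ord0 i))) => i /=; rewrite mxE.
rewrite invf_plt ?posrE ?exprn_gt0//.
apply: lt_trans (truncnS_gt _) _; rewrite -/j -natrX ltr_nat; exact: ltn_expl.
Qed.

Variables (V : set 'rV[R]_n) (f : 'rV[R]_n -> 'rV[R]_n) (c : R).
Hypothesis V_open : open V.
Hypothesis f_cont : forall x, V x -> {for x, continuous f}.
Hypothesis c_gt0 : 0 < c.
Hypothesis f_colip : forall x y, V x -> V y -> `|x - y| <= c * `|f x - f y|.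

Lemma measurable_preimage_within (Q : set E) : measurable Q ->
  measurable (V `&` f @^-1` Q : set E).
Proof.
move=> mQ.
have mV : measurable (V : set E) by exact: measurable_borel_open.
have mf : measurable_fun (V : set E) (f : E -> E).
  apply: measurable_borel_fun => A oA; apply: measurable_borel_open.
  rewrite openE => x [Vx Afx]; apply: filterI; first exact: open_nbhs_nbhs.
  by apply: f_cont => //; exact: open_nbhs_nbhs.
exact: mf.
Qed.

Let m_cube j a : (m (V `&` f @^-1` dyadic_cube j a) <=
                  ((2 * c) ^+ n)%:E * m (dyadic_cube j a))%E.
Proof.
rewrite lebesgue_dyadic_cube -EFinM -exprMn -mulrA.
apply: lebesgue_rV_small.
- by apply: measurable_preimage_within; exact: measurable_dyadic_cube.
- by rewrite mulr_gt0// invr_gt0 exprn_gt0.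
- move=> x y [Vx fx] [Vy fy]; apply: le_trans (f_colip Vx Vy) _.
  by rewrite ler_pM2l//; exact: dyadic_cube_diam fx fy.
Qed.

Let m_open (U : set 'rV[R]_n) : open U ->
  (m (V `&` f @^-1` U) <= ((2 * c) ^+ n)%:E * m U)%E.
Proof.
move=> oU.
have mU : measurable (U : set E) by exact: measurable_borel_open.
pose good j a := dyadic_cube j a `<=` (U : set E).
pose F j k : set E := if @pickle_inv 'rV[int]_n k is Some a then
   (if `[< good j a >] then dyadic_cube j a else set0) else set0.
have mF j k : measurable (F j k).
  rewrite /F; case: pickle_inv => [a|//]; case: ifP => // _.
  exact: measurable_dyadic_cube.
have tF j : trivIset setT (F j).
  apply/trivIsetP => k l _ _ kl; apply/seteqP; split => // x [].
  rewrite /F; case Ek : (pickle_inv k) => [a|//]; case: ifP => // _ xa.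
  case El : (pickle_inv l) => [b|//]; case: ifP => // _ xb.
  have ab : a = b by apply/rowP => i; rewrite -(xa i) -(xb i).
  have := @pickle_invK 'rV[int]_n k; have := @pickle_invK 'rV[int]_n l.
  by rewrite Ek El /= ab => -> kl'; rewrite kl' eqxx in kl.
pose U_ j := \bigcup_k F j k.
have U_P j (x : 'rV[R]_n) : U_ j x <->
    forall y : 'rV[R]_n,
     (forall i, Num.floor (2 ^+ j * y ord0 i) = Num.floor (2 ^+ j * x ord0 i)) -> U y.
  split.
    move=> [k _]; rewrite /F; case: pickle_inv => // a; case: asboolP => // ga xa y yx.
    by apply: ga => i /=; rewrite yx; exact: xa.
  move=> h; exists (pickle (\row_i Num.floor (2 ^+ j * x ord0 i))) => //.
  rewrite /F pickleK_inv; case: asboolP => [_ i /=|]; first by rewrite mxE.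
  by case => y hy; apply: h => i; rewrite (hy i) mxE.
have mU_ j : measurable (U_ j) by exact: bigcupT_measurable.
have ndU : nondecreasing_seq U_.
  apply/nondecreasing_seqP => j; apply/subsetPset => x /U_P h; apply/U_P => y yx.
  by apply: h => i; apply: dyadic_refine.
have UU : \bigcup_j U_ j = U.
  apply/seteqP; split => [x [j _ /U_P]|x Ux]; first exact.
  by have [j hj] := dyadic_exhaust oU Ux; exists j => //; apply/U_P.
have le_j j : (m (V `&` f @^-1` U_ j) <= ((2 * c) ^+ n)%:E * m U)%E.
  apply: (@le_trans _ _ (\sum_(k <oo) m (V `&` f @^-1` F j k))%E).
    apply: measure_sigma_subadditive.
    - by move=> k; exact: measurable_preimage_within.
    - exact: measurable_preimage_within.
    - by move=> x [Vx [k _ Fx]]; exists k.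
  apply: (@le_trans _ _ (\sum_(k <oo) ((2 * c) ^+ n)%:E * m (F j k))%E).
    apply: lee_nneseries => [k _ _|k _]; first exact: measure_ge0.
    rewrite /F; case: pickle_inv => [a|]; last by rewrite preimage_set0 setI0 measure0 mule0.
    case: ifP => _; first exact: m_cube.
    by rewrite preimage_set0 setI0 measure0 mule0.
  rewrite nneseriesZl; last by move=> k _; exact: measure_ge0.
  apply: lee_pmul => //.
  - by rewrite lee_fin exprn_ge0// mulr_ge0// ltW.
  - by apply: nneseries_ge0 => k _ _; exact: measure_ge0.
  - rewrite -measure_semi_bigcup//; last exact: bigcupT_measurable.
    apply: le_measure; rewrite ?inE//; first exact: bigcupT_measurable.
    by rewrite -UU => x h; exists j.
have cv := @nondecreasing_cvg_mu _ _ _ m (fun j => V `&` f @^-1` U_ j).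
have {}cv : (m \o (fun j => V `&` f @^-1` U_ j)) @ \oo --> m (V `&` f @^-1` U).
  rewrite -UU preimage_bigcup setI_bigcupr; apply: cv.
  - by move=> j; exact: measurable_preimage_within.
  - by apply: bigcupT_measurable => j; exact: measurable_preimage_within.
  - move=> i j ij; apply/subsetPset; apply: setIS; apply: preimage_subset; apply/subsetPset; exact: ndU.
rewrite -(cvg_lim _ cv)//; apply: lime_le; first by apply/cvg_ex; eexists; exact: cv.
by near=> j; exact: le_j.
Unshelve. all: by end_near. Qed.

(** The preimage of a cube of side [d] has diameter at most [c d], hence measure at
most [(2 c d)^n].  An open set is an increasing union of disjoint unions of cubes
of one generation, and a Borel set is approximated from outside by open sets;
both limits preserve the inequality.  The balls [B N] serve to apply outer
regularity to finite measures. *)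
Lemma lebesgue_co_lipschitz (Q : set E) : measurable Q ->
  (m (V `&` f @^-1` Q) <= ((2 * c) ^+ n)%:E * m Q)%E.
Proof.
move=> mQ.
pose B N : set E := ball (0 : 'rV[R]_n) N.+1%:R.
have oB N : open (B N : set 'rV[R]_n) by exact: ball_open.
have mB N : measurable (B N) by exact: measurable_borel_open.
have K0 : 0 < (2 * c) ^+ n by rewrite exprn_gt0// mulr_gt0.
have le_N N : (m (V `&` f @^-1` (Q `&` B N)) <= ((2 * c) ^+ n)%:E * m Q)%E.
  apply/lee_addgt0Pr => e e0.
  pose d := e / (2 * c) ^+ n.
  have d0 : 0 < d by rewrite divr_gt0.
  have nufin : (mrestr m (mB N) setT < +oo)%E.
    by rewrite /mrestr setTI; exact: lebesgue_rV_ball_fin.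
  have [U [oU QU hU]] := borel_rV_outer_regular nufin mQ d0.
  rewrite /mrestr in hU.
  apply: (@le_trans _ _ (m (V `&` f @^-1` (U `&` B N)))).
    apply: le_measure; rewrite ?inE.
    - by apply: measurable_preimage_within; exact: measurableI.
    - apply: measurable_preimage_within; apply: measurable_borel_open; exact: openI.
    - by move=> x [Vx [Qx Bx]]; split => //; split => //; exact: QU.
  apply: le_trans (m_open (openI oU (oB N))) _.
  apply: (@le_trans _ _ (((2 * c) ^+ n)%:E * (m (Q `&` B N) + d%:E))%E).
    by rewrite lee_pmul2l.
  rewrite ge0_muleDr ?measure_ge0 ?lee_fin ?(ltW d0)//.
  rewrite -EFinM /d mulrCA divff ?gt_eqF// mulr1 leeD2r// lee_pmul2l//.
  by apply: le_measure; rewrite ?inE//; exact: measurableI.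
have QB : Q = \bigcup_N (Q `&` B N).
  rewrite -setI_bigcupr (_ : \bigcup_N B N = setT) ?setIT//.
  apply/seteqP; split => // x _; exists (Num.trunc `|x|) => //.
  rewrite /B mx_norm_ball /ball_ /= sub0r normrN; exact: truncnS_gt.
have cv := @nondecreasing_cvg_mu _ _ _ m (fun N => V `&` f @^-1` (Q `&` B N)).
have {}cv : (m \o (fun N => V `&` f @^-1` (Q `&` B N))) @ \oo --> m (V `&` f @^-1` Q).
  rewrite {2}QB preimage_bigcup setI_bigcupr; apply: cv.
  - by move=> j; apply: measurable_preimage_within; exact: measurableI.
  - by apply: bigcupT_measurable => j; apply: measurable_preimage_within; exact: measurableI.
  - move=> i j ij; apply/subsetPset; apply: setIS => x [Qx Bx]; split => //.
    by apply: le_ball Bx; rewrite ler_nat ltnS.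
rewrite -(cvg_lim _ cv)//; apply: lime_le; first by apply/cvg_ex; eexists; exact: cv.
by near=> j; exact: le_N.
Unshelve. all: by end_near. Qed.

End co_lipschitz.

(** * Linear changes of variables *)

Section affine_line.
Context {R : realType}.
Variables (a c : R).
Hypothesis a_neq0 : a != 0.

Let phi (t : measurableTypeR R) : measurableTypeR R := t * a + c.

Let mphi : measurable_fun setT phi.
Proof.
apply: measurable_funD => //; apply: measurable_funM => //.
Qed.

(** The measure [`|a| * lebesgue_measure (phi @^-1` _)] agrees with Lebesgue measure on
half-open intervals. *)
Lemma lebesgue_measure_affine (A : set (measurableTypeR R)) : measurable A ->
  lebesgue_measure (phi @^-1` A) = (`|a|^-1%:E * lebesgue_measure A)%E.
Proof.
move=> mA.
pose nu : {measure set (measurableTypeR R) -> \bar R} := mscale (NngNum (normr_ge0 a))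
  (measure_function_pushforward__canonical__measure_function_Measure
     (lebesgue_measure : {measure set (measurableTypeR R) -> \bar R}) mphi).
have h X : ocitv X -> lebesgue_measure X = nu X.
  move=> [[x y] _ <-].
  transitivity (`|a|%:E * lebesgue_measure (phi @^-1` `]x, y]%classic))%E; last by [].
  have [a0|a0] := ltP 0 a.
    rewrite (_ : _ @^-1` _ = `](x - c) / a, (y - c) / a]%classic); last first.
      apply/seteqP; split => t /=; rewrite !in_itv/= /phi;
      by rewrite ltr_pdivrMr// ler_pdivlMr// ltrBlDr lerBrDr.
    rewrite !lebesgue_measure_itv/= !lte_fin ltr_pM2r ?invr_gt0// ltrD2r.
    case: ifP => _; last by rewrite mule0.
    by rewrite -!EFinB -EFinM gtr0_norm//; congr EFin; field.
  have {}a0 : a < 0 by rewrite lt_neqAle a_neq0.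
  rewrite (_ : _ @^-1` _ = `[(y - c) / a, (x - c) / a[%classic); last first.
    apply/seteqP; split => t /=; rewrite !in_itv/= /phi;
    by rewrite ltr_ndivlMr// ler_ndivrMr// ltrBlDr lerBrDr andbC.
  rewrite !lebesgue_measure_itv/= !lte_fin ltr_nM2r ?invr_lt0// ltrD2r.
  case: ifP => _; last by rewrite mule0.
  by rewrite -!EFinB -EFinM ltr0_norm//; congr EFin; field.
have -> := lebesgue_measure_unique h mA.
transitivity (`|a|^-1%:E * (`|a|%:E * lebesgue_measure (phi @^-1` A)))%E; last by [].
by rewrite muleA -EFinM mulVf ?mul1e// normr_eq0.
Qed.

Lemma ge0_integral_affine (g : R -> \bar R) :
  measurable_fun setT (g : measurableTypeR R -> _) -> (forall t, 0 <= g t)%E ->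
  (\int[lebesgue_measure]_t g (t * a + c)%R =
   `|a|^-1%:E * \int[lebesgue_measure]_t g t)%E.
Proof.
move=> mg g0.
have := ge0_integral_pushforward mphi lebesgue_measure measurableT mg (fun y _ => g0 y).
rewrite preimage_setT => <-.
have a0 : 0 <= `|a|^-1 by rewrite invr_ge0.
rewrite (eq_measure_integral (mscale (NngNum a0) lebesgue_measure)); last first.
  by move=> A mA _; exact: lebesgue_measure_affine.
by rewrite ge0_integral_mscale.
Qed.

End affine_line.

Section linear_maps.
Context {R : realType}.
Local Notation m n := (lebesgue_rV R n).

Lemma measurable_section p (Q : set (borel 'rV[R]_p.+1)) (t : R) : measurable Q ->
  measurable ([set v | Q (row_mx (t%:M : 'rV[R]_1) v)] : set (borel 'rV[R]_p)).
Proof.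
move=> mQ; have := measurable_xsection (t : measurableTypeR R)
  (measurable_row_mx measurableT mQ).
by congr measurable; apply/seteqP; split => v; rewrite /xsection/= inE; first case.
Qed.

Lemma measurable_fun_section p (Q : set (borel 'rV[R]_p.+1)) : measurable Q ->
  measurable_fun setT ((fun t => m p [set v | Q (row_mx (t%:M : 'rV[R]_1) v)]) :
    measurableTypeR R -> _).
Proof.
move=> mQ; have := measurable_fun_xsection (m p) (measurable_row_mx measurableT mQ).
congr measurable_fun; apply/funext => t /=; congr (m p _).
by apply/seteqP; split => v; rewrite /xsection/= inE; first case.
Qed.

(** Cavalieri's principle: for an upper triangular matrix, the section of the preimage
at a first coordinate [t] is the preimage of a section under a triangular map in one
dimension less, translated by a vector that depends on [t].  This is why the
statement has the translation [c]. *)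
Lemma lebesgue_rV_triangular n (T : 'M[R]_n) (c : 'rV[R]_n) (Q : set (borel 'rV[R]_n)) :
  (forall i j : 'I_n, (j < i)%N -> T i j = 0) -> T \in unitmx -> measurable Q ->
  m n [set x | Q (x *m T + c)] = ((`|\det T|^-1)%:E * m n Q)%E.
Proof.
elim: n T c Q => [|n IH] T c Q trT uT mQ.
  rewrite det_mx00 normr1 invr1 mul1e; congr (m 0%N _).
  by apply/seteqP; split => x /=; rewrite (thinmx0 x) (thinmx0 (_ + _)).
pose a := T ord0 ord0; pose b := ursubmx (T : 'M[R]_(1 + n)).
pose D := drsubmx (T : 'M[R]_(1 + n)).
pose c0 := c ord0 ord0; pose c' := rsubmx (c : 'rV[R]_(1 + n)).
have TE : T = block_mx (a%:M : 'M[R]_1) b 0 D :> 'M[R]_(1 + n).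
  transitivity (block_mx (@ulsubmx R 1 n 1 n T) (@ursubmx R 1 n 1 n T)
    (@dlsubmx R 1 n 1 n T) (@drsubmx R 1 n 1 n T)); first by rewrite submxK.
  congr (block_mx _ _ _ _).
    apply/matrixP => i j; rewrite (ord1 i) (ord1 j) !mxE eqxx mulr1n.
    by congr (T _ _); exact: val_inj.
  by apply/matrixP => i j; rewrite !mxE trT// (ord1 j).
have cE : c = row_mx (c0%:M : 'rV[R]_1) c' :> 'rV[R]_(1 + n).
  transitivity (row_mx (@lsubmx R 1 1 n c) (@rsubmx R 1 1 n c)).
    by rewrite hsubmxK.
  congr row_mx.
  apply/matrixP => i j; rewrite (ord1 i) (ord1 j) !mxE eqxx mulr1n.
  by congr (c _ _); exact: val_inj.
have detT : \det T = a * \det D by rewrite TE (@det_ublock _ 1 n) det_scalar1.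
have : \det T != 0 by rewrite -unitfE -unitmxE.
rewrite detT mulf_eq0 negb_or => /andP[a0 D0].
have uD : D \in unitmx by rewrite unitmxE unitfE.
have trD (i j : 'I_n) : (j < i)%N -> D i j = 0 by move=> ji; rewrite !mxE trT.
have key' (t : R) v : row_mx (t%:M : 'rV[R]_1) v *m block_mx (a%:M : 'M[R]_1) b 0 D +
      row_mx (c0%:M : 'rV[R]_1) c' =
    row_mx ((t * a + c0)%:M : 'rV[R]_1) (v *m D + (t *: b + c')) :> 'rV[R]_(1 + n).
  rewrite (@mul_row_block _ 1 1 n 1 n) mulmx0 addr0 add_row_mx.
  by rewrite -scalar_mxM -raddfD/= mul_scalar_mx [_ + v *m D]addrC addrA.
have key (t : R) v : row_mx (t%:M : 'rV[R]_1) v *m T + c =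
    row_mx ((t * a + c0)%:M : 'rV[R]_1) (v *m D + (t *: b + c')) :> 'rV[R]_(1 + n).
  by rewrite -key' {1}TE {1}cE.
rewrite !lebesgue_rVS.
pose h (s : R) := m n [set v : 'rV[R]_n | Q (row_mx (s%:M : 'rV[R]_1) v)].
transitivity (\int[lebesgue_measure]_t ((`|\det D|^-1)%:E * h (t * a + c0)%R))%E.
  apply: eq_integral => t _; rewrite /h -(IH D (t *: b + c'))//; last exact: measurable_section.
  by congr (m n _); apply/seteqP; split => v /=; rewrite key.
have mh : measurable_fun setT (fun t : measurableTypeR R => h (t * a + c0)).
  apply: (measurableT_comp (measurable_fun_section mQ)).
  by apply: measurable_funD => //; exact: measurable_funM.
rewrite ge0_integralZl ?lee_fin ?invr_ge0//.
rewrite ge0_integral_affine//; last exact: measurable_fun_section.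
by rewrite muleA -EFinM -invfM -normrM mulrC.
Qed.

Lemma measurable_mulmxr_preimage n (A : 'M[R]_n) (Q : set (borel 'rV[R]_n)) :
  measurable Q -> measurable ([set x | Q (x *m A)] : set (borel 'rV[R]_n)).
Proof.
move=> mQ.
have := @measurable_preimage_within R n setT (fun x => x *m A) openT
  (fun x _ => @continuous_mulmxr R n n A x) Q mQ.
by rewrite setTI.
Qed.

(** Permutation matrices are isometries for the sup norm.  They preserve the measure,
but the cheap bound with a factor [2^n] is sufficient. *)
Lemma lebesgue_rV_perm n (s : 'S_n) (Q : set (borel 'rV[R]_n)) : measurable Q ->
  (m n [set x | Q (x *m perm_mx s)] <= (2 ^+ n)%:E * m n Q)%E.
Proof.
move=> mQ.
have colip (x y : 'rV[R]_n) : setT x -> setT y ->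
    `|x - y| <= 1 * `|x *m perm_mx s - y *m perm_mx s|.
  move=> _ _; rewrite mul1r -mulmxBl.
  apply: norm_le_coord => // i j.
  apply: le_trans (coord_le_norm _ i (s j)).
  have -> : perm_mx s = perm_mx ((s^-1)^-1)%g :> 'M[R]_n by rewrite invgK.
  by rewrite -col_permE [col_perm _ _ _ _]mxE permK.
have := lebesgue_co_lipschitz (@openT _) (fun x _ => @continuous_mulmxr R n n (perm_mx s) x)
  ltr01 colip mQ.
by rewrite setTI mulr1.
Qed.

(** Write [A] as a product of a permutation, a lower triangular matrix of determinant
1 and an upper triangular matrix.  Conjugation by the permutation that reverses
the order of the coordinates makes the lower triangular factor upper triangular.
In total three permutations occur, whence the exponent 3. *)
Lemma lebesgue_rV_linear n (A : 'M[R]_n) (Q : set (borel 'rV[R]_n)) :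
  A \in unitmx -> measurable Q ->
  (m n [set x | Q (x *m A)] <= ((2 ^+ n) ^+ 3)%:E * ((`|\det A|^-1)%:E * m n Q))%E.
Proof.
case: n A Q => [|n] A Q uA mQ.
  rewrite !expr0 expr1n mul1e det_mx00 normr1 invr1 mul1e.
  suff -> : [set x | Q (x *m A)] = Q by [].
  by apply/seteqP; split => x /=; rewrite (thinmx0 x) (thinmx0 (_ *m _)).
have := cormen_lup_correct A; have := cormen_lup_perm A; have := cormen_lup_detL A.
have := @cormen_lup_lower _ _ A; have := @cormen_lup_upper _ _ A.
case: (cormen_lup A) => [[P L] U] triU triL detL /is_perm_mxP[s Ps] PA.
rewrite /= in triU triL detL Ps PA; rewrite {P}Ps in PA.
pose r : 'S_n.+1 := perm (@rev_ord_inj n.+1).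
pose J : 'M[R]_n.+1 := perm_mx r.
have rK : (r * r = 1)%g by apply/permP => i; rewrite permM !permE rev_ordK.
have JJ : J *m J = 1%:M by rewrite -perm_mxM rK perm_mx1.
pose L' := J *m L *m J.
have L'E i j : L' i j = L (rev_ord i) (rev_ord j).
  have rV : (r^-1 = r)%g by rewrite -[LHS]mulg1 -rK mulgA mulVg mul1g.
  have -> : L' = col_perm r (row_perm r L) by rewrite col_permE row_permE rV.
  by rewrite !mxE !permE.
have LE : L = J *m L' *m J.
  by rewrite /L' !mulmxA JJ mul1mx -mulmxA JJ mulmx1.
have AE : A = perm_mx s^-1 *m L *m U.
  rewrite -mulmxA; have -> : L *m U = perm_mx s *m A by rewrite -mulmxE in PA; exact: esym PA.
  by rewrite mulmxA -perm_mxM mulVg perm_mx1 mul1mx.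
have detL' : \det L' = 1.
  by rewrite /L' !det_mulmx mulrAC -det_mulmx JJ det1 mul1r detL.
have detA : `|\det A| = `|\det U|.
  rewrite AE !det_mulmx detL mulr1 normrM det_perm normrX normrN1 expr1n.
  by rewrite mul1r.
have uU : U \in unitmx.
  by move: uA; rewrite !unitmxE !unitfE -normr_eq0 detA normr_eq0.
have uL' : L' \in unitmx by rewrite unitmxE detL' unitr1.
have trL' (i j : 'I_n.+1) : (j < i)%N -> L' i j = 0.
  move=> ji; rewrite L'E triL/=; last by rewrite leq_sub2l// ltnW.
  by rewrite (inj_eq rev_ord_inj) -(inj_eq val_inj) gtn_eqF.
have K0 : (0 <= (2 ^+ n.+1 : R)%:E)%E by rewrite lee_fin exprn_ge0.
pose Q1 := [set x : 'rV[R]_n.+1 | Q (x *m U)].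
have mQ1 : measurable (Q1 : set (borel _)) by exact: measurable_mulmxr_preimage.
pose Q2 := [set x : 'rV[R]_n.+1 | Q1 (x *m J)].
have mQ2 : measurable (Q2 : set (borel _)) by exact: measurable_mulmxr_preimage.
pose Q3 := [set x : 'rV[R]_n.+1 | Q2 (x *m L')].
have mQ3 : measurable (Q3 : set (borel _)) by exact: measurable_mulmxr_preimage.
pose Q4 := [set x : 'rV[R]_n.+1 | Q3 (x *m J)].
have mQ4 : measurable (Q4 : set (borel _)) by exact: measurable_mulmxr_preimage.
apply: (@le_trans _ _ (lebesgue_rV R n.+1 [set x | Q4 (x *m perm_mx s^-1)])).
  rewrite le_eqVlt; apply/orP; left; apply/eqP.
  apply: (congr1 (lebesgue_rV R n.+1)).
  by apply/funext => x; rewrite /Q4 /Q3 /Q2 /Q1 /= AE LE !mulmxA.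
have triE (B : 'M[R]_n.+1) (S : set (borel 'rV[R]_n.+1)) : (forall i j : 'I_n.+1, (j < i)%N -> B i j = 0) ->
    B \in unitmx -> measurable S ->
    m n.+1 [set x | S (x *m B)] = ((`|\det B|^-1)%:E * m n.+1 S)%E.
  move=> trB uB mS; rewrite -(@lebesgue_rV_triangular _ B 0)//.
  apply: (congr1 (lebesgue_rV R n.+1)).
  by apply/funext => x; rewrite /= addr0.
apply: le_trans (lebesgue_rV_perm _ mQ4) _.
have K3 (a : R) : a ^+ 3 = a * (a * a) by rewrite exprS expr2.
rewrite K3 2!EFinM -!muleA.
apply: lee_wpmul2l => //.
apply: le_trans (lebesgue_rV_perm _ mQ3) _.
apply: lee_wpmul2l => //.
rewrite triE// detL' normr1 invr1 mul1e.
apply: le_trans (lebesgue_rV_perm _ mQ1) _.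
apply: lee_wpmul2l => //.
by rewrite triE// detA.
Qed.

End linear_maps.

(** * Volume by coverings with patches *)

Section nat_pairs.
Context {R : realType}.
Local Open Scope ereal_scope.

Lemma nneseries_pair (f : {bij [set: nat] >-> [set: nat * nat]}) (v : nat -> nat -> \bar R) :
  (forall i j, 0 <= v i j) ->
  \sum_(n <oo) v (f n).1 (f n).2 = \sum_(i <oo) \sum_(j <oo) v i j.
Proof.
move=> v0; transitivity (\esum_(i in [set: nat]) (fun p => v p.1 p.2) (f i)).
  by rewrite nneseries_esumT.
rewrite -(@reindex_esum R nat (nat * nat)%type setT setT f (fun p => v p.1 p.2)); last exact: bij.
transitivity (\esum_(i in [set: nat]) \esum_(j in [set: nat]) v i j).
  rewrite esum_esum; last by move=> i j _ _; exact: v0.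
  by congr esum; apply/seteqP; split => x.
rewrite nneseries_esumT; last by move=> i; apply: nneseries_ge0 => j _ _; exact: v0.
by apply: eq_esum => i _; rewrite nneseries_esumT.
Qed.

End nat_pairs.

(** The volume defined by coverings is an outer measure, for any family [P] of
patches. *)
Section patch_volume.
Context {R : realType} {m : nat} (M : rmanifold R m) (k : nat).
Variable P : set (set 'rV[R]_k * ('rV[R]_k -> M)).
Local Open Scope ereal_scope.

Let area (B : set (borel 'rV[R]_k)) (s : 'rV[R]_k -> M) : \bar R :=
  \int[lebesgue_rV R k]_(x in B) (vol_density s x)%:E.

Let area_ge0 B s : 0 <= area B s.
Proof. by apply: integral_ge0 => x _; rewrite lee_fin sqrtr_ge0. Qed.

Lemma patch_vol_le (A : set M) (B : nat -> set (borel 'rV[R]_k)) s :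
  (forall i, measurable (B i) /\ exists2 D, P (D, s i) & B i `<=` D) ->
  A `<=` \bigcup_i (s i @` B i) ->
  patch_vol P A <= \sum_(i <oo) \int[lebesgue_rV R k]_(x in B i) (vol_density (s i) x)%:E.
Proof. by move=> mB cov; apply: ereal_inf_lbound; exists B, s. Qed.

Lemma patch_vol_ge0 (A : set M) : 0 <= patch_vol P A.
Proof.
apply: le_ereal_inf_tmp => _ [B [s [_ _ ->]]].
by apply: nneseries_ge0 => i _ _; exact: area_ge0.
Qed.

Lemma patch_volS (A A' : set M) : A `<=` A' -> patch_vol P A <= patch_vol P A'.
Proof.
move=> AA; apply: ereal_inf_le_tmp => _ [B [s [mB cov ->]]].
by exists B, s; split => //; exact: subset_trans cov.
Qed.

Lemma patch_vol0 D s : P (D, s) -> patch_vol P set0 = 0.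
Proof.
move=> Ps; apply/eqP; rewrite eq_le patch_vol_ge0 andbT.
apply: le_trans (@patch_vol_le set0 (fun=> set0) (fun=> s) _ _) _ => //.
  by move=> i; split => //; exists D.
by rewrite eseries0// => i _ _; rewrite integral_set0.
Qed.

Lemma patch_vol_adherent (A : set M) (e : R) : patch_vol P A < +oo -> (0 < e)%R ->
  exists (B : nat -> set (borel 'rV[R]_k)) (s : nat -> 'rV[R]_k -> M),
  [/\ (forall i, measurable (B i) /\ exists2 D, P (D, s i) & B i `<=` D),
     A `<=` \bigcup_i (s i @` B i) &
     \sum_(i <oo) area (B i) (s i) <= patch_vol P A + e%:E].
Proof.
move=> Afin e0; have fin : patch_vol P A \is a fin_num.
  by rewrite ge0_fin_numE// patch_vol_ge0.
have [_ [B [s [mB cov ->]]] h] := lb_ereal_inf_adherent e0 fin.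
by exists B, s; split => //; exact: ltW.
Qed.

(** Near-optimal coverings of the sets [F i], with errors that sum up to [e], are
enumerated as one covering of their union. *)
Lemma patch_vol_bigcup (A : set M) (F : nat -> set M) : A `<=` \bigcup_i F i ->
  patch_vol P A <= \sum_(i <oo) patch_vol P (F i).
Proof.
move=> AF; have [[i ioo]|] := pselect (exists i, patch_vol P (F i) = +oo).
  rewrite (eseries_pinfty _ _ ioo) ?leey// => n _.
  by rewrite -ltNye (lt_le_trans _ (patch_vol_ge0 _)).
rewrite -forallNE => Foo.
have {}Foo i : patch_vol P (F i) < +oo by rewrite ltey; exact/eqP/Foo.
apply/lee_addgt0Pr => e e0.
have en i : (0 < e / (2 ^ i.+1)%:R)%R by rewrite divr_gt0// ltr0n expn_gt0.
have /choice[Bs hBs] i : exists Bs : (nat -> set (borel 'rV[R]_k)) * (nat -> 'rV[R]_k -> M),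
  [/\ (forall j, measurable (Bs.1 j) /\ exists2 D, P (D, Bs.2 j) & Bs.1 j `<=` D),
     F i `<=` \bigcup_j (Bs.2 j @` Bs.1 j) &
     \sum_(j <oo) area (Bs.1 j) (Bs.2 j) <= patch_vol P (F i) + (e / (2 ^ i.+1)%:R)%:E].
  by have [B [s h]] := patch_vol_adherent (Foo i) (en i); exists (B, s).
have /card_esym/ppcard_eqP[f] := card_nat2.
pose v i j := area ((Bs i).1 j) ((Bs i).2 j).
apply: (@le_trans _ _ (\sum_(n <oo) v (f n).1 (f n).2)).
  apply: (@patch_vol_le A (fun n => (Bs (f n).1).1 (f n).2) (fun n => (Bs (f n).1).2 (f n).2)).
    by move=> n; have [h _ _] := hBs (f n).1; exact: h.
  move=> x /AF[i _ Fx]; have [_ h _] := hBs i; have [j _ xj] := h _ Fx.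
  by exists (f^-1%FUN (i, j)) => //; rewrite invK ?inE.
rewrite nneseries_pair; last by move=> i j; exact: area_ge0.
refine (le_trans _ (epsilon_trick _ _ (ltW e0))); last by move=> i; exact: patch_vol_ge0.
apply: lee_nneseries => [i _ _|i _]; last by have [_ _] := hBs i.
by apply: nneseries_ge0 => j _ _; exact: area_ge0.
Qed.

End patch_volume.

(** * Growth of leaf volume *)

Section local_volume.
Context {R : realType} {n : nat}.
Local Notation E := (borel 'rV[R]_n).
Local Notation m := (lebesgue_rV R n).

(** The factor [(2 * 2)^n] is the one of [lebesgue_co_lipschitz] for a map that
contracts distances by at most a factor 2, and [(2^n)^3] the one of
[lebesgue_rV_linear]. *)
Definition distortion : R := (2 * 2) ^+ n * (2 ^+ n) ^+ 3.

Lemma distortion_gt0 : 0 < distortion.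
Proof. by rewrite mulr_gt0// ?exprn_gt0// mulr_gt0. Qed.

(** Write [h] as [h] followed by the inverse of [A], and then [A]: the first map is
almost an isometry near [w], and the second is linear. *)
Lemma local_volume (h : 'rV[R]_n -> 'rV[R]_n) w (A : 'M[R]_n) (V0 : set 'rV[R]_n) :
  sdiff h w A -> A \in unitmx -> open V0 -> V0 w ->
  (forall x, V0 x -> {for x, continuous h}) ->
  exists V : set 'rV[R]_n, [/\ open V, V w, V `<=` V0 & forall Q : set E, measurable Q ->
    (m (V `&` h @^-1` Q) <= (distortion / `|\det A|)%:E * m Q)%E].
Proof.
move=> hA uA oV0 V0w ch.
have [U wU colip] := sdiff_co_lipschitz hA uA.
exists (interior U `&` V0); split.
- by apply: openI => //; exact: open_interior.
- by [].
- by move=> x [].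
move=> Q mQ.
pose f y := h y *m invmx A.
have oV : open (interior U `&` V0) by apply: openI => //; exact: open_interior.
have cf x : (interior U `&` V0) x -> {for x, continuous f}.
  move=> [_ V0x]; apply: (@continuous_comp _ _ _ h (fun y => y *m invmx A)); first exact: ch.
  exact: continuous_mulmxr.
have co x y : (interior U `&` V0) x -> (interior U `&` V0) y ->
    `|x - y| <= 2 * `|f x - f y|.
  by move=> [/interior_subset Ux _] [/interior_subset Uy _]; exact: colip.
pose Q' : set E := [set x | Q (x *m A)].
have mQ' : measurable Q' by exact: measurable_mulmxr_preimage.
have -> : (interior U `&` V0) `&` h @^-1` Q = (interior U `&` V0) `&` f @^-1` Q'.
  by apply/seteqP; split => x [Vx]; rewrite /Q' /f /= mulmxKV.
apply: le_trans (lebesgue_co_lipschitz oV cf (ltr0n R 2) co mQ') _.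
apply: (@le_trans _ _ (((2 * 2) ^+ n)%:E *
    (((2 ^+ n) ^+ 3)%:E * ((`|\det A|^-1)%:E * m Q)))%E).
  apply: lee_wpmul2l; first by rewrite lee_fin exprn_ge0// mulr_ge0.
  exact: lebesgue_rV_linear.
by rewrite !muleA -!EFinM.
Qed.

Lemma integral_set0_le (f : E -> \bar R) c : (0 <= c -> \int[m]_(x in set0) f x <= c)%E.
Proof. by rewrite integral_set0. Qed.

Lemma EFin_integral_ge0 (f : E -> R) (Q : set E) : (forall x, 0 <= f x) ->
  (0 <= \int[m]_(x in Q) (f x)%:E)%E.
Proof. by move=> f0; apply: integral_ge0 => x _; rewrite lee_fin. Qed.

End local_volume.
Arguments distortion R n : clear implicits.

Section density_integral.
Context {R : realType} {m : nat} (M : rmanifold R m) (k : nat).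
Local Notation disc := (disc R k).
Local Notation E := (borel 'rV[R]_k).
Variables (s : 'rV[R]_k -> M).
Hypothesis s_C1 : Ck_param 1 disc s.

Lemma measurable_vol_density (Q : set E) : measurable Q -> Q `<=` disc ->
  measurable_fun Q (fun x : E => (vol_density s x)%:E).
Proof.
move=> mQ QD; have mD : measurable (disc : set E).
  by apply: measurable_borel_open; exact: disc_open.
have : measurable_fun (disc : set E) (vol_density s : E -> measurableTypeR R).
  apply: measurable_borel_real_fun => A oA; apply: measurable_borel_open.
  apply: open_within => //; first exact: disc_open.
  by move=> x Dx; exact: vol_density_continuous (disc_open (n := k)) s_C1 Dx.
move=> /(measurable_funS mD QD) h.
by apply/(@measurable_EFinP _ E R Q (vol_density s)).
Qed.

Lemma integral_vol_density_le (Q : set E) (c : R) : measurable Q -> Q `<=` disc -> 0 <= c ->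
  (forall x, Q x -> vol_density s x <= c) ->
  (\int[lebesgue_rV R k]_(x in Q) (vol_density s x)%:E <= c%:E * lebesgue_rV R k Q)%E.
Proof.
move=> mQ QD c0 h; rewrite -integral_cst//.
apply: ge0_le_integral => //.
- by move=> x _; rewrite lee_fin sqrtr_ge0.
- exact: measurable_vol_density.
Qed.

Lemma integral_vol_density_ge (Q : set E) (c : R) : measurable Q -> Q `<=` disc -> 0 <= c ->
  (forall x, Q x -> c <= vol_density s x) ->
  (c%:E * lebesgue_rV R k Q <= \int[lebesgue_rV R k]_(x in Q) (vol_density s x)%:E)%E.
Proof.
move=> mQ QD c0 h; rewrite -integral_cst//.
apply: ge0_le_integral => //.
- exact: measurable_vol_density.
Qed.

End density_integral.

Section volume_growth.
Context {R : realType} {m : nat} (M : rmanifold R m) (k : nat) (W : foliation M k 1).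
Local Notation L := (leaf W).
Local Notation P := (leaf_par W).
Local Notation disc := (disc R k).
Local Notation E := (borel 'rV[R]_k).
Local Notation leb := (lebesgue_rV R k).

Variable F : M -> M.
Hypothesis F_diffeo : local_diffeo 1 F.
Hypothesis F_inv : invariant_foliation W F.
Hypothesis F_inj : forall z, set_inj (L z) F.

Variables (n : nat) (z : M) (lam : R).
Hypothesis lam_gt0 : 0 < lam.
Local Notation G := (iter n F).

(** The factor 4 accounts for the oscillation, by a factor at most 2 each, of the
volume densities of the source and of the target patch. *)
Definition growth_const : R := 4 * distortion R k / lam.

Lemma growth_const_gt0 : 0 < growth_const.
Proof. by rewrite divr_gt0// mulr_gt0// distortion_gt0. Qed.

Lemma growth_const_ge0 : (0 <= growth_const%:E)%E.
Proof. by rewrite lee_fin; exact: ltW growth_const_gt0. Qed.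

(** The part of the leaf of [z] that is sent into the piece [s @` Q] of the image leaf is
covered by a patch of small volume. *)
Definition thin_preimage (s : 'rV[R]_k -> M) (Q : set E) := exists (t : 'rV[R]_k -> M) (B : set E),
  [/\ P z t, measurable B, B `<=` disc,
      (forall y, L z y -> (s @` Q) (G y) -> (t @` B) y) &
      (\int[leb]_(x in B) (vol_density t x)%:E <=
       growth_const%:E * \int[leb]_(x in Q) (vol_density s x)%:E)%E].

(** Let [t] be a patch around [y] and [h = s^-1 \o G \o t].  The hypothesis on the leafwise
determinant bounds [`|\det A|] from below, where [A] is the derivative of [h], in terms
of the two densities.  Injectivity of [G] on the leaf is what makes one patch
sufficient: all points of the leaf above [s @` Q] lie in [t @` V1] as soon as [s @` Q] is
contained in the image of [t @` V1]. *)
Lemma local_growth s x y : P (G z) s -> disc x -> L z y -> G y = s x ->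
  lam <= leaf_det W G y ->
  exists U : set 'rV[R]_k, [/\ open U, U x &
    forall Q : set E, measurable Q -> Q `<=` U -> thin_preimage s Q].
Proof.
move=> Ps Dx zy Gy lamy.
have sc := leaf_par_chart Ps.
have [t [w [Pt Dw tw]]] := leaf_par_ex zy.
have tc := leaf_par_chart Pt.
pose f := G \o t.
pose h := leaf_coord s f.
have oD := @disc_open R k.
have fw : s x = f w by rewrite /f /= tw Gy.
have lf u : disc u -> leafwise_at W (G z) f u by exact: leafwise_iter.
pose V0 := disc `&` f @^-1` (s @` disc).
have oV0 : open V0.
  have [_ _ _ _ [_ o2]] := tc.
  have := o2 _ (iter_leaf_open_preimage F_diffeo F_inv (leaf_chart_image_open sc)).
  congr open; apply/seteqP; split => u [Du] /=; first by case.
  by move=> h'; split => //; split => //; have [tL _ _ _ _] := tc; apply: tL; exists u.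
have V0w : V0 w by split => //; exists x.
have ch u : V0 u -> {for u, continuous h}.
  by move=> [Du [v Dv Ev]]; exact: (leaf_coord_continuous sc Dv Ev (lf _ Du)).
have [sfw rkw] := rank_iter F_diffeo n tc Dw.
have [A [hA dfA]] := leaf_coord_sdiff sc Dx fw (lf _ Dw) sfw.
have uA : A \in unitmx.
  rewrite -row_free_unit /row_free eqn_leq rank_leq_row/=.
  by rewrite -[leqLHS]rkw dfA mxrankM_maxl.
have detA : 0 < `|\det A| by rewrite normr_gt0 -unitfE -unitmxE.
have ts0 := vol_density_gt0 (leaf_chart_rank tc Dw).
have ss0 := vol_density_gt0 (leaf_chart_rank sc Dx).
have key : lam * vol_density t w <= `|\det A| * vol_density s x.
  have lamt : lam <= leaf_det W G (t w) by rewrite tw.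
  have detE := leaf_det_iterE F_diffeo n tc Dw.
  have volE : vol_density f w = `|\det A| * vol_density s x.
    by rewrite /vol_density dfA sqrt_det_congr fw.
  move: lamt; rewrite detE -/f volE.
  by move: ts0; move: (vol_density t w) => v v0; rewrite ler_pdivlMr.
have [V [oV Vw VV0 Vvol]] := local_volume hA uA oV0 V0w ch.
have [_ _ tC1 _ _] := tc; have [_ _ sC1 _ [ _ so2]] := sc.
pose V1 := V `&` (disc `&` vol_density t @^-1` [set r | r < 2 * vol_density t w]).
have oV1 : open V1.
  apply: openI => //; apply: (open_within oD _ (@open_lt R _)).
  by move=> u Du; exact: vol_density_continuous oD tC1 Du.
have twice (r : R) : 0 < r -> r < 2 * r by move=> r0; rewrite ltr_pMl// ltr1n.
have half (r : R) : 0 < r -> r / 2 < r by move=> r0; rewrite ltr_pdivrMr// ltr_pMr// ltr1n.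
have V1w : V1 w by split; [exact: Vw|split; [exact: Dw|exact: twice]].
have V1D : V1 `<=` disc by move=> u [_ []].
(* On [V1] and [U1] the densities of [t] and [s] vary by a factor at most 2. *)
pose U1 := disc `&` vol_density s @^-1` [set r | vol_density s x / 2 < r].
have oU1 : open U1.
  apply: (open_within oD _ (@open_gt R _)).
  by move=> u Du; exact: vol_density_continuous oD sC1 Du.
have [tL _ _ _ [to1 _]] := tc.
pose U := U1 `&` (disc `&` s @^-1` (G @` (t @` V1))).
exists U; split.
- apply: openI => //; apply: so2.
  apply: (iter_leaf_open_image F_diffeo F_inv); last exact: to1.
  by move=> _ [u V1u <-]; apply: tL; exists u => //; exact: V1D.
- split; first by split; [exact: Dx|exact: half].
  split; first exact: Dx.
  by exists (t w); [exists w|exact: esym fw].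
move=> Q mQ QU.
have QD : Q `<=` disc by move=> u /QU[[]].
pose B : set E := V1 `&` h @^-1` Q.
have mB : measurable B.
  by apply: measurable_preimage_within => // u [/VV0 Vu _]; exact: ch.
have BD : B `<=` disc by move=> u [/V1D].
exists t, B; split; [exact: Pt|exact: mB|exact: BD|..].
- move=> y' zy' [x' Qx' sx'].
  have [_ [_ /= [_ [v V1v <-] Gv]]] := QU _ Qx'.
  have tv : t v = y'.
    apply: (iter_leaf_inj F_diffeo F_inv (n := n) F_inj (z := z)); rewrite ?inE//.
      by apply: tL; exists v => //; exact: V1D.
    by rewrite -sx' Gv.
  have hv : h v = x' by apply: (leaf_coordE sc); [exact: QD|exact: esym Gv].
  exists v => //; split; first exact: V1v.
  by change (Q (h v)); rewrite hv.
have c2 : 0 <= 2 * vol_density t w := ltW (lt_trans ts0 (twice _ ts0)).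
have c1 : 0 <= vol_density s x / 2 := divr_ge0 (ltW ss0) (ler0n _ 2).
have i1 : (\int[leb]_(x in B) (vol_density t x)%:E <= (2 * vol_density t w)%:E * leb B)%E.
  apply: (integral_vol_density_le tC1 mB BD c2).
  by move=> u [[_ [_ h2]] _]; exact: ltW h2.
have i2 : (leb B <= (distortion R k / `|\det A|)%:E * leb Q)%E.
  apply: le_trans (Vvol Q mQ); apply: le_measure; rewrite ?inE//.
    by apply: measurable_preimage_within => // u /VV0 Vu; exact: ch.
  by move=> u [[Vu _] Qu].
have i3 : ((vol_density s x / 2)%:E * leb Q <= \int[leb]_(x in Q) (vol_density s x)%:E)%E.
  apply: (integral_vol_density_ge sC1 mQ QD c1).
  by move=> u /QU[[_ h2] _]; exact: ltW h2.
have d0 := @distortion_gt0 R k.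
apply: (le_trans i1).
move: key ts0 ss0 i3 c2 c1.
move: (vol_density t w) (vol_density s x) => vt vs key vt0 vs0 i3 c2 c1 {i1}.
apply: (@le_trans _ _ ((2 * vt)%:E * ((distortion R k / `|\det A|)%:E * leb Q))%E).
  by apply: lee_wpmul2l => //; rewrite lee_fin.
apply: (@le_trans _ _ (growth_const%:E * ((vs / 2)%:E * leb Q))%E); last first.
  by apply: lee_wpmul2l => //; exact: growth_const_ge0.
rewrite !muleA -!EFinM; apply: lee_wpmul2r => //; rewrite lee_fin /growth_const.
move: (distortion R k) d0 (`|\det A|) key detA => d d0 a key a0.
rewrite (_ : 4 * d / lam * (vs / 2) = (2 * d / lam) * vs); last by field; rewrite gt_eqF.
rewrite (_ : 2 * vt * (d / a) = (2 * d / lam) * (lam * vt / a)); last first.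
  by field; rewrite !gt_eqF.
by rewrite ler_pM2l ?divr_gt0 ?mulr_gt0// ler_pdivrMr// [vs * a]mulrC.
Qed.

Variable A : set M.
Hypothesis A_det : forall y, A y -> lam <= leaf_det W G y.

Local Notation leaf_patches y := [set p | p.1 = disc /\ P y p.2].

(** The part of [B] that is reached from [A] is covered by countably many disjoint
Borel pieces [Q i] of [B], each inside a rational ball on which the local bound
holds; the bounds for the pieces add up to at most the integral over [B]. *)
Lemma patch_growth s (B : set E) : P (G z) s -> measurable B -> B `<=` disc ->
  (patch_vol (leaf_patches z) [set y | [/\ A y, L z y & (s @` B) (G y)]] <=
   growth_const%:E * \int[leb]_(x in B) (vol_density s x)%:E)%E.
Proof.
move=> Ps mB BD.
have [_ _ sC1 _ _] := leaf_par_chart Ps.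
have [t0 [u0 [Pt0 _ _]]] := leaf_par_ex (leaf_refl W z).
pose U (c : 'rV[rat]_k * nat) : set 'rV[R]_k := ball (map_mx ratr c.1 : 'rV[R]_k) c.2.+1%:R^-1.
pose good c := forall Q : set E, measurable Q -> Q `<=` U c -> thin_preimage s Q.
(* The pieces are indexed by natural numbers through a coding of rational balls;
   numbers that encode no good ball contribute the empty set. *)
pose D i : set E := if @pickle_inv ('rV[rat]_k * nat)%type i is Some c then
  (if `[< good c >] then B `&` U c else set0) else set0.
have mD i : measurable (D i).
  rewrite /D; case: pickle_inv => [c|//]; case: ifP => // _.
  by apply: measurableI => //; apply: measurable_borel_open; exact: ball_open.
have DB i : D i `<=` B.
  by rewrite /D; case: pickle_inv => [c|//]; case: ifP => // _ x [].
pose Q := seqDU D.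
have mQ i : measurable (Q i) by exact: seqDU_measurable.
have QD i : Q i `<=` D i by exact: subset_seqDU.
have dens_int_ge0 t (Q' : set E) : (0 <= \int[leb]_(x in Q') (vol_density t x)%:E)%E.
  by apply: EFin_integral_ge0 => x; exact: sqrtr_ge0.
have thin0 : thin_preimage s set0.
  exists t0, set0; split; [exact: Pt0|exact: measurable0|exact: sub0set|by move=> y _ []|].
  apply: integral_set0_le; apply: mule_ge0; first exact: growth_const_ge0.
  exact: dens_int_ge0.
have thin i : thin_preimage s (Q i).
  have := QD i; rewrite /D; case: pickle_inv => [c|]; last by rewrite subset0 => ->.
  case: asboolP => [gc h|_]; last by rewrite subset0 => ->.
  by apply: gc => // x /h[].
have /choice[tB htB] i : exists tB : ('rV[R]_k -> M) * set E,
  [/\ P z tB.1, measurable tB.2, tB.2 `<=` disc,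
      (forall y, L z y -> (s @` Q i) (G y) -> (tB.1 @` tB.2) y) &
      (\int[leb]_(x in tB.2) (vol_density tB.1 x)%:E <=
       growth_const%:E * \int[leb]_(x in Q i) (vol_density s x)%:E)%E].
  by have [t [B' h]] := thin i; exists (t, B').
have mV : measurable_fun B (fun x : E => (vol_density s x)%:E) by exact: measurable_vol_density.
have dens_ge0 x : (0 <= (vol_density s x)%:E)%E by rewrite lee_fin sqrtr_ge0.
have UQB : \bigcup_i Q i `<=` B by move=> x [i _ /QD /DB].
have mUQ : measurable (\bigcup_i Q i) by exact: bigcupT_measurable.
apply: (@le_trans _ _ (\sum_(i <oo)
   \int[leb]_(x in (tB i).2) (vol_density (tB i).1 x)%:E)%E).
  apply: patch_vol_le => [i|y [Ay zy [x Bx sx]]].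
    by have [h1 h2 h3 _ _] := htB i; split => //; exists disc.
  have Dx := BD _ Bx.
  have [V [oV Vx hV]] := local_growth Ps Dx zy (esym sx) (A_det Ay).
  have [q [j [qx qV]]] := rV_rational_ball oV Vx.
  have gqj : good (q, j) by move=> Q' mQ' Q'U; apply: hV => //; exact: subset_trans qV.
  have : (\bigcup_i D i) x.
    exists (pickle (q, j)) => //; rewrite /D pickleK_inv; case: asboolP => [_|/(_ gqj)//].
    by split.
  rewrite (seqDU_bigcup_eq D) => -[i _ Qx]; exists i; first exact: I.
  by have [_ _ _ h _] := htB i; exact: (h y zy (ex_intro2 _ _ x Qx sx)).
apply: (@le_trans _ _ (\sum_(i <oo)
   growth_const%:E * \int[leb]_(x in Q i) (vol_density s x)%:E)%E).
  apply: lee_nneseries => [i _ _|i _]; first exact: dens_int_ge0.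
  by have [_ _ _ _ h] := htB i; exact: h.
rewrite nneseriesZl; last by move=> i _; exact: dens_int_ge0.
apply: lee_wpmul2l; first exact: growth_const_ge0.
rewrite -ge0_integral_bigcup//.
- exact: ge0_subset_integral.
- exact: measurable_funS mV.
- exact: trivIset_seqDU.
Qed.

(** A near-optimal covering of the image leaf by patches is pulled back patch by
patch.  The term 1 in [C + 1] pays for the non-optimality of the covering. *)
Lemma leaf_vol_growth (C : R) : (leaf_vol W (G z) (L (G z)) <= C%:E)%E ->
  (leaf_vol W z A <= (growth_const * (C + 1))%:E)%E.
Proof.
move=> volC; rewrite /leaf_vol setIid in volC.
have [B [s [hB cov sumB]]] := patch_vol_adherent (le_lt_trans volC (ltry C)) ltr01.
apply: (@le_trans _ _ (\sum_(i <oo) patch_vol (leaf_patches z)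
   [set y | [/\ A y, L z y & (s i @` B i) (G y)]])%E).
  apply: patch_vol_bigcup => y [Ay zy].
  have [i _ h] := cov _ (iter_leaf F_diffeo F_inv n zy).
  by exists i.
apply: (@le_trans _ _ (\sum_(i <oo)
   growth_const%:E * \int[leb]_(x in B i) (vol_density (s i) x)%:E)%E).
  apply: lee_nneseries => [i _ _|i _]; first exact: patch_vol_ge0.
  have [mBi [D [/= DE Ps] BD]] := hB i; apply: patch_growth => //.
  by rewrite -DE.
rewrite nneseriesZl; last first.
  by move=> i _; apply: integral_ge0 => x _; rewrite lee_fin sqrtr_ge0.
rewrite (EFinM growth_const); apply: lee_wpmul2l; first exact: growth_const_ge0.
by apply: (le_trans sumB); rewrite EFinD leeD2r.
Qed.

End volume_growth.

(** * Birkhoff averages and physical measures *)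

Section compact_continuous.
Context {R : realType} {T : ptopologicalType}.
Hypothesis T_compact : compact [set: T].
Variable mu : probability (borel T) R.

Lemma continuous_borel_measurable (g : T -> R) : continuous g ->
  measurable_fun [set: borel T] (g : borel T -> measurableTypeR R).
Proof.
move=> cg; apply: measurable_borel_real_fun => A oA; rewrite setTI.
by apply: measurable_borel_open; apply: open_comp => // x _; exact: cg.
Qed.

Lemma continuous_compact_bounded (g : T -> R) : continuous g ->
  exists2 K : R, 0 <= K & forall x, `|g x| <= K.
Proof.
move=> cg; have /compact_bounded[K [_ hK]] : compact (g @` setT).
  by apply: continuous_compact => //; exact: continuous_subspaceT.
exists (`|K| + 1); first by rewrite addr_ge0.
move=> x; apply: hK; last by exists x.
by rewrite (le_lt_trans (ler_norm K))// ltrDl.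
Qed.

Lemma continuous_integrable (g : T -> R) : continuous g ->
  mu.-integrable [set: borel T] (EFin \o g).
Proof.
move=> cg; have [K K0 hK] := continuous_compact_bounded cg.
apply: (@measurable_bounded_integrable _ (borel T) R mu g setT) => //.
- exact: le_lt_trans (probability_le1 mu measurableT) (ltry 1).
- exact: continuous_borel_measurable.
- by exists K; split; [exact: num_real|move=> L KL x _; exact: le_trans (hK x) (ltW KL)].
Qed.

End compact_continuous.

Section birkhoff.
Context {R : realType} {m : nat} {M : rmanifold R m}.
Hypothesis M_compact : compact [set: M].
Variables (F : M -> M) (mu : probability (borel M) R).
Hypothesis F_continuous : continuous F.

Definition orbit_sum (g : M -> R) n z : R := \sum_(0 <= i < n) g (iter i F z).

Lemma iter_continuous n : continuous (iter n F).
Proof.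
elim: n => [|n IH] x; first exact: cvg_id.
by apply: (@continuous_comp _ _ _ (iter n F) F); [exact: IH|exact: F_continuous].
Qed.

Lemma orbit_sum_continuous g n : continuous g -> continuous (orbit_sum g n).
Proof.
move=> cg; rewrite /orbit_sum; elim: n => [|n IH] x.
  under eq_fun do rewrite big_geq//; exact: cvg_cst.
under eq_fun do rewrite big_nat_recr//=.
apply: (@cvgD _ _ _ (nbhs x)); first exact: IH.
by apply: (@continuous_comp _ _ _ (iter n F) g); [exact: iter_continuous|exact: cg].
Qed.

Lemma orbit_sum_shift g n z :
  orbit_sum (g \o F) n z = orbit_sum g n z + (g (iter n F z) - g z).
Proof.
have <- := @telescope_sumr R 0 n (fun i => g (iter i F z)) (leq0n n).
rewrite /orbit_sum -big_split/=.
by apply: eq_bigr => i _; rewrite addrC subrK.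
Qed.

(** Time averages along an orbit do not see a shift by one step: for a bounded
function the difference of the averages is [O(1/n)].  This is a substitute for
the invariance of [mu], obtained from a single point of its basin. *)
Lemma basin_Rintegral_comp z g : basin F mu z -> continuous g ->
  \int[mu]_x (g (F x)) = \int[mu]_x g x.
Proof.
move=> bz cg; have cgF : continuous (g \o F).
  by move=> x; apply: (@continuous_comp _ _ _ F g); [exact: F_continuous|exact: cg].
rewrite -(cvg_lim (@Rhausdorff R) (bz _ cgF)); apply: cvg_lim; first exact: Rhausdorff.
have [K K0 hK] := continuous_compact_bounded M_compact cg.
have -> : (fun n => n%:R^-1 * \sum_(0 <= i < n) (g \o F) (iter i F z)) =
    (fun n => n%:R^-1 * orbit_sum g n z) \+ (fun n => n%:R^-1 * (g (iter n F z) - g z)).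
  by apply/funext => n /=; rewrite -mulrDr -orbit_sum_shift.
rewrite -[X in _ --> X]addr0; apply: cvgD; first exact: bz.
rewrite -cvg_shiftS.
apply: (@squeeze_cvgr _ _ _ _ (fun n => - (2 * K * harmonic n)) (fun n => 2 * K * harmonic n)).
- apply: nearW => n; rewrite -ler_norml normrM ger0_norm ?invr_ge0// mulrC.
  apply: ler_wpM2r; first by rewrite invr_ge0.
  by rewrite (le_trans (ler_normB _ _))// mulrDl mul1r lerD.
- rewrite -oppr0 -(mulr0 (2 * K)); apply: cvgN; apply: cvgMr; exact: cvg_harmonic.
- rewrite -(mulr0 (2 * K)); apply: cvgMr; exact: cvg_harmonic.
Qed.

Lemma basin_Rintegral_iter z n g : basin F mu z -> continuous g ->
  \int[mu]_x g (iter n F x) = \int[mu]_x g x.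
Proof.
move=> bz; elim: n g => [//|n IH] g cg.
rewrite -(basin_Rintegral_comp bz cg); apply: (IH (g \o F)).
by move=> x; apply: (@continuous_comp _ _ _ F g); [exact: F_continuous|exact: cg].
Qed.

Lemma basin_Rintegral_orbit_sum z g n : basin F mu z -> continuous g ->
  \int[mu]_x orbit_sum g n x = n%:R * \int[mu]_x g x.
Proof.
move=> bz cg; elim: n => [|n IH].
  have -> : (fun x => orbit_sum g 0 x) = cst 0.
    by apply/funext => x; rewrite /orbit_sum big_geq.
  by rewrite (Rintegral_cst mu measurableT) !mul0r.
have -> : (fun x => orbit_sum g n.+1 x) = (fun x => orbit_sum g n x + g (iter n F x)).
  by apply/funext => x; rewrite /orbit_sum big_nat_recr.
have cgn : continuous (g \o iter n F).
  by move=> x; apply: (@continuous_comp _ _ _ (iter n F) g); [exact: iter_continuous|exact: cg].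
rewrite (RintegralD measurableT
  (continuous_integrable M_compact mu (orbit_sum_continuous cg))
  (continuous_integrable M_compact mu cgn)).
by rewrite IH (basin_Rintegral_iter n bz cg) -natr1 mulrDl mul1r.
Qed.

(** The averages of [g] are uniformly bounded and all have the integral of [g].  By
dominated convergence so does their limit, which is positive almost
everywhere. *)
Lemma basin_Rintegral_gt0 z g : basin F mu z -> continuous g ->
  (\forall x \ae mu, exists2 chi : R, (fun n => n%:R^-1 * orbit_sum g n x) @ \oo --> chi & 0 < chi) ->
  0 < \int[mu]_x g x.
Proof.
move=> bz cg lim; rewrite ltNge; apply/negP => a0.
have [K K0 hK] := continuous_compact_bounded M_compact cg.
have aeF : Filter (nbhs (almost_everywhere mu)) by exact: ae_filter_ringOfSetsType.
(* The index is shifted by one to avoid the average over an empty orbit. *)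
pose avg n (x : M) : R := n.+1%:R^-1 * orbit_sum g n.+1 x.
have cavg n : continuous (avg n).
  by move=> x; apply: cvgMr; exact: orbit_sum_continuous.
pose f_ n (x : borel M) : \bar R := (avg n x)%:E.
(* The upper limit is a measurable version of the limit, which exists only
   almost everywhere. *)
pose f (x : borel M) : \bar R := limn_esup (f_ ^~ x).
have mf_ n : measurable_fun setT (f_ n).
  by apply/measurable_EFinP; exact: continuous_borel_measurable.
have mf : measurable_fun setT f by apply: measurable_fun_limn_esup => n; exact: mf_.
have f_f : {ae mu, forall x, setT x -> f_ ^~ x @ \oo --> f x /\ (0 < f x)%E}.
  apply: filterS lim => x [chi hchi chi0] _.
  have h : f_ ^~ x @ \oo --> chi%:E.
    by apply: cvg_EFin; [exact: nearW|]; move: hchi; rewrite -cvg_shiftS.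
  have fE : f x = chi%:E := (cvg_limn_einf_sup h).2.
  by rewrite fE lte_fin.
have bavg n x : `|avg n x| <= K.
  rewrite normrM ger0_norm ?invr_ge0// ler_pdivrMl// /orbit_sum.
  rewrite (le_trans (ler_norm_sum _ _ _))// (le_trans (ler_sum _ (fun i _ => hK _)))//.
  by rewrite big_const_nat iter_addr_0 subn0 mulr_natl.
have f_f' : {ae mu, forall x, setT x -> f_ ^~ x @ \oo --> f x}.
  by apply: filterS f_f => x h Tx; exact: (h Tx).1.
have [intf _ cvgf] := dominated_convergence measurableT mf_ mf f_f'
  (finite_measure_integrable_cst mu K measurableT)
  (aeW mu (fun x n _ => bavg n x)).
have If n : (\int[mu]_x f_ n x = (\int[mu]_x g x)%:E)%E.
  rewrite -[LHS]fineK; last first.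
    by apply: integrable_fin_num => //; exact: continuous_integrable.
  congr EFin; rewrite -/(Rintegral _ _ _).
  rewrite (RintegralZl _ measurableT (continuous_integrable M_compact mu (orbit_sum_continuous cg))).
  by rewrite (basin_Rintegral_orbit_sum _ bz cg) mulrA mulVf ?mul1r// pnatr_eq0.
have {cvgf} If0 : (\int[mu]_x f x = (\int[mu]_x g x)%:E)%E.
  rewrite -(cvg_lim (@ereal_hausdorff R) cvgf); apply: cvg_lim; first exact: ereal_hausdorff.
  by under eq_fun do rewrite If; exact: cvg_cst.
have absfE : (\int[mu]_x `|f x| = \int[mu]_x f x)%E.
  have mabs : measurable_fun setT (fun x => `|f x|%E) by exact: measurableT_comp.
  apply: (@ae_eq_integral _ _ _ mu setT f _ measurableT mabs mf).
  by apply: filterS f_f => x h Tx; apply: gee0_abs; exact: ltW (h Tx).2.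
have absf : (\int[mu]_x `|f x| = 0)%E.
  apply/eqP; rewrite eq_le; apply/andP; split; first by rewrite absfE If0 lee_fin.
  exact: integral_ge0.
have /(ae_eq_integral_abs mu measurableT mf) f0 := absf.
have : {ae mu, forall x, False}.
  apply: filterS2 f0 f_f => x h1 h2.
  by have [_] := h2 I; rewrite h1// ltxx.
move=> [N [mN N0 sN]].
have : (mu setT <= 0)%E by rewrite -N0; apply: le_measure; rewrite ?inE// => x _; apply: sN.
by rewrite leNgt (_ : mu setT = 1%E) ?lte01//; exact: probability_setT.
Qed.

End birkhoff.

(** * Absolutely continuous foliations and the theorem *)

Section volume_facts.
Context {R : realType} {m : nat} {M : rmanifold R m}.
Local Open Scope ereal_scope.

Lemma vol_ge0 (A : set M) : 0 <= vol A.
Proof. exact: patch_vol_ge0. Qed.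

Lemma vol_set0 : vol (set0 : set M) = 0.
Proof. by apply: (@patch_vol0 R m M m _ (chart (point : M) @` cdom point) (param point)); exists point. Qed.

Lemma volS (A B : set M) : A `<=` B -> vol A <= vol B.
Proof. exact: patch_volS. Qed.

Lemma vol_bigcup_gt0 (A : set M) (F : nat -> set M) :
  A `<=` \bigcup_i F i -> 0 < vol A -> exists i, 0 < vol (F i).
Proof.
move=> AF; apply: contraPP; rewrite -forallNE => F0.
apply/negP; rewrite -leNgt; apply: (le_trans (patch_vol_bigcup _ AF)).
rewrite eseries0// => i _ _; apply/eqP; rewrite eq_le; apply/andP; split.
  by rewrite leNgt; apply/negP; exact: F0.
exact: vol_ge0.
Qed.

End volume_facts.

Section absolutely_continuous_foliation.
Context {R : realType} {m : nat} {M : rmanifold R m} {k : nat} (W : foliation M k 1).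
Hypothesis M_compact : compact [set: M].

Local Notation D := (disc R k `*` disc R (m - k)).

(** By compactness finitely many foliation boxes cover [M]. *)
Lemma box_vol_gt0 (A : set M) : (0 < vol A)%E ->
  exists2 phi, foliation_box 1 (leaf W) (leaf_par W) phi & (0 < vol (A `&` phi @` D))%E.
Proof.
move=> A0; have /choice[box hbox] z : exists phi,
    foliation_box 1 (leaf W) (leaf_par W) phi /\ (phi @` D) z.
  by have [phi h1 h2] := leaf_box W z; exists phi.
have := M_compact; rewrite compact_cover => cpt.
have [] := cpt M setT (fun z => box z @` D).
- by move=> z _; have [[_ _ o _ _] _] := hbox z; apply: o => //; apply: open_setX; exact: disc_open.
- by move=> z _; exists z => //; exact: (hbox z).2.
move=> S _ cov; pose s : seq M := finmap.enum_fset S.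
have [|i vi] := @vol_bigcup_gt0 R m M A (fun i => A `&` box (nth point s i) @` D) _ A0.
  move=> z Az; have [w Sw zw] := cov z I.
  by exists (index w s) => //; split => //; rewrite nth_index.
by exists (box (nth point s i)) => //; exact: (hbox _).1.
Qed.

(** In a box that meets [A] in positive volume, a set of plaques of positive transversal
measure has conditional measures that charge [A].  On some of them the conditional
measure is absolutely continuous, so that leaf volume charges [A] too. *)
Lemma leaf_vol_gt0 (A : set (borel M)) : absolutely_continuous W -> measurable A ->
  (0 < vol A)%E -> exists z, (0 < leaf_vol W z A)%E.
Proof.
move=> AC mA /box_vol_gt0[phi phibox].
have [nu [kappa [[nuE _ disE] bad0]]] := AC _ phibox.
rewrite disE// => int0; apply: contrapT; rewrite -forallNE => leaf0.
have mk : measurable_fun setT (fun p => kappa p A) := measurable_kernel kappa A mA.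
(* If no leaf charges [A], every plaque over [Q] lies in the exceptional set of
   absolute continuity. *)
pose Q : set (borel 'rV[R]_(m - k)) := [set p | (0 < kappa p A)%E].
have mQ : measurable Q.
  rewrite (_ : Q = setT `&` (fun p => kappa p A) @^-1` `]0%E, +oo[%classic).
    by apply: mk => //; exact: emeasurable_itv.
  by rewrite setTI; apply/seteqP; split => p; rewrite /Q /= in_itv/= andbT.
have nuQ0 : nu Q = 0%E.
  rewrite nuE//; apply/eqP; rewrite eq_le; apply/andP; split; last exact: vol_ge0.
  rewrite -bad0; apply: volS => _ [[x p] [/= Dx [Dp Qp]] <-].
  exists x, p; split => // dom; move: Qp; rewrite /Q /=.
  rewrite (dom A)//; first by rewrite ltxx.
  move=> B mB BA; apply/eqP; rewrite eq_le; apply/andP; split; last exact: patch_vol_ge0.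
  have /negP := leaf0 (phi (x, p)); rewrite -leNgt; apply: le_trans.
  by apply: patch_volS => y [By Ly]; split => //; exact: BA.
move: int0; rewrite (_ : (\int[nu]_p kappa p A = 0)%E) ?ltxx//.
rewrite -(integral0 nu setT); apply: ae_eq_integral => //.
exists Q; split => // p /= /not_implyP[_ h].
by rewrite /Q /= lt0e measure_ge0 andbT; apply/eqP.
Qed.

End absolutely_continuous_foliation.

Section expansion_times.
Context {R : realType} {m : nat} {M : rmanifold R m}.
Variables (F : M -> M) (g : M -> R) (a : R).
Hypothesis F_continuous : continuous F.
Hypothesis g_continuous : continuous g.

Definition late_growth N : set M :=
  [set z | forall n, (N <= n)%N -> n%:R * a <= orbit_sum F g n z].

Lemma late_growth_closed N : closed (late_growth N).
Proof.
rewrite (_ : late_growth N = \bigcap_(n in [set n | (N <= n)%N])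
    (orbit_sum F g n @^-1` [set r | n%:R * a <= r])); last first.
  by apply/seteqP; split.
apply: closed_bigI => n _; apply: closed_comp; last exact: closed_ge.
by move=> z _; exact: orbit_sum_continuous.
Qed.

Lemma late_growth_cover z c : (fun n => n%:R^-1 * orbit_sum F g n z) @ \oo --> c -> a < c ->
  (\bigcup_N late_growth N) z.
Proof.
move=> cvgc ac; have [N _ hN] : \forall n \near \oo, a < n%:R^-1 * orbit_sum F g n z.
  exact: (cvgr_gt c cvgc a ac).
exists N => // -[_|n Nn]; first by rewrite mul0r /orbit_sum big_geq.
by have := ltW (hN _ Nn); rewrite ler_pdivlMl.
Qed.

End expansion_times.

(** It is enough to compare with the linear lower bound of the exponential. *)
Lemma expR_bound_le0 (R : realType) (r K a : R) N : 0 < a ->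
  (forall n, (N <= n)%N -> r <= K / expR (n%:R * a)) -> r <= 0.
Proof.
move=> a0 h; rewrite leNgt; apply/negP => r0.
pose n := maxn N (Num.truncn (K / (r * a))).+1.
have := h n (leq_maxl _ _); rewrite ler_pdivlMr ?expR_gt0// leNgt => /negP; apply.
have Kn : K < n%:R * (r * a).
  rewrite -ltr_pdivrMr ?mulr_gt0//; apply: (lt_le_trans (truncnS_gt _)).
  by rewrite ler_nat leq_maxr.
apply: (lt_le_trans Kn); rewrite mulrCA ler_pM2l//.
by rewrite (le_trans _ (expR_ge1Dx _))// lerDr.
Qed.

Theorem theorem7p10 (R : realType) (m : nat) (M : rmanifold R m) (F : M -> M)
    (mu : probability (borel M) R) (k : nat) (W : foliation M k 1)
    (M_compact : compact [set: M])
    (F_C2 : Ck_map 2 [set: M] F)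
    (F_ph : partially_hyperbolic F)
    (mu_physical : physical F mu)
    (W_invariant : invariant_foliation W F)
    (W_bounded : exists C : R, forall z : M, (leaf_vol W z (leaf W z) <= C%:E)%E)
    (F_leaf_inj : forall z : M, set_inj (leaf W z) F)
    (chi_pos : \forall z \ae mu,
       exists2 chi : R, is_leaf_exponent W F z chi & 0 < chi) :
  ~ absolutely_continuous W.
Proof.
move=> AC.
have F_diffeo : local_diffeo 1 F := F_ph.1.
have cF : continuous F by move=> z; exact: F_C2.1.
have [C volC] := W_bounded.
pose g (z : M) : R := ln (leaf_det W F z).
have cg : continuous g.
  move=> z; apply: (@continuous_comp _ _ _ (leaf_det W F) (@ln R)).
    exact: leaf_det_continuous.
  exact: continuous_ln (leaf_det_iter_gt0 W F_diffeo 1 z).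
have gE n z : orbit_sum F g n z = ln (leaf_det W (iter n F) z).
  by rewrite (ln_leaf_det_iter F_diffeo W_invariant).
have [z0 bz0] : exists z, basin F mu z.
  apply: contrapT; rewrite -forallNE => b0; move: mu_physical; rewrite /physical.
  by rewrite (_ : basin F mu = set0) ?vol_set0 ?ltxx//; apply/seteqP; split => // z /b0.
have aeF : Filter (nbhs (almost_everywhere mu)) by exact: ae_filter_ringOfSetsType.
have a0 : 0 < \int[mu]_x g x.
  apply: (basin_Rintegral_gt0 M_compact cF bz0 cg).
  apply: filterS chi_pos => z [chi hchi chi0]; exists chi => //.
  by move: hchi; rewrite /is_leaf_exponent; under eq_fun do rewrite -gE mulrC.
pose a := (\int[mu]_x g x) / 2.
have ha : a < \int[mu]_x g x by rewrite ltr_pdivrMr// ltr_pMr// ltr1n.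
have ha0 : 0 < a by rewrite divr_gt0.
have [|N volN] := vol_bigcup_gt0 (F := late_growth F g a) _ mu_physical.
  by move=> z bz; exact: (late_growth_cover (bz _ cg)).
have mN : measurable (late_growth F g a N : set (borel M)).
  by apply: measurable_borel_closed; exact: late_growth_closed.
have [z vz] := leaf_vol_gt0 M_compact AC mN volN.
have bound n : (N <= n)%N ->
    (leaf_vol W z (late_growth F g a N) <=
     (4 * distortion R k * (C + 1) / expR (n%:R * a))%:E)%E.
  move=> Nn; have expand y : late_growth F g a N y ->
      expR (n%:R * a) <= leaf_det W (iter n F) y.
    move=> /(_ n Nn); rewrite gE -ler_expR lnK// posrE.
    exact: leaf_det_iter_gt0.
  have := leaf_vol_growth F_diffeo W_invariant F_leaf_inj (expR_gt0 _) expand (volC _).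
  by rewrite /growth_const mulrAC.
have fin : leaf_vol W z (late_growth F g a N) \is a fin_num.
  rewrite ge0_fin_numE; last exact: patch_vol_ge0.
  exact: le_lt_trans (bound N (leqnn N)) (ltry _).
move: vz; rewrite -(fineK fin) lte_fin ltNge => /negP; apply.
apply: (@expR_bound_le0 R _ (4 * distortion R k * (C + 1)) a N ha0) => n Nn.
by rewrite -lee_fin fineK// bound.
Qed.
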